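(* Let $G$ be a connected directed graph that is not strongly connected. Then every bounded derivation on $\mathcal{A}_G$ is inner (i.e. of the form $\delta_T$ with $T\in\mathcal{A}_G$) if and only if $G$ is a fruit tree that contains no in-fruit.
   Context: A directed graph $G=(\mathcal{V},\mathcal{E},s,r)$ has a vertex set $\mathcal{V}$ and an edge set $\mathcal{E}$ (each of arbitrary cardinality; loops and multiple edges allowed) and source and range maps $s,r\colon\mathcal{E}\to\mathcal{V}$; an edge $e$ is an arrow from $s(e)$ to $r(e)$. $\mathbb{F}_G^+$ is the set of all directed paths of finite length: vertices $v$ are paths of length $0$ with $r(v)=s(v)=v$, and a path of length $n\geq1$ is $p=e_1e_2\cdots e_n$ with $s(e_j)=r(e_{j+1})$, $r(p)=r(e_1)$, $s(p)=s(e_n)$; if $s(p_1)=r(p_2)$, the product $p_1p_2$ is the concatenation. Let $\mathcal{H}_G=\ell^2(\mathbb{F}_G^+)$ with orthonormal basis $\{\xi_w\}$. For $e\in\mathcal{E}$, $L_e\xi_w=\xi_{ew}$ if $r(w)=s(e)$ and $0$ otherwise; for $x\in\mathcal{V}$, $L_x\xi_w=\xi_w$ if $r(w)=x$ and $0$ otherwise. $\mathcal{A}_G$ is the norm-closed algebra generated by $\{L_e,L_x\}$ in $B(\mathcal{H}_G)$. A derivation on $\mathcal{A}_G$ is a linear map $\delta\colon\mathcal{A}_G\to\mathcal{A}_G$ with $\delta(AB)=\delta(A)B+A\delta(B)$; $\delta_T(A)=AT-TA$. $G$ is strongly connected if for any vertices $x,y$ there is a directed path from $x$ to $y$ (a single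 vertex with no edge is strongly connected). Connectedness refers to the underlying undirected graph. The $n$-circle graph $\mathscr{C}_n$ ($n\geq1$) has distinct vertices $v_1,\dots,v_n$ and edges $e_1,\dots,e_n$ with $r(e_j)=v_j$, $s(e_j)=v_{j+1\,(\mathrm{mod}\,n)}$. A polygon of length $n\geq1$ is a set of distinct vertices $v_1,\dots,v_n$ and distinct edges $e_1,\dots,e_n$ with $\{r(e_j),s(e_j)\}=\{v_j,v_{j+1\,(\mathrm{mod}\,n)}\}$. A generalized tree is a connected directed graph with at least two vertices containing no polygon; a leaf is a vertex of it of degree one (total number of incident edges). Let $G_t$ be a generalized tree with vertex set $\mathcal{V}_t$, $V=\{v_\lambda\}$ a (possibly empty) subset of its leaves with $V\neq\mathcal{V}_t$, $e_\lambda$ the unique edge of $G_t$ between $v_\lambda$ and $\mathcal{V}_t\setminus\{v_\lambda\}$, and $G_f$ a directed graph whose connected components are circle graphs $\mathscr{C}_{n_\lambda}$, one for each $v_\lambda$. The graph $G_t\sqcup_V G_f$ obtained by identifying each $v_\lambda$ with a vertex of $\mathscr{C}_{n_\lambda}$ (no other identifications; the edge set is the disjoint union) is called a generalized fruit tree, and a fruit tree if it has finitely many vertices. The circle $\mathscr{C}_{n_\lambda}$ is called an out-fruit if $s(e_\lambda)=v_\lambda$ and an in-fruit otherwise, i.e. if $r(e_\lambda)=v_\lambda$. *)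

(* Defs.v *)
From HB Require Import structures.
From Stdlib Require Import Relations.
From mathcomp Require Import all_boot all_order all_algebra.
From mathcomp Require Import complex lra ring.
From mathcomp Require Import finmap.
From mathcomp Require Import all_classical all_reals all_analysis.

Set Implicit Arguments.
Unset Strict Implicit.
Unset Printing Implicit Defensive.

Import Order.TTheory GRing.Theory Num.Theory ComplexField.Normc.
Import numFieldNormedType.Exports.

Local Open Scope classical_set_scope.
Local Open Scope ring_scope.
Local Open Scope complex_scope.

Section Ell2.
Variables (R : realType) (I : choiceType).
Local Notation C := R[i].

Definition l2_summable : {pred I -> C^o} :=
  fun f => (\esum_(i in [set: I]) (normc (f i) ^+ 2)%:E < +oo)%E.

Record ell2 := Ell2 { ell2_fun :> I -> C^o; _ : ell2_fun \in l2_summable }.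
HB.instance Definition _ := [isSub for ell2_fun].
HB.instance Definition _ := [Choice of ell2 by <:].

Lemma l2P (f : I -> C^o) (M : R) :
  (forall s : seq I, uniq s -> \sum_(i <- s) normc (f i) ^+ 2 <= M) ->
  (\esum_(i in [set: I]) (normc (f i) ^+ 2)%:E <= M%:E)%E.
Proof.
move=> H; apply: ge_ereal_sup => _ [F [finF _] <-].
rewrite fsbig_finite//= sumEFin lee_fin; exact/H/fset_uniq.
Qed.

Lemma sum_l2 (f : I -> C^o) (s : seq I) : uniq s ->
  ((\sum_(i <- s) normc (f i) ^+ 2)%:E <=
     \esum_(i in [set: I]) (normc (f i) ^+ 2)%:E)%E.
Proof.
move=> us; apply: esum_ge; exists [set` s].
  by split=> //; exact: finite_seq.
by rewrite -fsbig_seq// sumEFin.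
Qed.

Definition l2norm (f : I -> C^o) : R :=
  Num.sqrt (fine (\esum_(i in [set: I]) (normc (f i) ^+ 2)%:E)).

Lemma esum_l2_ge0 (f : I -> C^o) :
  (0 <= \esum_(i in [set: I]) (normc (f i) ^+ 2)%:E)%E.
Proof. by apply: esum_ge0 => i _; rewrite lee_fin sqr_ge0. Qed.

Lemma l2norm_ge0 f : 0 <= l2norm f. Proof. exact: sqrtr_ge0. Qed.

Lemma l2norm_sqr f : l2norm f ^+ 2 =
  fine (\esum_(i in [set: I]) (normc (f i) ^+ 2)%:E).
Proof. by rewrite sqr_sqrtr// fine_ge0// esum_l2_ge0. Qed.

Lemma sum_le_l2norm (f : I -> C^o) (s : seq I) : f \in l2_summable -> uniq s ->
  \sum_(i <- s) normc (f i) ^+ 2 <= l2norm f ^+ 2.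
Proof.
move=> fl us; rewrite l2norm_sqr -lee_fin fineK ?sum_l2//.
by rewrite ge0_fin_numE ?esum_l2_ge0.
Qed.

Lemma l2_bound (f : I -> C^o) (M : R) :
  (forall s : seq I, uniq s -> \sum_(i <- s) normc (f i) ^+ 2 <= M) ->
  f \in l2_summable /\ l2norm f ^+ 2 <= M.
Proof.
move=> /l2P H; have fl : f \in l2_summable by exact: le_lt_trans H (ltry _).
split=> //; rewrite l2norm_sqr -lee_fin fineK//.
by rewrite ge0_fin_numE ?esum_l2_ge0.
Qed.

Lemma normc_ge0 (z : C) : 0 <= normc z.
Proof. by case: z => a b; exact: sqrtr_ge0. Qed.

Lemma l2_submod_closed : submod_closed l2_summable.
Proof.
split=> [|a f g fl gl].
  have [] // := @l2_bound (0 : I -> C^o) 0 => s _.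
  by rewrite big1// => i _; rewrite [X in normc X](_ : _ = 0%C)// normc0 expr0n.
pose M := 2 * (normc a ^+ 2 * l2norm f ^+ 2 + l2norm g ^+ 2).
have [] // := @l2_bound (a *: f + g) M => s us.
apply: le_trans (_ : \sum_(i <- s) 2 * (normc a ^+ 2 * normc (f i) ^+ 2
   + normc (g i) ^+ 2) <= _).
  apply: ler_sum => i _ /=.
  have h : normc ((a *: f + g) i) <= normc a * normc (f i) + normc (g i).
    by rewrite -normcM; exact: le_normcD.
  apply: le_trans (_ : (normc a * normc (f i) + normc (g i)) ^+ 2 <= _).
    by rewrite lerXn2r ?nnegrE ?normc_ge0// addr_ge0 ?mulr_ge0 ?normc_ge0.
  rewrite -exprMn -subr_ge0.
  set x := normc a * _; set y := normc (g i).
  rewrite (_ : _ - _ = (x - y) ^+ 2) ?sqr_ge0//.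
  by ring.
rewrite -mulr_sumr big_split/= -mulr_sumr ler_wpM2l// lerD//.
  by rewrite ler_wpM2l ?sqr_ge0// sum_le_l2norm.
exact: sum_le_l2norm.
Qed.

HB.instance Definition _ :=
  GRing.isSubmodClosed.Build _ _ l2_summable l2_submod_closed.
HB.instance Definition _ := [SubChoice_isSubLmodule of ell2 by <:].
End Ell2.

Arguments l2_summable {R I}.


Section Ell2Norm.
Variables (R : realType) (I : choiceType).
Local Notation C := R[i].
Local Notation H := (ell2 R I).
Implicit Types f g : H.

Lemma ell2P f : (f : I -> C^o) \in l2_summable.
Proof. exact: valP. Qed.

Lemma ell2_ext f g : f =1 g -> f = g.
Proof. by move=> fg; apply/val_inj/funext. Qed.

Lemma l2norm_le (f : I -> C^o) (M : R) : 0 <= M ->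
  (forall s : seq I, uniq s -> \sum_(i <- s) normc (f i) ^+ 2 <= M ^+ 2) ->
  l2norm f <= M.
Proof.
move=> M0 /l2_bound[_ h]; rewrite -(@ler_pXn2r _ 2)// nnegrE l2norm_ge0//.
Qed.

Lemma normc_le_l2norm f i : normc (f i) <= l2norm f.
Proof.
have /= := sum_le_l2norm (ell2P f) (s := [:: i]) isT.
by rewrite big_seq1 ler_pXn2r// nnegrE ?normc_ge0 ?l2norm_ge0.
Qed.

Lemma l2norm0_eq0 f : l2norm f = 0 -> f = 0.
Proof.
move=> f0; apply: ell2_ext => i; apply: (@eq0_normc R); apply/eqP.
by rewrite eq_le normc_ge0 -f0 normc_le_l2norm.
Qed.

Lemma l2norm_0 : l2norm (0 : H) = 0.
Proof.
apply/eqP; rewrite eq_le l2norm_ge0 andbT; apply: l2norm_le => // s _.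
rewrite big1 ?sqr_ge0// => i _.
by rewrite [X in normc X](_ : _ = 0%C)// normc0 expr0n.
Qed.

Lemma l2normZ_le (a : C) f : l2norm (a *: f) <= normc a * l2norm f.
Proof.
apply: l2norm_le => [|s us]; first by rewrite mulr_ge0 ?normc_ge0 ?l2norm_ge0.
under eq_bigr => i _.
  rewrite [X in normc X](_ : _ = a * (f i : C))// normcM exprMn; over.
by rewrite -mulr_sumr exprMn ler_wpM2l ?sqr_ge0// sum_le_l2norm// ell2P.
Qed.

Lemma l2normZ (a : C) f : l2norm (a *: f) = normc a * l2norm f.
Proof.
apply/eqP; rewrite eq_le l2normZ_le/=.
have [->|a0] := eqVneq a 0; first by rewrite normc0 mul0r l2norm_ge0.
have na0 : 0 < normc a.
  by rewrite lt_neqAle normc_ge0 andbT eq_sym; apply: contra a0 => /eqP/eq0_normc->.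
rewrite -ler_pdivlMl// -normcV.
by have := l2normZ_le a^-1 (a *: f); rewrite scalerA mulVf// scale1r.
Qed.

Lemma l2normD f g : l2norm (f + g) <= l2norm f + l2norm g.
Proof.
have [/l2norm0_eq0->|a0] := eqVneq (l2norm f) 0.
  by rewrite add0r lerDr l2norm_ge0.
have [/l2norm0_eq0->|b0] := eqVneq (l2norm g) 0.
  by rewrite addr0 lerDl l2norm_ge0.
have {}a0 : 0 < l2norm f by rewrite lt_neqAle eq_sym a0 l2norm_ge0.
have {}b0 : 0 < l2norm g by rewrite lt_neqAle eq_sym b0 l2norm_ge0.
apply: l2norm_le => [|s us]; first by rewrite addr_ge0// ltW.
have := sum_le_l2norm (ell2P f) us; have := sum_le_l2norm (ell2P g) us.
move: (l2norm f) (l2norm g) a0 b0 => a b a0 b0 sg sf.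
apply: le_trans (_ : \sum_(i <- s) (a + b) * (a^-1 * normc (f i) ^+ 2
   + b^-1 * normc (g i) ^+ 2) <= _).
  apply: ler_sum => i _ /=.
  have h : normc ((f + g) i) <= normc (f i) + normc (g i) by exact: le_normcD.
  apply: le_trans (_ : (normc (f i) + normc (g i)) ^+ 2 <= _).
    by rewrite lerXn2r ?nnegrE ?normc_ge0// addr_ge0 ?normc_ge0.
  rewrite -subr_ge0; set x := normc (f i); set y := normc (g i).
  rewrite (_ : _ - _ = (a * b)^-1 * (b * x - a * y) ^+ 2).
    by rewrite mulr_ge0 ?sqr_ge0// invr_ge0 mulr_ge0// ltW.
  by field; rewrite !gt_eqF.
rewrite -mulr_sumr big_split/= -!mulr_sumr [leRHS]expr2.
apply: ler_wpM2l; first by rewrite addr_ge0// ltW.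
by rewrite lerD// ler_pdivrMl// -expr2.
Qed.

Lemma ell2_normD f g : (l2norm (f + g))%:C <= (l2norm f)%:C + (l2norm g)%:C.
Proof. by rewrite -rmorphD/= lecR l2normD. Qed.

Lemma ell2_normZ (a : C) f : (l2norm (a *: f))%:C = `|a| * (l2norm f)%:C.
Proof. by rewrite l2normZ rmorphM. Qed.

Lemma ell2_norm0 f : (l2norm f)%:C = 0 -> f = 0.
Proof. by move=> /eqP; rewrite (inj_eq (@complexI R) _ 0) => /eqP/l2norm0_eq0. Qed.

HB.instance Definition _ :=
  Lmodule_isNormed.Build C H ell2_normD ell2_normZ ell2_norm0.

Lemma ell2_normE f : `|f| = (l2norm f)%:C. Proof. by []. Qed.

End Ell2Norm.

Section BoundedOperators.
Variables (R : realType) (I : choiceType).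
Local Notation C := R[i].
Local Notation H := (ell2 R I).

Definition bounded_linear : {pred H -> H} := fun T =>
  `[< linear T /\ exists M : R, forall x, l2norm (T x) <= M * l2norm x >].

Record bop := Bop { bop_fun :> H -> H; _ : bop_fun \in bounded_linear }.
HB.instance Definition _ := [isSub for bop_fun].
HB.instance Definition _ := [Choice of bop by <:].
Implicit Types (S T : bop) (x : H).

Lemma bounded_linear_submod_closed : submod_closed bounded_linear.
Proof.
split=> [|a S T /asboolP[lS [M SM]] /asboolP[lT [N TN]]]; apply/asboolP.
  split=> [c x y|]; first by rewrite scaler0 addr0.
  by exists 0 => x; rewrite mul0r (_ : (0 : H -> H) x = 0)// l2norm_0.
split=> [c x y|].
  rewrite [LHS](_ : _ = a *: S (c *: x + y) + T (c *: x + y))//.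
  rewrite [RHS](_ : _ = c *: (a *: S x + T x) + (a *: S y + T y))//.
  by rewrite lS lT !scalerDr !scalerA (mulrC a) addrACA.
exists (normc a * M + N) => x.
rewrite mulrDl -mulrA; apply: le_trans (l2normD (a *: S x) (T x)) _.
by rewrite l2normZ lerD// ler_wpM2l ?normc_ge0.
Qed.

HB.instance Definition _ :=
  GRing.isSubmodClosed.Build _ _ bounded_linear bounded_linear_submod_closed.
HB.instance Definition _ := [SubChoice_isSubLmodule of bop by <:].

Lemma bop_linear (T : bop) : linear T.
Proof. by have /asboolP[] := valP T. Qed.

Lemma bop_ext (S T : bop) : S =1 T -> S = T.
Proof. by move=> ST; apply/val_inj/funext. Qed.

Definition opnorm (T : bop) : R :=
  sup [set l2norm (T x) | x in [set x : H | l2norm x <= 1]].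

Lemma bop_bounded (T : bop) :
  exists2 M : R, 0 <= M & forall x, l2norm (T x) <= M * l2norm x.
Proof.
have /asboolP[_ [M TM]] := valP T; exists `|M| => // x.
by rewrite (le_trans (TM x))// ler_wpM2r ?l2norm_ge0// ler_norm.
Qed.

Lemma bopZ (T : bop) (a : C) (x : H) : T (a *: x) = a *: T x.
Proof.
have lT := bop_linear T.
have T0 : T 0 = 0.
  apply: (addrI (T 0)); rewrite addr0.
  by apply/esym; have := lT 1 0 0; rewrite !scale1r addr0; apply.
by have := lT a x 0; rewrite T0 !addr0.
Qed.

Lemma bop0 (T : bop) : T 0 = 0.
Proof. by have := bopZ T 0 0; rewrite !scale0r. Qed.

Lemma opnorm_has_sup (T : bop) :
  has_sup [set l2norm (T x) | x in [set x : H | l2norm x <= 1]].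
Proof.
have [M M0 TM] := bop_bounded T; split.
  by exists (l2norm (T 0)), 0 => //=; rewrite l2norm_0.
by exists M => _ [x /= x1 <-]; rewrite (le_trans (TM x))// ler_piMr.
Qed.

Lemma opnorm_ge0 T : 0 <= opnorm T.
Proof.
apply: (le_trans (l2norm_ge0 (T 0))); apply: ub_le_sup.
  by have [] := opnorm_has_sup T.
by exists 0 => //=; rewrite l2norm_0.
Qed.

Lemma le_opnorm T x : l2norm (T x) <= opnorm T * l2norm x.
Proof.
have [/l2norm0_eq0->|x0] := eqVneq (l2norm x) 0.
  by rewrite bop0 l2norm_0 mulr0.
have {}x0 : 0 < l2norm x by rewrite lt_neqAle eq_sym x0 l2norm_ge0.
have n : normc ((l2norm x)^-1)%:C = (l2norm x)^-1.
  by apply: complexI; rewrite -[LHS]/(`|((l2norm x)^-1)%:C|) ger0_norm// lecR invr_ge0 ltW.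
rewrite -ler_pdivrMr// mulrC -n -l2normZ -bopZ; apply: ub_le_sup.
  by have [] := opnorm_has_sup T.
by exists (((l2norm x)^-1)%:C *: x) => //=; rewrite l2normZ n mulVf// gt_eqF.
Qed.

Lemma opnorm_le T M : 0 <= M -> (forall x, l2norm (T x) <= M * l2norm x) ->
  opnorm T <= M.
Proof.
move=> M0 TM; apply: ge_sup; first by have [] := opnorm_has_sup T.
by move=> _ [x /= x1 <-]; rewrite (le_trans (TM x))// ler_piMr.
Qed.

Lemma opnormD_le S T : opnorm (S + T) <= opnorm S + opnorm T.
Proof.
apply: opnorm_le => [|x]; first by rewrite addr_ge0 ?opnorm_ge0.
by rewrite mulrDl (le_trans (l2normD (S x) (T x)))// lerD ?le_opnorm.
Qed.

Lemma opnormZ_le (a : C) T : opnorm (a *: T) <= normc a * opnorm T.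
Proof.
apply: opnorm_le => [|x]; first by rewrite mulr_ge0 ?opnorm_ge0 ?normc_ge0.
by rewrite [leLHS](l2normZ a (T x)) -mulrA ler_wpM2l ?normc_ge0 ?le_opnorm.
Qed.

Lemma opnormZ (a : C) T : opnorm (a *: T) = normc a * opnorm T.
Proof.
apply/eqP; rewrite eq_le opnormZ_le/=.
have [->|a0] := eqVneq a 0; first by rewrite normc0 mul0r opnorm_ge0.
have na0 : 0 < normc a.
  by rewrite lt_neqAle normc_ge0 andbT eq_sym; apply: contra a0 => /eqP/eq0_normc->.
rewrite -ler_pdivlMl// -normcV.
by have := opnormZ_le a^-1 (a *: T); rewrite scalerA mulVf// scale1r.
Qed.

Lemma bop_normD S T : (opnorm (S + T))%:C <= (opnorm S)%:C + (opnorm T)%:C.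
Proof. by rewrite -rmorphD/= lecR opnormD_le. Qed.

Lemma bop_normZ (a : C) T : (opnorm (a *: T))%:C = `|a| * (opnorm T)%:C.
Proof. by rewrite opnormZ rmorphM. Qed.

Lemma bop_norm0 T : (opnorm T)%:C = 0 -> T = 0.
Proof.
move=> /complexI T0; apply: bop_ext => x; apply: l2norm0_eq0; apply/eqP.
by rewrite eq_le l2norm_ge0 andbT (le_trans (le_opnorm T x))// T0 mul0r.
Qed.

HB.instance Definition _ :=
  Lmodule_isNormed.Build C bop bop_normD bop_normZ bop_norm0.

Lemma bounded_linear_id : id \in bounded_linear.
Proof. by apply/asboolP; split=> //; exists 1 => x; rewrite mul1r. Qed.

Lemma bounded_linear_comp (S T : bop) : S \o T \in bounded_linear.
Proof.
apply/asboolP; split=> [c x y|]; first by rewrite /= !bop_linear.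
exists (opnorm S * opnorm T) => x /=.
rewrite (le_trans (le_opnorm _ _))// -mulrA ler_wpM2l ?opnorm_ge0//.
exact: le_opnorm.
Qed.

Definition bop_id : bop := Bop bounded_linear_id.
Definition bop_comp (S T : bop) : bop := Bop (bounded_linear_comp S T).

Lemma bop_compA : associative bop_comp.
Proof. by move=> S T U; exact: bop_ext. Qed.
Lemma bop_comp1l : left_id bop_id bop_comp.
Proof. by move=> S; exact: bop_ext. Qed.
Lemma bop_comp1r : right_id bop_id bop_comp.
Proof. by move=> S; exact: bop_ext. Qed.
Lemma bop_compDl : left_distributive bop_comp +%R.
Proof. by move=> S T U; exact: bop_ext. Qed.
Lemma bop_compDr : right_distributive bop_comp +%R.
Proof.
move=> S T U; apply: bop_ext => x /=.
by have := bop_linear S 1 (T x) (U x); rewrite !scale1r.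
Qed.

HB.instance Definition _ := GRing.Zmodule_isPzRing.Build bop
  bop_compA bop_comp1l bop_comp1r bop_compDl bop_compDr.

End BoundedOperators.

Lemma bopM (R : realType) (I : choiceType) (S T : bop R I) x :
  (S * T) x = S (T x).
Proof. by []. Qed.

Lemma bop_normE (R : realType) (I : choiceType) (T : bop R I) :
  `|T| = (opnorm T)%:C.
Proof. by []. Qed.

Section BasisVectors.
Variables (R : realType) (I : choiceType).
Local Notation C := R[i].

Lemma xi_summable (i : I) :
  (fun j => (j == i)%:R : C^o) \in l2_summable.
Proof.
suff /l2_bound[] : forall s : seq I, uniq s ->
    \sum_(j <- s) normc ((j == i)%:R : C) ^+ 2 <= 1 :> R by [].
move=> s us; under eq_bigr => j _.
  rewrite (_ : _ ^+ 2 = if j == i then 1 else 0); last first.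
    by case: eqP => _; rewrite ?normc1 ?normc0 ?expr1n ?expr0n.
  over.
rewrite -big_mkcond/= big_const_seq (count_uniq_mem i us).
by case: (_ \in _); rewrite /= ?addr0 ?ler01.
Qed.

Definition xi (i : I) : ell2 R I := Ell2 (xi_summable i).

(* For a partial map [t] that is injective on its domain, the operator with  *)
(* (shift f) j = f (t j), read as 0 where [t] is undefined.                  *)
Variables (t : I -> option I).
Hypothesis t_inj : forall i j k, t i = Some k -> t j = Some k -> i = j.

Definition shift_fun (f : I -> C^o) : I -> C^o := fun j => oapp f 0 (t j).

Lemma shift_bound (f : ell2 R I) (s : seq I) : uniq s ->
  \sum_(j <- s) normc (shift_fun f j) ^+ 2 <= l2norm f ^+ 2.
Proof.
move=> us; apply: le_trans (sum_le_l2norm (ell2P f) (s := pmap t s) _).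
  elim: s {us} => [|j s IH]; first by rewrite !big_nil.
  rewrite big_cons/= /shift_fun; case: (t j) => [k|]/=.
    by rewrite big_cons lerD2l.
  by rewrite !expr0n /= addr0 sqrtr0 expr0n/= add0r.
elim: s us => //= j s IH /andP[js us]; case tj : (t j) => [k|] /=; last exact: IH.
rewrite IH// andbT mem_pmap; apply: contra js => /mapP[j' j's tj'].
by rewrite (t_inj tj (esym tj')).
Qed.

Lemma shift_summable (f : ell2 R I) : shift_fun f \in l2_summable.
Proof. by have [] := l2_bound (shift_bound f). Qed.

Definition shift_map (f : ell2 R I) : ell2 R I := Ell2 (shift_summable f).

Lemma shift_bounded : shift_map \in @bounded_linear R I.
Proof.
apply/asboolP; split=> [c f g|].
  apply: ell2_ext => j /=; rewrite /shift_fun.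
  rewrite [RHS](_ : _ = c * oapp f 0 (t j) + oapp g 0 (t j))//.
  by case: (t j) => //=; rewrite mulr0 addr0.
exists 1 => f; rewrite mul1r; apply: l2norm_le; first exact: l2norm_ge0.
exact: shift_bound.
Qed.

Definition shift_op : bop R I := Bop shift_bounded.

End BasisVectors.
Arguments xi R {I} i.

Record digraph := Digraph {
  vert : choiceType;
  edge : choiceType;
  src : edge -> vert;
  rng : edge -> vert }.
Arguments src {d} e.
Arguments rng {d} e.

Section Paths.
Variable G : digraph.

Fixpoint valid_path (v : vert G) (p : seq (edge G)) : bool :=
  if p is e :: q then (rng e == v) && valid_path (src e) q else true.

(* [DPath (v, [:: e1; ...; en])] is the path e1 ... en with range v, so that *)
(* (v, [::]) is the vertex v as a path of length 0.                          *)
Record dpath := DPath {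
  dpath_val : vert G * seq (edge G);
  _ : valid_path dpath_val.1 dpath_val.2 }.
HB.instance Definition _ := [isSub for dpath_val].
HB.instance Definition _ := [Choice of dpath by <:].

Definition path_rng (w : dpath) : vert G := (val w).1.
Definition path_src (w : dpath) : vert G :=
  last (val w).1 (map src (val w).2).

Lemma cons_path_subproof (e : edge G) (w : dpath) : path_rng w = src e ->
  valid_path (rng e) (e :: (val w).2).
Proof. by case: w => -[v p] /= vp; rewrite /path_rng /= eqxx => <-. Qed.

Definition cons_path (e : edge G) (w : dpath) (H : path_rng w = src e) : dpath :=
  @DPath (rng e, e :: (val w).2) (cons_path_subproof H).

Definition uncons_path (e : edge G) (w : dpath) : option dpath :=
  if (val w).2 is e' :: q then
    if e' == e then insub (src e, q) else None
  else None.

Definition at_vertex (v : vert G) (w : dpath) : option dpath :=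
  if path_rng w == v then Some w else None.

Lemma uncons_pathP e w w' : uncons_path e w = Some w' <->
  exists H : path_rng w' = src e, w = cons_path H.
Proof.
split.
  case: w => -[v [|e' q]] //= vp; rewrite /uncons_path/=.
  case: eqP => // ee'; subst e'.
  case: insubP => //= u qu uq [<-].
  have H : path_rng u = src e := congr1 fst uq.
  exists H; apply/val_inj => /=; rewrite (congr1 snd uq : (\val u).2 = q).
  by case/andP: vp => /eqP->.
case=> H ->; rewrite /uncons_path /= eqxx.
case: w' H => -[v q] vq; rewrite /path_rng/= => H; subst v.
by rewrite insubT/=; congr Some; exact: val_inj.
Qed.

Lemma uncons_path_inj e w1 w2 w : uncons_path e w1 = Some w ->
  uncons_path e w2 = Some w -> w1 = w2.
Proof.
by move=> /uncons_pathP[H1 ->] /uncons_pathP[H2 ->]; exact: val_inj.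
Qed.

Lemma at_vertex_inj v w1 w2 w : at_vertex v w1 = Some w ->
  at_vertex v w2 = Some w -> w1 = w2.
Proof.
by rewrite /at_vertex; case: eqP => // _ [<-]; case: eqP => // _ [->].
Qed.

End Paths.

Section PathAlgebra.
Variables (R : realType) (G : digraph).
Local Notation H := (ell2 R (dpath G)).
Local Notation B := (bop R (dpath G)).

Definition L_edge (e : edge G) : B := shift_op R (@uncons_path_inj G e).
Definition L_vert (v : vert G) : B := shift_op R (@at_vertex_inj G v).

Lemma L_edge_xi e w (h : path_rng w = src e) :
  L_edge e (xi R w) = xi R (cons_path h).
Proof.
apply: ell2_ext => u; rewrite /= /shift_fun.
have [->|ne] := eqVneq u (cons_path h).
  have E : uncons_path e (cons_path h) = Some w by apply/uncons_pathP; exists h.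
  by rewrite E /= !eqxx.
case E : (uncons_path e u) => [w'|]//=.
case: eqP => // ww'; move: E ne; rewrite ww' => /uncons_pathP[h' ->].
by rewrite (Prop_irrelevance h h') eqxx.
Qed.

Lemma L_edge_xi0 e w : path_rng w <> src e -> L_edge e (xi R w) = 0.
Proof.
move=> h; apply: ell2_ext => u; rewrite /= /shift_fun.
case E : (uncons_path e u) => [w'|]//=.
case: eqP => // ww'; move: E; rewrite ww' => /uncons_pathP[h' _].
by case: (h h').
Qed.

Lemma L_vert_xi v w : L_vert v (xi R w) = if path_rng w == v then xi R w else 0.
Proof.
apply: ell2_ext => u; rewrite /= /shift_fun /at_vertex.
have [->|uw] := eqVneq u w; first by case: eqP => //= _; rewrite eqxx.
by case: eqP => _; case: eqP => _ //=; rewrite (negbTE uw).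
Qed.

Definition is_subalgebra (A : set B) : Prop :=
  [/\ A 0, (forall S T, A S -> A T -> A (S + T)),
      (forall (c : R[i]) T, A T -> A (c *: T))
    & (forall S T, A S -> A T -> A (S * T))].

(* Not required to be unital: if G has infinitely many vertices, the         *)
(* identity operator does not belong to the algebra below.                   *)
Definition graph_algebra : set B :=
  smallest [set A | is_subalgebra A /\ closed A]
    (range L_edge `|` range L_vert).

End PathAlgebra.
Arguments graph_algebra : clear implicits.

Section Derivations.
Variables (R : realType) (I : choiceType).
Local Notation B := (bop R I).
Implicit Types (A : set B) (d : B -> B).

(* Linear maps A -> A are represented by maps on all bounded operators, of   *)
(* which only the values on A matter.                                        *)
Definition is_derivation A d : Prop :=
  [/\ (forall S, A S -> A (d S)),
      (forall (c : R[i]) S T, A S -> A T -> d (c *: S + T) = c *: d S + d T)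
    & (forall S T, A S -> A T -> d (S * T) = d S * T + S * d T)].

Definition bounded_on A d : Prop :=
  exists M : R, forall S, A S -> opnorm (d S) <= M * opnorm S.

Definition is_inner A d : Prop :=
  exists2 T, A T & forall S, A S -> d S = S * T - T * S.

End Derivations.

Definition strongly_connected (G : digraph) : Prop :=
  forall x y : vert G, exists w : dpath G, path_src w = x /\ path_rng w = y.

Definition connected_digraph (G : digraph) : Prop :=
  forall x y : vert G,
    clos_refl_sym_trans (vert G)
      (fun u v => exists e : edge G, src e = u /\ rng e = v) x y.

Definition is_polygon (G : digraph) (n : nat)
    (v : 'I_n -> vert G) (e : 'I_n -> edge G) : Prop :=
  [/\ (0 < n)%N, injective v, injective e
    & forall j, [set rng (e j); src (e j)] = [set v j; v (ordS j)]].

Definition generalized_tree (G : digraph) : Prop :=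
  [/\ connected_digraph G, (exists x y : vert G, x <> y)
    & ~ exists n (v : 'I_n -> vert G) (e : 'I_n -> edge G), is_polygon v e].

Definition incident (G : digraph) (e : edge G) (x : vert G) : Prop :=
  src e = x \/ rng e = x.

(* Degree one; in a generalized tree there are no loops to count twice.      *)
Definition is_leaf (G : digraph) (x : vert G) : Prop :=
  exists! e : edge G, incident e x.

Definition circle (n : nat) : digraph :=
  @Digraph 'I_n 'I_n (@ordS n) id.

Definition disjoint_union (J : choiceType) (F : J -> digraph) : digraph :=
  @Digraph {j : J & vert (F j)} {j : J & edge (F j)}
    (fun e => Tagged (fun j => vert (F j)) (src (tagged e)))
    (fun e => Tagged (fun j => vert (F j)) (rng (tagged e))).

(* [fruit_base l] is the vertex of the circle at [l] that gets identified    *)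
(* with [l]; its mere existence forces [0 < fruit_len l]. The values of      *)
(* [fruit_len] and [fruit_base] outside [fruit_at] are not used.             *)
Record fruit_data := FruitData {
  stem : digraph;
  fruit_at : set (vert stem);
  fruit_len : vert stem -> nat;
  fruit_base : forall l, 'I_(fruit_len l) }.
Arguments fruit_len : clear implicits.
Arguments fruit_base : clear implicits.
Arguments fruit_at : clear implicits.

Section FruitTrees.
Variable D : fruit_data.
Local Notation Gt := (stem D).

Definition fruits : digraph :=
  @disjoint_union {l : vert Gt | l \in fruit_at D}
    (fun l => circle (fruit_len D (val l))).

Definition free_vert :=
  {x : vert fruits | tagged x != fruit_base D (val (tag x))}.

Definition glue_fruit (x : vert fruits) : vert Gt + free_vert :=
  if insub x is Some y then inr y else inl (val (tag x)).

Definition glued : digraph :=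
  @Digraph (vert Gt + free_vert)%type (edge Gt + edge fruits)%type
    (fun e => match e with inl a => inl (src a) | inr b => glue_fruit (src b) end)
    (fun e => match e with inl a => inl (rng a) | inr b => glue_fruit (rng b) end).

Definition is_generalized_fruit_tree : Prop :=
  [/\ generalized_tree Gt, (forall l, fruit_at D l -> is_leaf l)
    & fruit_at D <> setT].

Definition is_fruit_tree : Prop :=
  is_generalized_fruit_tree /\ finite_set [set: vert glued].

(* The edge joining the leaf [l] to the rest of the tree ends at [l].        *)
Definition is_in_fruit (l : vert Gt) : Prop :=
  fruit_at D l /\ exists e : edge Gt, rng e = l /\ src e <> l.

End FruitTrees.

Definition digraph_iso (G H : digraph) : Prop :=
  exists (fv : vert G -> vert H) (fe : edge G -> edge H),
    [/\ bijective fv, bijective fe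
      & forall e, src (fe e) = fv (src e) /\ rng (fe e) = fv (rng e)].

Definition fruit_tree_without_in_fruit (G : digraph) : Prop :=
  exists D : fruit_data,
    [/\ is_fruit_tree D, digraph_iso G (glued D)
      & ~ exists l, is_in_fruit (l : vert (stem D))].

(* Main.v *)
(* Call an edge e a cross edge if no path leads from r(e) back to s(e).

   If all bounded derivations are inner and T is a bounded operator whose
   commutators with the generators lie in the algebra, then T differs from an
   element of the algebra by an operator commuting with the algebra.
   Comparing Fourier coefficients for well chosen T gives:
   - T = projection onto the paths with range in a set of vertices: there are
     only finitely many vertices, since diagonal coefficients of elements of
     the algebra tend to 0;
   - T = substitution of a path m through e for the cross edge e, that is
     p e q |-> p m q: with m = e, removing e disconnects G; with m = e c, where
     c is a cycle at s(e), all cycles at s(e) commute and e is the only edge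
     leaving its strong component, which is therefore a circle;
   - if there were a cycle c at r(e), one could take T = f(W), where W is the
     substitution of c e for e and f is a bounded analytic function. The
     commutator of f(W) with L_e lies in the algebra as soon as f is square
     summable, but f(W) agrees with an element of the algebra up to the
     commutant only if the Fejer means of f at 1 converge. A function f
     violating this is the limit of polynomials P_k obtained by composing
     small rotations, in the manner of the Rudin-Shapiro polynomials.

   Conversely, on a fruit tree without in-fruit a bounded derivation is reduced
   to 0 by inner derivations: first on the vertices, then on the edges off the
   circles, which are bridges, and on the edges of each circle but one, using
   that for each such edge e every path from s(e) to r(e) ends by traversing e.
   For the last edge one uses boundedness: if c is the whole circle, d(L_c)
   commutes with L_c, hence d(L_c^k) = k L_c^(k-1) d(L_c) and d(L_c) = 0. *)

From Stdlib Require Import Relations.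
Require Import Defs.
From mathcomp Require Import all_boot all_order all_algebra.
From mathcomp Require Import complex lra ring zify.
From mathcomp Require Import all_classical all_reals all_analysis.

Set Implicit Arguments.
Unset Strict Implicit.
Unset Printing Implicit Defensive.

Import Order.TTheory GRing.Theory Num.Theory ComplexField.Normc.
Import numFieldNormedType.Exports.

Local Open Scope classical_set_scope.
Local Open Scope ring_scope.
Local Open Scope complex_scope.

(** * Operators on l2 *)

Section Operators.
Variables (R : realType) (I : choiceType).
Local Notation C := R[i].
Local Notation H := (ell2 R I).
Local Notation B := (bop R I).
Implicit Types (S T : B) (f g : H) (r : I -> I -> Prop).

Lemma normcN (z : C) : normc (- z) = normc z.
Proof. by case: z => a b; rewrite /= !sqrrN. Qed.

Lemma normc_real (x : R) : normc (x%:C) = `|x|.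
Proof. by rewrite /normc /= expr0n addr0 sqrtr_sqr. Qed.

Lemma normc_nat (b : bool) : normc (b%:R : C) = b%:R.
Proof. by case: b; [exact: normc1|exact: normc0]. Qed.

Lemma normc_sum (J : Type) (s : seq J) (P : pred J) (F : J -> C) :
  normc (\sum_(i <- s | P i) F i) <= \sum_(i <- s | P i) normc (F i).
Proof.
elim/big_ind2 : _ => [|x a y b xa yb|//]; first by rewrite normc0.
by rewrite (le_trans (le_normcD _ _))// lerD.
Qed.

Lemma normc_le0 (z : C) : normc z <= 0 -> z = 0.
Proof. by move=> z0; apply: eq0_normc; apply/eqP; rewrite eq_le z0 normc_ge0. Qed.

Lemma bopD T f g : T (f + g) = T f + T g.
Proof. by have := bop_linear T 1 f g; rewrite !scale1r. Qed.

Lemma bop_sum T (J : Type) (s : seq J) (P : pred J) (F : J -> H) :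
  T (\sum_(i <- s | P i) F i) = \sum_(i <- s | P i) T (F i).
Proof. by apply: (big_morph T (bopD T) (bop0 T)). Qed.

Lemma bop_addE S T f : (S + T) f = S f + T f. Proof. by []. Qed.
Lemma bop_oppE S f : (- S) f = - S f. Proof. by []. Qed.
Lemma bop_scaleE (a : C) S f : (a *: S) f = a *: S f. Proof. by []. Qed.
Lemma ell2_addE f g i : (f + g) i = f i + g i. Proof. by []. Qed.
Lemma ell2_oppE f i : (- f) i = - f i. Proof. by []. Qed.
Lemma ell2_scaleE (a : C) f i : (a *: f) i = a * (f i : C). Proof. by []. Qed.
Lemma ell2_sumE (J : Type) (s : seq J) (P : pred J) (F : J -> H) i :
  (\sum_(j <- s | P j) F j) i = \sum_(j <- s | P j) F j i.
Proof. exact: (big_morph (fun f : H => f i)). Qed.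

Lemma bop_sumE (J : Type) (s : seq J) (P : pred J) (F : J -> B) f :
  (\sum_(j <- s | P j) F j) f = \sum_(j <- s | P j) F j f.
Proof. exact: (big_morph (fun T : B => T f)). Qed.

Lemma bop_scalerAl (a : C) S T : (a *: S) * T = a *: (S * T).
Proof. exact: bop_ext. Qed.

Lemma bop_scalerAr (a : C) S T : S * (a *: T) = a *: (S * T).
Proof. by apply: bop_ext => f; rewrite bopM !bop_scaleE bopZ. Qed.

Lemma opnormN T : opnorm (- T) = opnorm T.
Proof. by rewrite -scaleN1r opnormZ normcN normc1 mul1r. Qed.

Lemma opnorm0 : opnorm (0 : B) = 0.
Proof. by rewrite -(scale0r (0 : B)) opnormZ normc0 mul0r. Qed.

Lemma opnorm_le0 T : opnorm T <= 0 -> T = 0.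
Proof.
move=> T0; apply: bop_norm0; congr (_%:C).
by apply/eqP; rewrite eq_le T0 opnorm_ge0.
Qed.

Lemma opnormM S T : opnorm (S * T) <= opnorm S * opnorm T.
Proof.
apply: opnorm_le => [|f]; first by rewrite mulr_ge0 ?opnorm_ge0.
rewrite bopM (le_trans (le_opnorm _ _))// -mulrA ler_wpM2l ?opnorm_ge0//.
exact: le_opnorm.
Qed.

Lemma l2norm_xi (i : I) : l2norm (xi R i) <= 1.
Proof.
apply: l2norm_le => // s us; rewrite expr1n.
rewrite (eq_bigr (fun j => if j == i then 1 else 0 : R)) => [|j _].
  rewrite -big_mkcond/= big_const_seq iter_addr_0.
  by rewrite (count_uniq_mem i us) lern1 leq_b1.
by rewrite /= normc_nat; case: eqP => _; rewrite ?expr1n ?expr0n.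
Qed.

Definition cf T (i j : I) : C := T (xi R i) j.

Lemma cfD S T i j : cf (S + T) i j = cf S i j + cf T i j. Proof. by []. Qed.
Lemma cfN T i j : cf (- T) i j = - cf T i j. Proof. by []. Qed.
Lemma cfZ (a : C) T i j : cf (a *: T) i j = a * cf T i j. Proof. by []. Qed.
Lemma cf0 i j : cf 0 i j = 0. Proof. by []. Qed.

Lemma cf_le T i j : normc (cf T i j) <= opnorm T.
Proof.
apply: (le_trans (normc_le_l2norm _ _)); apply: (le_trans (le_opnorm _ _)).
by rewrite ler_piMr ?opnorm_ge0 ?l2norm_xi.
Qed.

(** Closedness phrased with the real number [opnorm]; [closed_limP] identifies it with topological
    closedness, whose balls have complex radii. *)
Definition lim_closed (P : set B) := forall T,
  (forall e : R, 0 < e -> exists2 S, P S & opnorm (T - S) <= e) -> P T.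

Lemma closed_limP (P : set B) : closed P <-> lim_closed P.
Proof.
split=> cP T TP.
  apply: cP => U /nbhs_ballP[e /= e0 eU].
  have e0' : 0 < complex.Re e by move: e0; rewrite ltcE => /andP[].
  have [S PS] := TP (complex.Re e / 2) (divr_gt0 e0' (ltr0Sn _ 1)).
  exists S; split=> //; apply: eU; rewrite -ball_normE /= bop_normE.
  move: e0; rewrite !ltcE /= => /andP[/eqP -> _]; rewrite eqxx /=; lra.
apply: cP => e e0.
have [S [PS]] := TP _ (@nbhsx_ballx _ _ T (e%:C) ltac:(by rewrite ltcR)).
rewrite -ball_normE /= bop_normE ltcR => h.
by exists S => //; exact: ltW.
Qed.

Definition pbij r :=
  (forall i j k, r i j -> r i k -> j = k) /\
  (forall i j k, r i k -> r j k -> i = j).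

(** The test [pbij r] sits inside the definition so that [rel_pre r] is injective on its domain for
    every relation [r], and [rel_op] takes no proof argument. *)
Definition rel_pre r (j : I) : option I :=
  if pselect (exists i, pbij r /\ r i j) is left h then Some (sval (cid h))
  else None.

Lemma rel_preP r i j : rel_pre r j = Some i -> pbij r /\ r i j.
Proof. by rewrite /rel_pre; case: pselect => // h [<-]; case: (cid h). Qed.

Lemma rel_preE r i j : pbij r -> r i j -> rel_pre r j = Some i.
Proof.
move=> br rij; rewrite /rel_pre; case: pselect => [h|]; last by case; exists i.
by case: (cid h) => k [_ rkj] /=; rewrite (br.2 _ _ _ rkj rij).
Qed.

Lemma rel_pre_inj r i j k :
  rel_pre r i = Some k -> rel_pre r j = Some k -> i = j.
Proof. by move=> /rel_preP[br rki] /rel_preP[_ rkj]; exact: br.1 rki rkj. Qed.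

(* The operator xi_i |-> xi_j for [r i j]; it is 0 unless [r] is a partial
   bijection. *)
Definition rel_op r : B := shift_op R (@rel_pre_inj r).

Lemma rel_opE r i j f : pbij r -> r i j -> rel_op r f j = f i.
Proof. by move=> br rij; rewrite /= /shift_fun (rel_preE br rij). Qed.

Lemma rel_op0 r j f : (forall i, ~ r i j) -> rel_op r f j = 0.
Proof.
move=> nr; rewrite /= /shift_fun; case E: (rel_pre r j) => [i|]//.
by have [_ /nr] := rel_preP E.
Qed.

Lemma eq_rel_op r r' : (forall i j, r i j <-> r' i j) -> rel_op r = rel_op r'.
Proof.
move=> rr'; congr rel_op; apply/funext => i; apply/funext => j.
exact/propext.
Qed.

Lemma rel_op_norm r : opnorm (rel_op r) <= 1.
Proof.
apply: opnorm_le => // f; rewrite mul1r; apply: l2norm_le; first exact: l2norm_ge0.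
exact: (@shift_bound R I (rel_pre r) (@rel_pre_inj r)).
Qed.

Definition relc r r' : I -> I -> Prop := fun i k => exists2 j, r' i j & r j k.

Lemma pbij_comp r r' : pbij r -> pbij r' -> pbij (relc r r').
Proof.
move=> [f b] [f' b']; split=> [i j k [x ix xj] [y iy yk]|i j k [x ix xk] [y jy yk]].
  by move: xj; rewrite (f' _ _ _ ix iy) => /f; apply.
by move: ix; rewrite (b _ _ _ xk yk) => /b'; apply.
Qed.

Lemma rel_opM r r' : pbij r -> pbij r' ->
  rel_op r * rel_op r' = rel_op (relc r r').
Proof.
move=> br br'; apply: bop_ext => f; rewrite bopM; apply: ell2_ext => k.
have [[j rjk]|nj] := pselect (exists j, r j k); last first.
  rewrite !rel_op0// => [i [j _ rjk]|j rjk]; apply: nj; by exists j.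
rewrite (rel_opE _ br rjk).
have [[i rij]|ni] := pselect (exists i, r' i j).
  rewrite (rel_opE _ br' rij) (@rel_opE _ i)//; first exact: pbij_comp.
  by exists j.
rewrite !rel_op0// => [i [j' rij' rjk']|i rij]; apply: ni; exists i => //.
by rewrite (br.2 _ _ _ rjk rjk').
Qed.

Lemma cf_rel_op r i j : pbij r -> cf (rel_op r) i j = `[< r i j >]%:R.
Proof.
move=> br; rewrite /cf; case: (pselect (exists k, r k j)) => [[k rkj]|nk].
  rewrite (rel_opE _ br rkj) /=; case: asboolP => [rij|nrij].
    by rewrite (br.2 _ _ _ rkj rij) eqxx.
  by case: eqP => // ki; case: nrij; rewrite -ki.
rewrite rel_op0 => [|k rk]; last by apply: nk; exists k.
by case: asboolP => // rij; case: nk; exists i.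
Qed.

Lemma rel_op_xi r i j : pbij r -> r i j -> rel_op r (xi R i) = xi R j.
Proof.
move=> br rij; apply: ell2_ext => k; rewrite -[LHS]/(cf _ i k) cf_rel_op//=.
case: asboolP => [rik|nrik]; first by rewrite (br.1 _ _ _ rij rik) eqxx.
by case: eqP => // kj; case: nrik; rewrite kj.
Qed.

End Operators.

(** * Closed subspaces of operators *)

Section Monomials.
Variables (R : realType) (I : choiceType).
Local Notation B := (bop R I).
Implicit Types (S T : B) (P : set B).

Lemma shift_op_rel (t : I -> option I)
    (t_inj : forall i j k, t i = Some k -> t j = Some k -> i = j) :
  shift_op R t_inj = rel_op R (fun i j => t j = Some i).
Proof.
have br : pbij (fun i j => t j = Some i).
  split=> i j k; [exact: t_inj|by move=> -> []].
apply: bop_ext => f; apply: ell2_ext => j.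
case E : (t j) => [i|]; first by rewrite (rel_opE _ br E) /= /shift_fun E.
by rewrite rel_op0 => [|i]; rewrite ?E// /= /shift_fun E.
Qed.

Lemma rel_op_empty (r : I -> I -> Prop) : (forall i j, ~ r i j) -> rel_op R r = 0.
Proof.
by move=> nr; apply: bop_ext => f; apply: ell2_ext => j; rewrite rel_op0.
Qed.

Definition sublin P := P 0 /\ forall (a : R[i]) S T, P S -> P T -> P (a *: S + T).

Lemma sublinD P S T : sublin P -> P S -> P T -> P (S + T).
Proof. by move=> [_ PL] PS PT; rewrite -[S]scale1r; exact: PL. Qed.

Lemma sublinZ P a S : sublin P -> P S -> P (a *: S).
Proof. by move=> [P0 PL] PS; rewrite -[_ *: _]addr0; exact: PL. Qed.

Lemma sublinN P S : sublin P -> P S -> P (- S).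
Proof. by move=> sP PS; rewrite -scaleN1r; exact: sublinZ. Qed.

Lemma sublinB P S T : sublin P -> P S -> P T -> P (S - T).
Proof. by move=> sP PS PT; apply: sublinD => //; exact: sublinN. Qed.

Lemma sublin_sum P (J : eqType) (s : seq J) (Q : pred J) (F : J -> B) : sublin P ->
  (forall j, j \in s -> Q j -> P (F j)) -> P (\sum_(j <- s | Q j) F j).
Proof.
move=> sP PF; rewrite big_seq_cond; elim/big_ind : _ => [|S T|j /andP[js Qj]].
- by case: sP.
- exact: sublinD.
- exact: PF.
Qed.

Lemma lim_closed_mulr P T : lim_closed P -> lim_closed [set S | P (S * T)].
Proof.
move=> cP S h; apply: cP => e e0.
have [S' PS' SS'] := h (e / (opnorm T + 1)) ltac:(by rewrite divr_gt0// ltr_wpDl ?opnorm_ge0).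
exists (S' * T) => //; rewrite -mulrBl (le_trans (opnormM _ _))//.
rewrite (le_trans (ler_wpM2r (opnorm_ge0 _) SS'))// mulrAC ler_pdivrMr ?ltr_wpDl ?opnorm_ge0//.
by rewrite ler_wpM2l ?ler_wpDr// ltW.
Qed.

Lemma lim_closed_mull P T : lim_closed P -> lim_closed [set S | P (T * S)].
Proof.
move=> cP S h; apply: cP => e e0.
have [S' PS' SS'] := h (e / (opnorm T + 1)) ltac:(by rewrite divr_gt0// ltr_wpDl ?opnorm_ge0).
exists (T * S') => //; rewrite -mulrBr (le_trans (opnormM _ _))//.
rewrite (le_trans (ler_wpM2l (opnorm_ge0 _) SS'))// mulrA ler_pdivrMr ?ltr_wpDl ?opnorm_ge0//.
by rewrite mulrC ler_wpM2l ?ler_wpDr// ltW.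
Qed.

Lemma sublin_mulr P T : sublin P -> sublin [set S | P (S * T)].
Proof.
move=> sP; split=> [|a S S' PS PS'] /=; first by rewrite mul0r; case: sP.
by rewrite mulrDl bop_scalerAl; apply: sP.2.
Qed.

Lemma sublin_mull P T : sublin P -> sublin [set S | P (T * S)].
Proof.
move=> sP; split=> [|a S S' PS PS'] /=; first by rewrite mulr0; case: sP.
by rewrite mulrDr bop_scalerAr; apply: sP.2.
Qed.

Lemma lim_closedI P P' : lim_closed P -> lim_closed P' -> lim_closed (P `&` P').
Proof.
move=> c c' S h; split; [apply: c|apply: c'] => e /h[T [PT P'T] ST]; by exists T.
Qed.

Lemma sublinI P P' : sublin P -> sublin P' -> sublin (P `&` P').
Proof.
move=> [P0 PL] [P0' PL']; split=> // a S T [PS PS'] [PT PT'].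
by split; [exact: PL|exact: PL'].
Qed.

End Monomials.

(** * Path operators and the graph algebra *)

Section PathOps.
Variables (R : realType) (G : digraph).
Local Notation C := R[i].
Local Notation B := (bop R (dpath G)).
Local Notation A := (graph_algebra R G).
Implicit Types (v x y : vert G) (e f : edge G) (p q : seq (edge G)) (w u : dpath G).
Implicit Types (S T : B).

Definition psrc v p : vert G := last v (map src p).

Lemma psrc_cat v p q : psrc v (p ++ q) = psrc (psrc v p) q.
Proof. by rewrite /psrc map_cat last_cat. Qed.

Lemma cat_injr (T : eqType) (p q s : seq T) : p ++ s = q ++ s -> p = q.
Proof.
move=> h; have sz : size p = size q by move/(congr1 size): h; rewrite !size_cat => /addIn.
by move/eqP: h; rewrite eqseq_cat// => /andP[/eqP].
Qed.

Lemma valid_cat v p q :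
  valid_path v (p ++ q) = valid_path v p && valid_path (psrc v p) q.
Proof. by elim: p v => //= e p IH v; rewrite IH andbA. Qed.

Lemma dpath_valid w : valid_path (val w).1 (val w).2.
Proof. by case: w. Qed.

Lemma dpath_eq w u : (val w).1 = (val u).1 -> (val w).2 = (val u).2 -> w = u.
Proof.
move=> h1 h2; apply: val_inj.
by rewrite [LHS]surjective_pairing [RHS]surjective_pairing h1 h2.
Qed.

Definition vtx v : dpath G := @DPath G (v, [::]) isT.

Definition mkp v p : dpath G := insubd (vtx v) (v, p).

Lemma mkpE v p : valid_path v p -> val (mkp v p) = (v, p).
Proof. by move=> vp; rewrite /mkp val_insubd vp. Qed.

Lemma mkp_nil v : mkp v [::] = vtx v.
Proof. by apply: val_inj; rewrite mkpE. Qed.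

(* [u] is the path [p w], where [p] has range [v]. *)
Definition pre v p w u :=
  (val w).1 = psrc v p /\ val u = (v, p ++ (val w).2).

Lemma pbij_pre v p : pbij (pre v p).
Proof.
split=> [w u u' [_ uE] [_ u'E]|w w' u [rw uE] [rw' uE']].
  by apply: val_inj; rewrite uE u'E.
move: uE'; rewrite uE => -[] /eqP; rewrite eqseq_cat// eqxx/= => /eqP ww'.
by apply: dpath_eq; rewrite ?rw ?rw'.
Qed.
Hint Resolve pbij_pre : core.

Definition Lop v p : B := rel_op R (pre v p).
(** The adjoint of the partial isometry [Lop v p]: it strips the prefix [p]. *)
Definition Ladj v p : B := rel_op R (fun u w => pre v p w u).

Lemma pbij_pre_adj v p : pbij (fun u w => pre v p w u).
Proof. by have [f b] := pbij_pre v p; split=> *; [apply: b; eassumption|apply: f;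
  eassumption]. Qed.
Hint Resolve pbij_pre_adj : core.

Lemma pre_total v p w : valid_path v p -> (val w).1 = psrc v p ->
  pre v p w (mkp v (p ++ (val w).2)).
Proof.
move=> vp rw; split=> //; rewrite mkpE// valid_cat vp -rw/=; exact: dpath_valid.
Qed.

Lemma L_edgeE e : L_edge R e = Lop (rng e) [:: e].
Proof.
rewrite [LHS]shift_op_rel; apply: eq_rel_op => w u; split.
  by move=> /uncons_pathP[H ->].
move=> [rw uE]; apply/uncons_pathP; exists rw; exact: val_inj.
Qed.

Lemma L_vertE v : L_vert R v = Lop v [::].
Proof.
rewrite [LHS]shift_op_rel; apply: eq_rel_op => w u; rewrite /at_vertex; split.
  by case: eqP => // uv [<-]; split=> //=; rewrite -uv -surjective_pairing.
move=> [rw uE]; rewrite /path_rng uE eqxx; congr Some.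
by apply: dpath_eq; rewrite uE.
Qed.

Lemma LopM v p q : valid_path v p -> Lop v p * Lop (psrc v p) q = Lop v (p ++ q).
Proof.
move=> vp; rewrite rel_opM//; apply: eq_rel_op => w u; split.
  move=> [w' [rw w'E] [rw' uE]]; split; first by rewrite psrc_cat.
  by rewrite uE w'E catA.
move=> [rw uE]; have := dpath_valid u; rewrite uE -catA valid_cat => /andP[_ vq].
exists (mkp (psrc v p) (q ++ (val w).2)); split; rewrite ?mkpE//.
  by rewrite rw psrc_cat.
by rewrite uE catA.
Qed.

Lemma LopM0 v p v' q : v' <> psrc v p -> Lop v p * Lop v' q = 0.
Proof.
move=> vp; rewrite rel_opM//; apply: rel_op_empty => w u [w' [rw w'E] [rw' uE]].
by apply: vp; rewrite -rw' w'E.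
Qed.

Lemma Ladj_Lop v p : valid_path v p -> Ladj v p * Lop v p = Lop (psrc v p) [::].
Proof.
move=> vp; rewrite rel_opM//; apply: eq_rel_op => w u; split.
  move=> [w' ww' uw']; have -> : u = w by exact: (pbij_pre v p).2 uw' ww'.
  by case: ww' => rw _; split=> //; rewrite -rw -surjective_pairing.
move=> [rw uE]; have -> : u = w by apply: dpath_eq; rewrite uE.
by exists (mkp v (p ++ (val w).2)); exact: pre_total.
Qed.

Lemma Ladj_norm v p : opnorm (Ladj v p) <= 1. Proof. exact: rel_op_norm. Qed.
Lemma Lop_norm v p : opnorm (Lop v p) <= 1. Proof. exact: rel_op_norm. Qed.

Lemma algebra_subalg : is_subalgebra A.
Proof.
split=> [|S T AS AT|a S AS|S T AS AT] P hP; have [[[P0 PD PZ PM] cP] gP] := hP => //.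
- by apply: PD; [exact: (AS P hP)|exact: (AT P hP)].
- by apply: PZ; exact: (AS P hP).
- by apply: PM; [exact: (AS P hP)|exact: (AT P hP)].
Qed.

Lemma algebra_sublin : sublin A.
Proof. by have [A0 AD AZ _] := algebra_subalg; split=> // a S T AS AT; apply: AD => //;
  exact: AZ. Qed.

Lemma algebraM S T : A S -> A T -> A (S * T).
Proof. by case: algebra_subalg => _ _ _; apply. Qed.

Lemma algebra_closed : lim_closed A.
Proof.
move=> T h P hP; have [[sP /closed_limP cP] gP] := hP.
by apply: cP => e /h[S AS ST]; exists S => //; exact: (AS P hP).
Qed.

Lemma algebra_edge e : A (L_edge R e).
Proof. by move=> P [_ gP]; apply: gP; left; exists e. Qed.

Lemma algebra_vert v : A (L_vert R v).
Proof. by move=> P [_ gP]; apply: gP; right; exists v. Qed.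

Lemma algebra_Lop v p : valid_path v p -> A (Lop v p).
Proof.
elim: p v => [|e p IH] v /= => [_|/andP[/eqP <- vp]].
  by rewrite -L_vertE; exact: algebra_vert.
have -> : Lop (rng e) (e :: p) = L_edge R e * Lop (src e) p.
  by rewrite L_edgeE (@LopM _ [:: e])//= eqxx.
by apply: algebraM; [exact: algebra_edge|exact: IH].
Qed.

Lemma generator_ind (P : set B) : sublin P -> lim_closed P ->
  (forall S T, P S -> P T -> P (S * T)) -> (forall e, P (L_edge R e)) ->
  (forall v, P (L_vert R v)) -> forall S, A S -> P S.
Proof.
move=> sP cP PM Pe Pv S; apply; split; last by move=> _ [[e _ <-]|[v _ <-]].
split; last exact/closed_limP.
split=> //; first by case: sP.
  by move=> *; exact: sublinD.
by move=> *; exact: sublinZ.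
Qed.

(** The intersection [Q] of all closed subspaces containing the path operators is an algebra: using
    minimality in each factor separately, it suffices that a product of two path operators is a path
    operator or 0. *)
Lemma span_ind (P : set B) : sublin P -> lim_closed P ->
  (forall v p, valid_path v p -> P (Lop v p)) -> forall S, A S -> P S.
Proof.
move=> sP cP PL S AS.
pose Q := [set S | forall P : set B, sublin P -> lim_closed P ->
  (forall v p, valid_path v p -> P (Lop v p)) -> P S].
suff : Q S by apply.
have QL v p : valid_path v p -> Q (Lop v p) by move=> vp P' sP' cP'; apply.
have sQ : sublin Q.
  split=> [P' []//|a S' T' QS QT P' sP' cP' PL'].
  by apply: sP'.2; [exact: QS|exact: QT].
have cQ : lim_closed Q.
  move=> T h P' sP' cP' PL'; apply: (cP') => e /h[S' QS' ?].
  by exists S' => //; apply: QS'.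
apply: (generator_ind sQ cQ _ _ _ AS) => [S1 T1 QS QT|e|v].
- apply: (QT [set T | Q (S1 * T)]); [exact: sublin_mull|exact: lim_closed_mull|].
  move=> v p vp; apply: (QS [set S | Q (S * Lop v p)]).
  + exact: sublin_mulr.
  + exact: lim_closed_mulr.
  + move=> v' p' vp' /=; have [->|/eqP ne] := eqVneq v (psrc v' p').
      have [vv'|nv] := boolP (valid_path (psrc v' p') p); last first.
        rewrite [X in Q (_ * X)]rel_op_empty ?mulr0//; first by case: sQ.
        move=> w u [_ uE]; have := dpath_valid u; rewrite uE valid_cat => /andP[h _].
        by rewrite h in nv.
      by rewrite LopM//; apply: QL; rewrite valid_cat vp'.
    by rewrite LopM0//; case: sQ.
- by rewrite L_edgeE; apply: QL => /=; rewrite eqxx.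
- by rewrite L_vertE; exact: QL.
Qed.

Lemma cf_Lop v p w u : cf (Lop v p) w u = `[< pre v p w u >]%:R.
Proof. exact: cf_rel_op. Qed.

(** Path operators multiply from the left, so they commute with right translation, and this survives
    norm limits. The common value is the Fourier coefficient of [S] at the path [p]. *)
Lemma right_invariant S w u p : A S ->
  psrc (val u).1 p = (val w).1 -> (val u).2 = p ++ (val w).2 ->
  cf S w u = cf S (vtx (val w).1) (mkp (val u).1 p).
Proof.
move=> AS rp uE; have := dpath_valid u; rewrite uE valid_cat => /andP[vp _].
apply: (span_ind (P := [set S | cf S w u = cf S (vtx (val w).1) (mkp (val u).1 p)])) AS => /=.
- by split=> [|a S' T' /= h1 h2]; rewrite ?cf0// !cfD !cfZ h1 h2.
- move=> T h; apply/eqP; rewrite -subr_eq0; apply/eqP/normc_le0/ler_addgt0Pr => e e0.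
  have [S' S'E TS'] := h (e / 2) (divr_gt0 e0 (ltr0Sn _ 1)).
  rewrite add0r.
  have -> : cf T w u - cf T (vtx (val w).1) (mkp (val u).1 p) =
    cf (T - S') w u - cf (T - S') (vtx (val w).1) (mkp (val u).1 p).
    by rewrite !cfD !cfN S'E; ring.
  apply: (le_trans (le_normcD _ _)); rewrite normcN (splitr e) lerD//.
    by rewrite (le_trans (cf_le _ _ _)).
  by rewrite (le_trans (cf_le _ _ _)).
- move=> v q vq; rewrite !cf_Lop; congr (nat_of_bool _)%:R.
  apply/asboolP/asboolP => -[rw uE']; split=> //.
    rewrite mkpE// cats0; move: uE; rewrite uE' /=.
    by move=> /cat_injr ->; congr pair; exact: (congr1 fst uE').
  move: uE'; rewrite mkpE// cats0 => -[uv pq].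
  by rewrite [LHS]surjective_pairing uv uE pq.
Qed.

Lemma right_invariant0 S w u : A S -> cf S w u != 0 ->
  exists p, psrc (val u).1 p = (val w).1 /\ (val u).2 = p ++ (val w).2.
Proof.
move=> AS cn0; apply: contrapT => nu; move/eqP: cn0; case.
apply: (span_ind (P := [set S | cf S w u = 0])) AS => /=.
- by split=> [|a S' T' /= h1 h2]; rewrite ?cf0// !cfD !cfZ h1 h2 mulr0 addr0.
- move=> T h; apply/normc_le0/ler_addgt0Pr => e /h[S' /= S'0 TS']; rewrite add0r.
  by apply: le_trans TS'; rewrite -[cf T w u]subr0 -S'0 -cfN -cfD cf_le.
- move=> v q vq; rewrite cf_Lop; case: asboolP => //= -[rw uE].
  by case: nu; exists q; rewrite uE rw.
Qed.

End PathOps.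
#[export] Hint Resolve pbij_pre pbij_pre_adj : core.
(** * Substitution operators and inner corrections *)

Section Reachability.
Variable G : digraph.
Implicit Types (v x y z : vert G) (e f : edge G) (p q : seq (edge G)).

Definition reach x y := exists2 p, valid_path y p & psrc y p = x.

Lemma reach_refl x : reach x x. Proof. by exists [::]. Qed.

Lemma reach_trans y x z : reach x y -> reach y z -> reach x z.
Proof.
move=> [p vp px] [q vq qy]; exists (q ++ p); first by rewrite valid_cat vq qy.
by rewrite psrc_cat qy.
Qed.

Lemma reach_edge e : reach (src e) (rng e).
Proof. by exists [:: e] => //=; rewrite eqxx. Qed.

Definition cross e := ~ reach (rng e) (src e).

(** The segment between two occurrences of [e] would lead from [rng e] back to [src e]. *)
Lemma cross_notin e v p q : cross e -> valid_path v (p ++ e :: q) ->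
  (e \notin p) && (e \notin q).
Proof.
have once r s t u : cross e -> ~~ valid_path u (r ++ e :: s ++ e :: t).
  move=> ce; apply/negP; rewrite valid_cat /= => /and3P[_ _].
  rewrite valid_cat /= => /and3P[vs /eqP es _]; apply: ce.
  by exists s.
move=> ce vpq; apply/andP; split; apply/negP => h; move: vpq; apply/negP.
  by case/path.splitPr: h => p1 p2; rewrite -catA /=; exact: once.
by case/path.splitPr: h => p1 p2; exact: once.
Qed.

Lemma split_uniq (T : eqType) (e : T) (p q p' q' : seq T) :
  e \notin p -> e \notin p' -> p ++ e :: q = p' ++ e :: q' -> p = p' /\ q = q'.
Proof.
elim: p p' => [|a p IH] [|a' p'] //=; rewrite ?inE.
- by move=> _ _ [].
- by move=> _ /norP[/eqP h _] [/h].
- by move=> /norP[/eqP h _] _ [/esym/h].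
- by move=> /norP[_ ep] /norP[_ ep'] [-> /IH[]// -> ->].
Qed.

Definition uedge (P : edge G -> Prop) x y := exists f, [/\ P f, src f = x & rng f = y].

End Reachability.

Section Insertion.
Variables (R : realType) (G : digraph).
Local Notation C := R[i].
Local Notation B := (bop R (dpath G)).
Local Notation A := (graph_algebra R G).
Implicit Types (v x y z : vert G) (f : edge G) (p q : seq (edge G)) (w u : dpath G).
Implicit Types (S T : B).

Definition all_inner := forall d : B -> B,
  is_derivation A d -> bounded_on A d -> is_inner A d.

(** The commutator with [T] maps the generators into [A], hence all of [A]: the elements with this
    property form a closed subalgebra. Innerness of this bounded derivation yields [T']. *)
Lemma inner_correction T : all_inner ->
  (forall f, A (Lop R (rng f) [:: f] * T - T * Lop R (rng f) [:: f])) ->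
  (forall v, A (Lop R v [::] * T - T * Lop R v [::])) ->
  exists2 T', A T' & forall S, A S -> S * (T - T') = (T - T') * S.
Proof.
move=> inner Te Tv; have sA := @algebra_sublin R G.
have AT S : A S -> A (S * T - T * S).
  move=> AS; suff: (A `&` [set S | A (S * T - T * S)]) S by case.
  apply: (generator_ind _ _ _ _ _ AS) => [||S1 S2 [A1 A1'] [A2 A2']|f|v].
  - apply: sublinI => //; split=> [|a S1 S2 /= A1 A2].
      by rewrite /= mul0r mulr0 subr0; case: sA.
    rewrite /= mulrDl mulrDr bop_scalerAl bop_scalerAr.
    rewrite (_ : _ - _ = a *: (S1 * T - T * S1) + (S2 * T - T * S2)); first exact: sA.2.
    by rewrite scalerBr opprD addrACA.
  - apply: lim_closedI; first exact: algebra_closed.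
    move=> S1 h; apply: algebra_closed => e e0.
    have M0 : 0 < opnorm T + opnorm T + 1 by rewrite ltr_wpDl ?addr_ge0 ?opnorm_ge0.
    have [S2 AS2 SS2] := h (e / (opnorm T + opnorm T + 1)) (divr_gt0 e0 M0).
    exists (S2 * T - T * S2) => //.
    rewrite (_ : _ - _ = (S1 - S2) * T - T * (S1 - S2)); last first.
      by rewrite mulrBl mulrBr !opprD !opprK addrACA.
    rewrite (le_trans (opnormD_le _ _))// opnormN.
    have h1 := le_trans (opnormM (S1 - S2) T) (ler_wpM2r (opnorm_ge0 _) SS2).
    have h2 := le_trans (opnormM T (S1 - S2)) (ler_wpM2l (opnorm_ge0 _) SS2).
    rewrite (le_trans (lerD h1 h2))// [X in _ + X]mulrC -mulrDr.
    by rewrite mulrAC ler_pdivrMr// ler_wpM2l ?lerDl// ltW.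
  - split; first exact: algebraM.
    rewrite /= (_ : _ - _ = S1 * (S2 * T - T * S2) + (S1 * T - T * S1) * S2).
      by apply: (sublinD sA); apply: algebraM.
    by rewrite mulrBr mulrBl !mulrA addrA subrK.
  - by rewrite L_edgeE; split=> //=; apply: algebra_Lop; rewrite /= eqxx.
  - by rewrite L_vertE; split=> //=; apply: algebra_Lop.
have [||T' AT' dT'] := inner (fun S => S * T - T * S).
- split=> // [c S1 S2 _ _|S1 S2 _ _].
    rewrite mulrDl mulrDr bop_scalerAl bop_scalerAr.
    by rewrite scalerBr opprD addrACA.
  by rewrite mulrBr mulrBl !mulrA [RHS]addrC addrA subrK.
- exists (opnorm T + opnorm T) => S _.
  rewrite (le_trans (opnormD_le _ _))// opnormN mulrDl lerD ?opnormM//.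
  by rewrite mulrC opnormM.
exists T' => // S AS; rewrite mulrBr mulrBl.
rewrite -[S * T](subrK (T * S)) (dT' _ AS) addrAC.
by rewrite [X in X + _ = _]addrAC subrr sub0r addrC.
Qed.

Lemma cf_LopM v p S w u u' : pre v p u u' -> cf (Lop R v p * S) w u' = cf S w u.
Proof. by move=> uu'; rewrite /cf bopM (rel_opE _ (pbij_pre v p) uu'). Qed.

Lemma cf_LopM0 v p S w u' : (forall u, ~ pre v p u u') -> cf (Lop R v p * S) w u' = 0.
Proof. by move=> uu'; rewrite /cf bopM rel_op0. Qed.

Lemma cf_MLop v p S w w' u : pre v p w w' -> cf (S * Lop R v p) w u = cf S w' u.
Proof. by move=> ww'; rewrite /cf bopM (rel_op_xi _ (pbij_pre v p) ww'). Qed.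

Section Commutant.
Variable Z : B.
Hypothesis Zcomm : forall S, A S -> S * Z = Z * S.

(** Operators commuting with [A] are invariant under left translation, the mirror image of
    [right_invariant]. Every contradiction drawn from innerness plays these two invariances against
    each other. *)
Lemma commutant_cf v p w w' u u' : valid_path v p ->
  pre v p w w' -> pre v p u u' -> cf Z w' u' = cf Z w u.
Proof.
move=> vp ww' uu'; rewrite -(cf_LopM _ _ uu') Zcomm; last exact: algebra_Lop.
by rewrite (cf_MLop _ _ ww').
Qed.

Lemma commutant_cf0 v p w w' u' : valid_path v p ->
  pre v p w w' -> (forall u, ~ pre v p u u') -> cf Z w' u' = 0.
Proof.
move=> vp ww' nu; rewrite -(cf_MLop _ _ ww') -Zcomm; last exact: algebra_Lop.
exact: cf_LopM0.
Qed.

End Commutant.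

Variables (e : edge G) (m1 m2 : seq (edge G)).
Let m := m1 ++ e :: m2.
Hypotheses (ce : cross e) (vm : valid_path (rng e) m) (sm : psrc (rng e) m = src e).

(* xi_{p e q} |-> xi_{p m q}; this is well defined because a path contains the
   cross edge [e] at most once. *)
Definition ins w u :=
  exists p q, (val w).2 = p ++ e :: q /\ val u = ((val w).1, p ++ m ++ q).

(** The inserted path [m] contains [e] as well, so the single occurrence of [e] in the image
    recovers the position of the substitution. *)
Lemma pbij_ins : pbij ins.
Proof.
split=> [w u u' [p [q [wE uE]]] [p' [q' [wE' uE']]]|
         w w' u [p [q [wE uE]]] [p' [q' [wE' uE']]]].
  have := dpath_valid w; rewrite wE => /(cross_notin ce)/andP[ep _].
  have := dpath_valid w; rewrite wE' => /(cross_notin ce)/andP[ep' _].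
  move: wE'; rewrite wE => /(split_uniq ep ep')[pp' qq']; subst p' q'.
  by apply: val_inj; rewrite uE uE'.
have assoc r s : r ++ m ++ s = (r ++ m1) ++ e :: (m2 ++ s) by rewrite /m -!catA.
have := dpath_valid u; rewrite uE assoc => /(cross_notin ce)/andP[ep _].
have := dpath_valid u; rewrite uE' assoc => /(cross_notin ce)/andP[ep' _].
move: uE'; rewrite uE !assoc => -[ww' /(split_uniq ep ep')[/cat_injr pp' /eqP]].
rewrite eqseq_cat// eqxx => /eqP qq'.
by apply: dpath_eq => //; rewrite wE wE' pp' qq'.
Qed.
Hint Resolve pbij_ins : core.

Definition Ins : B := rel_op R ins.

Lemma ins_valid w p q : (val w).2 = p ++ e :: q ->
  valid_path (val w).1 (p ++ m ++ q).
Proof.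
move=> wE; have := dpath_valid w; rewrite wE !valid_cat /= => /and3P[-> /eqP <- vq].
by move: vm sm; rewrite /m valid_cat => -> ->.
Qed.

Lemma ins_total w p q : (val w).2 = p ++ e :: q ->
  ins w (mkp (val w).1 (p ++ m ++ q)).
Proof. by move=> wE; exists p, q; split=> //; rewrite mkpE//; exact: ins_valid. Qed.

Lemma ins_rng w u : ins w u -> (val u).1 = (val w).1.
Proof. by case=> p [q [_ ->]]. Qed.

Lemma Ins_edge f : f <> e -> Lop R (rng f) [:: f] * Ins = Ins * Lop R (rng f) [:: f].
Proof.
move=> fe; rewrite (rel_opM R (pbij_pre _ _) pbij_ins) (rel_opM R pbij_ins (pbij_pre _ _)); apply: eq_rel_op => w u; split.
  move=> [w' iw [rw' uE]]; have rw := ins_rng iw; case: iw => p [q [wE w'E]].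
  have pf : pre (rng f) [:: f] w (mkp (rng f) (f :: (val w).2)).
    by apply: pre_total; rewrite /= ?eqxx// -rw.
  exists (mkp (rng f) (f :: (val w).2)) => //; case: pf => _ fE.
  by exists (f :: p), q; rewrite fE uE wE w'E.
move=> [w' [rw w'E] [p [q [pE uE]]]]; rewrite w'E /= in pE uE.
case: p pE uE => [[]//|f' p [<- wE] uE].
exists (mkp (val w).1 (p ++ m ++ q)); first exact: ins_total.
by split; rewrite mkpE ?uE//; exact: ins_valid.
Qed.

Lemma Ins_vert v : Lop R v [::] * Ins = Ins * Lop R v [::].
Proof.
rewrite (rel_opM R (pbij_pre _ _) pbij_ins) (rel_opM R pbij_ins (pbij_pre _ _));
  apply: eq_rel_op => w u; split.
  move=> [w' iw [rw uE]]; exists w; last by have -> : u = w' by apply: dpath_eq; rewrite uE.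
  by rewrite (ins_rng iw) in rw; split=> //; rewrite [LHS]surjective_pairing rw.
move=> [w' [rw w'E] iw]; have E : w' = w by apply: dpath_eq; rewrite w'E.
subst w'; exists u => //; split; first by rewrite (ins_rng iw).
by rewrite [LHS]surjective_pairing (ins_rng iw) rw.
Qed.

Lemma Ins_self : Ins * Lop R (rng e) [:: e] = Lop R (rng e) m.
Proof.
rewrite (rel_opM R pbij_ins (pbij_pre _ _)); apply: eq_rel_op => w u; split.
  move=> [w' [rw w'E] [p [q [pE uE]]]].
  have := dpath_valid w'; rewrite pE => /(cross_notin ce)/andP[ep _].
  rewrite w'E /= in pE uE.
  by have [] := @split_uniq _ e [::] _ _ _ isT ep pE => p0 q0; subst p q; split;
    rewrite ?sm// uE.
move=> [rw uE]; rewrite sm in rw.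
have pe : pre (rng e) [:: e] w (mkp (rng e) (e :: (val w).2)).
  by apply: pre_total; rewrite /= ?eqxx.
exists (mkp (rng e) (e :: (val w).2)) => //; case: pe => _ wE.
by exists [::], (val w).2; rewrite wE uE.
Qed.

(** Every path in the range of [Ins] already contains [e] and cannot be prolonged by [e] again. *)
Lemma Ins_self0 : Lop R (rng e) [:: e] * Ins = 0.
Proof.
rewrite (rel_opM R (pbij_pre _ _) pbij_ins);
  apply: rel_op_empty => w u [w' [p [q [wE w'E]]] [rw uE]].
have := dpath_valid u; rewrite uE => /(@cross_notin _ _ _ [::] _ ce)/=.
by rewrite w'E /m /= !mem_cat !inE eqxx !orbT.
Qed.

Lemma Ins_commutator f : A (Lop R (rng f) [:: f] * Ins - Ins * Lop R (rng f) [:: f]).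
Proof.
have sA := @algebra_sublin R G.
have [->|/eqP/Ins_edge->] := eqVneq f e; last by rewrite subrr; case: sA.
by rewrite Ins_self0 Ins_self sub0r; apply: (sublinN sA); exact: algebra_Lop.
Qed.

Lemma Ins_correction : all_inner ->
  exists2 T', A T' & forall S, A S -> S * (Ins - T') = (Ins - T') * S.
Proof.
move=> inner; apply: inner_correction => // [f|v]; first exact: Ins_commutator.
by rewrite Ins_vert subrr; case: (@algebra_sublin R G).
Qed.

End Insertion.

(** * Finiteness, bridges and exits when all bounded derivations are inner *)

Section InnerConsequences.
Variables (R : realType) (G : digraph).
Local Notation C := R[i].
Local Notation B := (bop R (dpath G)).
Local Notation A := (graph_algebra R G).
Implicit Types (v x y z : vert G) (e f : edge G) (p q c d : seq (edge G)) (w u : dpath G).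
Implicit Types (S T Z : B).
Hypothesis inner : all_inner R G.

Lemma edge_valid f : valid_path (rng f) [:: f].
Proof. by rewrite /= eqxx. Qed.
Hint Resolve edge_valid : core.

Definition epath f : dpath G := mkp (rng f) [:: f].

Lemma epathE f : val (epath f) = (rng f, [:: f]). Proof. exact: mkpE. Qed.

Lemma pre_vtx v p : valid_path v p -> pre v p (vtx (psrc v p)) (mkp v p).
Proof. by move=> vp; split; rewrite //= mkpE// cats0. Qed.

Lemma commutant_diag Z f : (forall S, A S -> S * Z = Z * S) ->
  cf Z (epath f) (epath f) = cf Z (vtx (src f)) (vtx (src f)).
Proof.
by move=> Zc; apply: (commutant_cf Zc (edge_valid f)); exact: (pre_vtx (edge_valid f)).
Qed.

(** Right invariance ties the diagonal coefficient at the path [f] to the range of [f], whereas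
    [commutant_diag] ties it to the source. Together they compare the coefficients at both ends of
    an edge. *)
Lemma algebra_diag T f : A T ->
  cf T (epath f) (epath f) = cf T (vtx (rng f)) (vtx (rng f)).
Proof.
move=> AT; rewrite (right_invariant (p := [::]) AT) ?epathE//=.
by rewrite mkp_nil.
Qed.

(** A path operator has at most one nonzero diagonal coefficient at vertices, and the property
    passes to linear combinations and norm limits. *)
Lemma algebra_diag_c0 T (eps : R) : A T -> 0 < eps ->
  exists s : seq (vert G), forall x, x \notin s -> normc (cf T (vtx x) (vtx x)) <= eps.
Proof.
move=> AT; move: eps; apply: (span_ind (P := [set T | forall eps : R, 0 < eps -> exists
  s : seq (vert G), forall x, x \notin s -> normc (cf T (vtx x) (vtx x)) <= eps]) _ _ _ AT).
- split=> [eps e0|a S1 S2 h1 h2 eps e0].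
    by exists [::] => x _; rewrite cf0; rewrite normc0 ltW.
  have M0 : 0 < normc a + 1 by rewrite ltr_wpDl ?normc_ge0.
  have [s1 h1'] := h1 (eps / 2 / (normc a + 1)) ltac:(by rewrite !divr_gt0).
  have [s2 h2'] := h2 (eps / 2) ltac:(by rewrite divr_gt0).
  exists (s1 ++ s2) => x; rewrite mem_cat => /norP[/h1' b1 /h2' b2].
  rewrite cfD cfZ (le_trans (le_normcD _ _))// normcM (splitr eps) lerD//.
  rewrite (le_trans (ler_wpM2l (normc_ge0 _) b1))// mulrCA ler_piMr ?divr_ge0 ?(ltW e0)//.
  by rewrite ler_pdivrMr// mul1r lerDl.
- move=> S h eps e0.
  have [S' h' SS'] := h (eps / 2) ltac:(by rewrite divr_gt0).
  have [s sE] := h' (eps / 2) ltac:(by rewrite divr_gt0).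
  exists s => x /sE b; rewrite -[S](subrK S') cfD (le_trans (le_normcD _ _))//.
  by rewrite (splitr eps) lerD// (le_trans (cf_le _ _ _)).
- move=> v p vp eps e0; exists [:: v] => x; rewrite inE => xv.
  rewrite cf_Lop; case: asboolP => [[_ [/eqP]]|_]; first by rewrite (negPf xv).
  by rewrite normc0 ltW.
Qed.

Lemma connected_const (z : vert G -> C) : connected_digraph G ->
  (forall f, z (src f) = z (rng f)) -> forall x y, z x = z y.
Proof.
move=> conn zE x y;
  elim: (conn x y) => {x y} [x y [f [<- <-]]|x|x y _ ->|x y t _ -> _ ->] //.
Qed.

Lemma seq_avoid (f : nat -> vert G) (s : seq (vert G)) : injective f ->
  exists N, forall n, (N <= n)%N -> f n \notin s.
Proof.
move=> fi; elim: s => [|x s [N h]]; first by exists 0%N.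
have [[k fk]|nk] := pselect (exists k, f k = x).
  exists (maxn N k.+1) => n; rewrite geq_max => /andP[Nn kn].
  rewrite inE negb_or h// andbT -fk (inj_eq fi); case: eqP => // nk.
  by rewrite nk ltnn in kn.
exists N => n Nn; rewrite inE negb_or h// andbT; apply/eqP => fn.
by apply: nk; exists n.
Qed.

Lemma inner_finite_vert : connected_digraph G -> finite_set [set: vert G].
Proof.
move=> conn; apply: contrapT => /infiniteP/card_leP/unsquash f0.
pose f n := val (f0 (to_setT n)).
have fi : injective f.
  by move=> i j /val_inj/(inj _ _) ij; have := ij (mem_setT _) (mem_setT _) => -[].
(* Every other term of an injective sequence, so that infinitely many vertices lie in [V] and
   infinitely many outside. *)
pose V := [set f n.*2 | n in [set: nat]].
pose r w u := w = u /\ V (val w).1.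
have br : pbij r by split=> [w u u' [<- _] [<- _]|w w' u [-> _] [-> _]].
pose T := rel_op R r.
have diagT w : cf T w w = `[< V (val w).1 >]%:R.
  rewrite cf_rel_op//; congr (nat_of_bool _)%:R.
  by apply/asboolP/asboolP => [[]|].
have [||T' AT' Zc] := inner_correction (T := T) inner.
- move=> e.
  suff -> : Lop R (rng e) [:: e] * T - T * Lop R (rng e) [:: e] =
      ((`[< V (src e) >]%:R - `[< V (rng e) >]%:R) : C) *: Lop R (rng e) [:: e].
    by apply: (sublinZ _ (@algebra_sublin R G)); exact: algebra_Lop.
  rewrite scalerBl; congr (_ - _).
    rewrite (rel_opM R (pbij_pre _ _) br); case: (asboolP (V (src e))) => Ve;
      rewrite ?scale1r ?scale0r.
      apply: eq_rel_op => w u; split=> [[w' [<- _]]//|wu]; exists w => //; split=> //.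
      by case: wu => ->.
    by apply: rel_op_empty => w u [w' [<- Vw] [rw _]]; apply: Ve; rewrite rw in Vw.
  rewrite (rel_opM R br (pbij_pre _ _)); case: (asboolP (V (rng e))) => Ve;
    rewrite ?scale1r ?scale0r.
    apply: eq_rel_op => w u; split=> [[w' wu [<- _]]//|wu]; exists u => //; split=> //.
    by case: wu => _ ->.
  by apply: rel_op_empty => w u [w' [_ w'E] [_ Vw]]; apply: Ve; rewrite w'E in Vw.
- move=> v; suff -> : Lop R v [::] * T = T * Lop R v [::].
    by rewrite subrr; case: (@algebra_sublin R G).
  rewrite (rel_opM R br (pbij_pre _ _)) (rel_opM R (pbij_pre _ _) br);
    apply: eq_rel_op => w u; split=> [[w' [ww' Vw] [rw uE]]|[w' [rw uE] [wu Vw]]].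
    subst w'; exists u; first by [].
    by split=> //; rewrite uE; rewrite -(_ : (val w).1 = v).
  subst w'; exists w; last by [].
  by split=> //; move: Vw; rewrite uE /= rw.

(* Both [T] and [T'] take at the path [g] their value at the range of [g], while [T - T'] takes
   there its value at the source. Hence [z] is constant on the connected graph. *)
pose z x := cf (T - T') (vtx x) (vtx x).
have zE g : z (src g) = z (rng g).
  rewrite /z -(commutant_diag _ Zc) !cfD !cfN (algebra_diag _ AT') !diagT.
  by rewrite epathE.
have zc := connected_const conn zE.
have zV x : z x = `[< V x >]%:R - cf T' (vtx x) (vtx x) by rewrite /z cfD cfN diagT.
(* Far out in the sequence the diagonal of [T'] is at most 1/3, so the constant [z] is within 1/3
   both of 1 and of 0. *)
have [s sE] := algebra_diag_c0 AT' (eps := 1 / 3) ltac:(lra).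
have [N NE] := seq_avoid s fi.
have V1 : z (f N.*2) = 1 - cf T' (vtx (f N.*2)) (vtx (f N.*2)).
  by rewrite zV asboolT//; exists N.
have V0 : z (f N.*2.+1) = - cf T' (vtx (f N.*2.+1)) (vtx (f N.*2.+1)).
  rewrite zV asboolF ?sub0r// => -[k _ /fi kN].
  by move/(congr1 odd): kN; rewrite /= !odd_double.
have h1 := sE _ (NE N.*2 ltac:(lia)).
have h2 := sE _ (NE N.*2.+1 ltac:(lia)).
have : normc (1 : C) <= 2 / 3.
  rewrite (_ : 1 = cf T' (vtx (f N.*2)) (vtx (f N.*2)) - cf T' (vtx (f N.*2.+1)) (vtx (f N.*2.+1))).
    by rewrite (le_trans (le_normcD _ _))// normcN; lra.
  by rewrite -V0 (zc _ (f N.*2)) V1 addrC subrK.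
rewrite normc1; lra.
Qed.

Lemma ins_vtx e p q x u : ~ ins e p q (vtx x) u.
Proof. by case=> -[|? ?] [? []]. Qed.

(** With [m] equal to [e] itself, [Ins] is the projection onto the paths containing [e]. The vertex
    coefficients [phi] of the correction [T'] then jump by 1 across [e] and are equal at the ends of
    any other edge, so the ends of [e] cannot be joined avoiding [e]. *)
Lemma inner_bridge e : cross e ->
  ~ clos_refl_sym_trans (vert G) (uedge (fun f => f <> e)) (src e) (rng e).
Proof.
move=> ce conn.
have sm : psrc (rng e) ([::] ++ [:: e]) = src e by [].
have vm : valid_path (rng e) ([::] ++ [:: e]) by exact: edge_valid.
have [T' AT' Zc] := Ins_correction ce vm sm inner.
pose phi x := cf T' (vtx x) (vtx x).
have br := pbij_ins [::] _ ce.
have phiE f : phi (src f) = phi (rng f) - (f == e)%:R.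
  have := commutant_diag f Zc.
  rewrite !cfD !cfN (algebra_diag _ AT') !cf_rel_op// => /esym/eqP.
  rewrite asboolF; last exact: ins_vtx.
  rewrite sub0r eq_sym -subr_eq0 opprK addrAC => /eqP h.
  suff E : `[< ins e [::] [::] (epath f) (epath f) >] = (f == e).
    rewrite E in h; rewrite /phi; apply/eqP; rewrite eq_sym -subr_eq0 -oppr_eq0 -h.
    by apply/eqP; ring.
  apply/asboolP/eqP => [[p [q []]]|->].
    by rewrite epathE /=; case: p => [[]//|? []].
  by exists [::], [::]; rewrite epathE.
have const x y : clos_refl_sym_trans (vert G) (uedge (fun f => f <> e)) x y -> phi x = phi y.
  elim=> {x y} [x y [f [/eqP fe <- <-]]|x|x y _ ->|x y t _ -> _ ->] //.
  by rewrite phiE (negPf fe) subr0.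
have := phiE e; rewrite (const _ _ conn) eqxx => /eqP.
by rewrite eq_sym subr_eq -subr_eq0 opprD addrA subrr sub0r oppr_eq0 oner_eq0.
Qed.

Definition cycle_at x c := [/\ c != [::], valid_path x c & psrc x c = x].

Lemma cross_notin_cycle e x c : cross e -> cycle_at x c -> e \notin c.
Proof.
move=> ce [_ vc sc]; apply/negP => /path.splitPr h; case: h vc sc => p q vc sc.
move: vc sc; rewrite valid_cat psrc_cat /= => /and3P[vp /eqP ep vq] qx.
apply: ce; apply: (@reach_trans _ x).
  by exists p; rewrite ?ep.
by exists q.
Qed.

(** Here [Z] is the substitution of [e c] for [e] minus its correction [T']. It is left invariant
    everywhere, and on paths without [e] it coincides with [- T'], so there it is right invariant
    too; its coefficients at the cycles of [src e] single out [c]. *)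
Lemma exit_correction e c : cross e -> cycle_at (src e) c ->
  exists Z, [/\ forall S, A S -> S * Z = Z * S,
    cf Z (vtx (src e)) (mkp (src e) c) = 1,
    forall q, cycle_at (src e) q -> q <> c -> cf Z (vtx (src e)) (mkp (src e) q) = 0 &
    forall w u, e \notin (val w).2 -> cf Z w u != 0 ->
      exists2 p, valid_path (val u).1 p & 
        [/\ psrc (val u).1 p = (val w).1, (val u).2 = p ++ (val w).2 &
          cf Z (vtx (val w).1) (mkp (val u).1 p) = cf Z w u]].
Proof.
move=> ce cc; have [cn0 vc sc] := cc.
have vm : valid_path (rng e) ([::] ++ e :: c) by rewrite /= eqxx.
have sm : psrc (rng e) ([::] ++ e :: c) = src e by [].
have [T' AT' Zc] := Ins_correction ce vm sm inner.
have br := pbij_ins [::] _ ce.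
set Z := Ins R e _ _ - T' in Zc.
have ZT w u : e \notin (val w).2 -> cf Z w u = - cf T' w u.
  move=> ew; rewrite cfD cfN cf_rel_op// asboolF ?sub0r// => -[p [q [wE _]]].
  by rewrite wE mem_cat inE eqxx orbT in ew.
have Zq q : cycle_at (src e) q -> cf Z (vtx (src e)) (mkp (src e) q) = (q == c)%:R.
  move=> cq; have [qn0 vq sq] := cq.
  have veq : valid_path (rng e) (e :: q) by rewrite /= eqxx.
  have pq : pre (rng e) [:: e] (mkp (src e) q) (mkp (rng e) (e :: q)).
    by split; rewrite mkpE//= mkpE.
  (* Left translation by [e] moves the coefficient to the pair [e], [e q]. There [T'] vanishes,
     since [e q] does not have [e] as its last letter. *)
  rewrite -(commutant_cf Zc (edge_valid e) (pre_vtx (edge_valid e)) pq).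
  rewrite cfD cfN cf_rel_op// (_ : cf T' _ _ = 0); last first.
    apply/eqP; apply: contraT => /(right_invariant0 AT')[p [_]].
    rewrite mkpE// epathE /= => eqp.
    have : e \in q.
      case: p eqp => [[q0]|? p [_ ->]]; first by rewrite q0 in qn0.
      by rewrite mem_cat inE eqxx orbT.
    by rewrite (negPf (cross_notin_cycle ce cq)).
  rewrite subr0 (_ : `[< _ >] = (q == c))//.
  apply/asboolP/eqP => [[p [p' []]]|->].
    rewrite epathE mkpE//=; case: p => [[<-]|? []//] /= [].
    by rewrite cats0.
  by exists [::], [::]; rewrite epathE mkpE//= cats0.
exists Z; split=> //.
- by rewrite Zq// eqxx.
- by move=> q cq /eqP/negPf qc; rewrite Zq// qc.
- move=> w u ew; rewrite ZT// oppr_eq0 => /(right_invariant0 AT')[p [sp uE]].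
  have := dpath_valid u; rewrite uE valid_cat => /andP[vp _].
  exists p => //; split=> //.
  by rewrite ZT// (right_invariant AT' sp uE).
Qed.

(** The coefficient of [Z] at the pair [d], [d c] is 1 by left invariance. Right invariance forces
    [d c = p d] with the coefficient at [p] equal to 1, so [p] is [c]. *)
Lemma inner_cycles_commute e c d : cross e ->
  cycle_at (src e) c -> cycle_at (src e) d -> c ++ d = d ++ c.
Proof.
move=> ce cc cd; have [Z [Zc Z1 Z0 Zr]] := exit_correction ce cc.
have [cn0 vc sc] := cc; have [dn0 vd sd] := cd.
have vdc : valid_path (src e) (d ++ c) by rewrite valid_cat vd sd.
have pdc : pre (src e) d (mkp (src e) c) (mkp (src e) (d ++ c)).
  by split; rewrite mkpE ?sd// mkpE.
have := pre_vtx vd; rewrite sd => pd.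
have h := commutant_cf Zc vd pd pdc; rewrite Z1 in h.
have [||p] := Zr (mkp (src e) d) (mkp (src e) (d ++ c)).
- by rewrite mkpE//; exact: cross_notin_cycle cd.
- by rewrite h oner_eq0.
rewrite !mkpE// => vp [sp pE]; rewrite h /= in vp sp pE * => Zp.
have [pc|npc] := pselect (p = c); first by rewrite pE pc.
move: Zp; rewrite Z0 => // [/eqP|]; first by rewrite eq_sym oner_eq0.
split=> //; apply/eqP => p0; move: pE; rewrite p0 /= => /(congr1 size).
by rewrite size_cat => /eqP; rewrite -[X in _ == X]addn0 eqn_add2l size_eq0 (negPf cn0).
Qed.

(** For [p] leading from [src e] to [src f], the coefficient of [Z] at the pair [f p], [f p c] is 1.
    As [e] is not in [f p], right invariance gives [f p c = q f p] with [q] nonempty, although [f]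
    occurs only once in a path. *)
Lemma inner_exit_unique e f c : cross e -> cross f -> cycle_at (src e) c ->
  reach (src e) (src f) -> reach (src f) (src e) -> e = f.
Proof.
move=> ce cf0 cc [p vp sp] fe; apply: contrapT => nef.
have [Z [Zc Z1 Z0 Zr]] := exit_correction ce cc.
have [cn0 vc sc] := cc.
have vfp : valid_path (rng f) (f :: p) by rewrite /= eqxx.
have sfp : psrc (rng f) (f :: p) = src e by [].
have vfpc : valid_path (rng f) ((f :: p) ++ c) by rewrite valid_cat vfp sfp.
have pfpc : pre (rng f) (f :: p) (mkp (src e) c) (mkp (rng f) ((f :: p) ++ c)).
  by split; rewrite mkpE ?sfp// mkpE.
have := pre_vtx vfp; rewrite sfp => pfp.
have h := commutant_cf Zc vfp pfp pfpc; rewrite Z1 in h.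
have ep : e \notin f :: p.
  rewrite inE negb_or; apply/andP; split; first exact/eqP.
  apply/negP => /path.splitPr hs; case: hs vp sp => p1 p2.
  rewrite valid_cat psrc_cat /= => /and3P[vp1 /eqP ep1 vp2] p2e.
  apply: ce; apply: (@reach_trans _ (src f)) => //.
  by exists p1 => //; rewrite ep1.
have [||q] := Zr (mkp (rng f) (f :: p)) (mkp (rng f) ((f :: p) ++ c)).
- by rewrite mkpE.
- by rewrite h oner_eq0.
rewrite !mkpE// => vq [sq qE _].
have [_ fc] := andP (cross_notin (p := [::]) cf0 vfpc).
case: q qE {vq sq} => [|f' q] qE.
  move: qE => /(congr1 size) /=.
  by rewrite size_cat => /eqP;
    rewrite eqSS -[X in _ == X]addn0 eqn_add2l size_eq0 (negPf cn0).
by move: fc; case: qE => _; rewrite -/cat => ->; rewrite mem_cat inE eqxx orbT.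
Qed.

End InnerConsequences.
(** * A bounded analytic function with divergent Fejer means *)

Section Rotation.
Variable R : realType.
Implicit Types (p q y s : nat -> R) (P Q : {poly R}).

Definition tau (k : nat) : R := (k.+2%:R)^-1.

Lemma tau_gt0 k : 0 < tau k. Proof. by rewrite invr_gt0. Qed.

Lemma tau_le k : tau k <= 2^-1.
Proof. by rewrite lef_pV2 ?posrE// ler_nat. Qed.

Lemma rotation_growth s : (forall k, s k.+1 <= (1 + tau k ^+ 2) * s k) ->
  0 <= s 0%N -> forall k, s k <= 2 * s 0%N.
Proof.
move=> sS s0.
(* The majorant dominates the product: its consecutive quotients are [1 + 1 / ((k+1)(k+3))], which
   exceeds [1 + tau k ^+ 2]. *)
have sle k : s k <= 2 * s 0%N * ((k%:R + 1) / (k%:R + 2)).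
  elim: k => [|k IH]; first by rewrite mulr0n !add0r mul1r mulrAC divff ?mul1r.
  apply: (le_trans (sS k)); apply: (le_trans (ler_wpM2l _ IH)).
    by rewrite addr_ge0// sqr_ge0.
  rewrite mulrCA; apply: ler_wpM2l; first by rewrite mulr_ge0.
  rewrite /tau -[k.+2]addn2 -[k.+1]addn1 !natrD.
  have : (0 : R) <= k%:R by []; move: (k%:R : R) => x x0.
  rewrite -subr_ge0.
  rewrite (_ : _ - _ = ((x + 2) ^+ 3 * (x + 3))^-1).
    by rewrite invr_ge0 mulr_ge0 ?exprn_ge0// addr_ge0.
  by field; apply/andP; split; apply: lt0r_neq0; lra.
move=> k; apply: (le_trans (sle k)); rewrite ler_piMr ?mulr_ge0//.
have k2 : (0 : R) < k%:R + 2 by rewrite ltr_wpDl.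
by rewrite ler_pdivrMr// mul1r lerD2l ler1n.
Qed.

(** Divergence of the harmonic series: passing from [n] to [2 n] adds at least
    [n * eta / (2 n + 1)], hence at least [eta / 3]. *)
Lemma unbounded_drift y (eta b : R) (K : nat) : 0 < eta ->
  (forall k, (K <= k)%N -> y k + tau k * eta <= y k.+1) ->
  exists k, b < y k.
Proof.
move=> eta0 yS.
have step n i : (K <= n)%N -> (i <= n)%N -> y n + i%:R * (eta / (n.*2.+1)%:R) <= y (n + i)%N.
  move=> Kn; elim: i => [|i IH] ni; first by rewrite mul0r addr0 addn0.
  have h := yS (n + i)%N (leq_trans Kn (leq_addr _ _)).
  rewrite addnS; apply: le_trans h; rewrite -[i.+1]addn1 natrD mulrDl mul1r addrA.
  apply: lerD; first exact: IH (ltnW ni).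
  rewrite mulrC ler_wpM2r ?(ltW eta0)// lef_pV2 ?posrE// ler_nat; lia.
have dbl n : (K < n)%N -> y n + eta / 3 <= y n.*2.
  move=> Kn; have n0 : (0 < n)%N by lia.
  have := step n n (ltnW Kn) (leqnn _); rewrite addnn; apply: le_trans.
  rewrite lerD2l mulrCA ler_wpM2l ?(ltW eta0)//.
  rewrite ler_pdivlMr ?ltr0n// mulrC ler_pdivrMr// -natrM ler_nat; lia.
have iter j : y K.+1 + j%:R * (eta / 3) <= y (K.+1 * 2 ^ j)%N.
  elim: j => [|j IH]; first by rewrite mul0r addr0 muln1.
  rewrite expnS mulnCA mul2n; apply: (le_trans _ (dbl _ _)); last first.
    by rewrite leq_pmulr// expn_gt0.
  by rewrite -[j.+1]addn1 natrD mulrDl mul1r addrA lerD2r.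
pose j := Num.bound `|(b - y K.+1) / (eta / 3)|.
exists (K.+1 * 2 ^ j)%N; apply: lt_le_trans (iter j).
rewrite -ltrBlDl -ltr_pdivrMr ?divr_gt0//.
exact: le_lt_trans (ler_norm _) (archi_boundP (normr_ge0 _)).
Qed.

Lemma rotation_not_cauchy p q : p 0%N = 1 -> q 0%N = 0 ->
  (forall k, p k.+1 = p k + tau k * q k) -> (forall k, q k.+1 = q k - tau k * p k) ->
  ~ forall eps : R, 0 < eps -> exists K, forall k, (K <= k)%N -> `|p k - p K| <= eps.
Proof.
move=> p0 q0 pS qS cauchy.
pose s k := p k ^+ 2 + q k ^+ 2.
have sS k : s k.+1 = (1 + tau k ^+ 2) * s k by rewrite /s pS qS; ring.
have s0 : s 0%N = 1 by rewrite /s p0 q0 expr1n expr0n addr0.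
have s2 k : s k <= 2.
  have := @rotation_growth s _ _ k; rewrite s0 mulr1; apply=> // j.
  by rewrite sS.
have s1 k : 1 <= s k.
  elim: k => [|k IH]; first by rewrite s0.
  by rewrite sS (le_trans IH)// ler_peMl ?lerDl ?sqr_ge0// (le_trans _ IH).
(* From [K] on, [p] stays within 1/8 of [p K]. If [|p K|] is at least 1/4, then [p] keeps its sign
   and is at least 1/8 in size, so [q] drifts off, although [s] is bounded by 2. *)
have [K pK] := cauchy 8^-1 ltac:(by rewrite invr_gt0).
have [pos|/ltW npos] := leP 4^-1 (p K).
  have [|k] := @unbounded_drift (fun k => - q k) 8^-1 2 K ltac:(by rewrite invr_gt0).
    move=> k /pK; rewrite ler_norml => /andP[h1 h2]; rewrite qS opprB addrC lerD2r.
    by rewrite ler_wpM2l ?(ltW (tau_gt0 k))//; lra.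
  by move=> h; have := s2 k; rewrite /s; nra.
have [neg|/ltW nneg] := leP (p K) (- 4^-1).
  have [|k] := @unbounded_drift q 8^-1 2 K ltac:(by rewrite invr_gt0).
    move=> k /pK; rewrite ler_norml => /andP[h1 h2]; rewrite qS lerD2l -mulrN.
    by rewrite ler_wpM2l ?(ltW (tau_gt0 k))//; lra.
  by move=> h; have := s2 k; rewrite /s; nra.
(* Remaining case: [|p k|] is at most 3/8, so [q k ^+ 2] is at least 55/64. The product [p k * q k]
   grows by [tau k * (q^2 - p^2 - tau k * p q)], where the last term is at most 1/2, and so it
   drifts off. *)
have [|k h] := @unbounded_drift (fun k => p k * q k) 8^-1 2 K ltac:(by rewrite invr_gt0).
  move=> k /pK; rewrite ler_norml => /andP[h1 h2].
  have t0 := tau_gt0 k; have t1 := tau_le k; have := s1 k; have := s2 k.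
  rewrite pS qS /s; move: (p k) (q k) (tau k) t0 t1 h1 h2 => a b t t0 t1 h1 h2 s2k s1k.
  have ha : a ^+ 2 <= 9 / 64.
    have h3 : 0 <= 3 / 8 - a by lra.
    have h4 : 0 <= 3 / 8 + a by lra.
    by have := mulr_ge0 h3 h4; nra.
  have hab : a * b <= 1 by have := sqr_ge0 (a - b); nra.
  rewrite -subr_ge0 (_ : _ - _ = t * (b ^+ 2 - a ^+ 2 - t * (a * b) - 8^-1)); last by ring.
  rewrite mulr_ge0 ?(ltW t0)//.
  have : t * (a * b) <= 2^-1.
    have [ab0|ab0] := leP 0 (a * b); last by have := mulr_ge0_le0 (ltW t0) (ltW ab0); lra.
    by have := ler_pM (ltW t0) ab0 t1 hab; lra.
  by lra.
by have := sqr_ge0 (p k - q k); have := s2 k; rewrite /s; nra.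
Qed.

(** The squared norm of [P] in the Hardy space of the disc. *)
Definition N2 P : R := \sum_(i < size P) P`_i ^+ 2.

Lemma N2_widen P n : (size P <= n)%N -> N2 P = \sum_(i < n) P`_i ^+ 2.
Proof.
move=> Pn; rewrite /N2 (big_ord_widen n (fun i => P`_i ^+ 2) Pn) big_mkcond.
by apply: eq_bigr => i _; case: ltnP => // /(nth_default 0) ->; rewrite expr0n.
Qed.

Lemma N2_ge0 P : 0 <= N2 P. Proof. by apply: sumr_ge0 => i _; exact: sqr_ge0. Qed.

Lemma N2Z a P : N2 (a *: P) = a ^+ 2 * N2 P.
Proof.
rewrite (@N2_widen _ (size P)) ?size_scale_leq// /N2 mulr_sumr.
by apply: eq_bigr => i _; rewrite coefZ exprMn.
Qed.

Lemma N2Xn m P : N2 ('X^m * P) = N2 P.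
Proof.
rewrite (@N2_widen _ (m + size P)); last first.
  by rewrite (leq_trans (size_polyMleq _ _))// size_polyXn.
rewrite big_split_ord /= big1 ?add0r => [|i _]; last first.
  by rewrite coefXnM /= ltn_ord expr0n.
by apply: eq_bigr => i _; rewrite coefXnM ltnNge leq_addr /= addKn.
Qed.

Lemma N2D P Q m : (size P <= m)%N -> (forall i, (i < m)%N -> Q`_i = 0) ->
  N2 (P + Q) = N2 P + N2 Q.
Proof.
move=> Pm Qm; pose n := (m + size Q)%N.
rewrite !(@N2_widen _ n) ?(leq_trans (size_polyD _ _))//; last 3 first.
- by rewrite /n; lia.
- by rewrite /n; lia.
- by rewrite geq_max /n; lia.
rewrite -big_split /=; apply: eq_bigr => i _; rewrite coefD.
have [im|mi] := ltnP i m; first by rewrite Qm// expr0n !addr0.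
by rewrite (nth_default _ (leq_trans Pm mi)) expr0n !add0r.
Qed.

(* Each step multiplies |P|^2 + |Q|^2 by 1 + tau^2 on the unit circle and
   rotates (P(1), Q(1)) by an angle of about tau; the squares of the tau_k are
   summable, the tau_k are not. The exponents grow so fast that the Fejer mean
   of order [rotm k] of the limit at 1 is P_k(1) up to 1 / (k + 1). *)
Definition gap k P Q (m : nat) : nat :=
  maxn m (size P + size Q + k +
    Num.bound (k.+1%:R * \sum_(i < size P) (i%:R * `|P`_i|))).

Fixpoint rotation_state k : {poly R} * {poly R} * nat :=
  if k is k'.+1 then
    let: (P, Q, m) := rotation_state k' in
    let P' := P + tau k' *: ('X^m * Q) in
    let Q' := 'X^m * Q - tau k' *: P in
    (P', Q', gap k P' Q' m)
  else (1, 0, gap 0 1 0 1).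

Definition rotP k := (rotation_state k).1.1.
Definition rotQ k := (rotation_state k).1.2.
Definition rotm k := (rotation_state k).2.

Lemma rotPS k : rotP k.+1 = rotP k + tau k *: ('X^(rotm k) * rotQ k).
Proof. by rewrite /rotP /rotQ /rotm /=; case: (rotation_state k) => [[]]. Qed.

Lemma rotQS k : rotQ k.+1 = 'X^(rotm k) * rotQ k - tau k *: rotP k.
Proof. by rewrite /rotP /rotQ /rotm /=; case: (rotation_state k) => [[]]. Qed.

Lemma rotm_gap k : rotm k = gap k (rotP k) (rotQ k) (if k is k'.+1 then rotm k' else 1).
Proof.
case: k => [|k]; first by [].
by rewrite /rotP /rotQ /rotm /=; case: (rotation_state k) => [[]].
Qed.

Lemma rotm_mono : {homo rotm : k l / (k <= l)%N}.
Proof. by apply: homo_leq => [//|? ? ?|k];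
  [exact: leq_trans|rewrite [rotm k.+1]rotm_gap leq_maxl]. Qed.

Lemma size_rotP k : (size (rotP k) <= rotm k)%N.
Proof. by rewrite rotm_gap /gap leq_max -!addnA leq_addr orbT. Qed.

Lemma le_rotm k : (k < rotm k)%N.
Proof.
rewrite rotm_gap /gap; case: k => [|k]; first by rewrite leq_max.
rewrite leq_max; apply/orP; right.
suff : (0 < size (rotP k.+1))%N by lia.
have P0 j : (rotP j)`_0 = 1.
  elim: j => [|j IH]; first by rewrite coef1.
  rewrite rotPS coefD coefZ coefXnM IH.
  case: (posnP (rotm j)) => [m0|_]; last by rewrite mulr0 addr0.
  by have := @rotm_mono 0 j isT; rewrite m0 leqn0 [rotm 0]rotm_gap /gap => /eqP; lia.
by rewrite lt0n size_poly_eq0; apply/eqP => h; have := P0 k.+1; rewrite h coef0 => /eqP;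
  rewrite eq_sym oner_eq0.
Qed.

Lemma rotm_moment k : k.+1%:R * (\sum_(i < size (rotP k)) (i%:R * `|(rotP k)`_i|)) <= (rotm k)%:R.
Proof.
rewrite rotm_gap /gap; set x := _ * _.
have x0 : 0 <= x by rewrite mulr_ge0// sumr_ge0// => i _; rewrite mulr_ge0.
rewrite (le_trans (ltW (archi_boundP x0)))// ler_nat leq_max leq_addl orbT//.
Qed.

Lemma rotP_coef k l i : (k <= l)%N -> (i < rotm k)%N -> (rotP l)`_i = (rotP k)`_i.
Proof.
move=> + ik; elim: l => [|l IH]; first by rewrite leqn0 => /eqP ->.
rewrite leq_eqVlt => /predU1P[->//|]; rewrite ltnS => kl.
rewrite rotPS coefD coefZ coefXnM (leq_trans ik (rotm_mono kl)) mulr0 addr0.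
exact: IH.
Qed.

Lemma rotP_coef0 k : (rotP k)`_0 = 1.
Proof. by rewrite (@rotP_coef 0 k)// ?coef1//; exact: le_rotm. Qed.

(** Multiplication by ['X^(rotm k)] moves [rotQ k] beyond the degree of [rotP k]. Supports being
    disjoint, each step multiplies the sum by exactly [1 + tau k ^+ 2]. *)
Lemma rot_N2 k : N2 (rotP k) + N2 (rotQ k) <= 2.
Proof.
have := @rotation_growth (fun k => N2 (rotP k) + N2 (rotQ k)) _ _ k.
have -> : N2 (rotP 0) + N2 (rotQ 0) = 1.
  by rewrite /N2 size_poly1 size_poly0 big_ord1 big_ord0 coef1 expr1n addr0.
rewrite mulr1; apply=> // j; rewrite le_eqVlt; apply/orP; left; apply/eqP.
have Xlow Q i : (i < rotm j)%N -> ('X^(rotm j) * Q)`_i = 0 by rewrite coefXnM => ->.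
rewrite rotPS rotQS (N2D (size_rotP j)) => [|i ij]; last by rewrite coefZ Xlow// mulr0.
rewrite [X in _ + N2 X = _]addrC (N2D (P := - _) (m := rotm j)); last 2 first.
- by rewrite size_polyN (leq_trans (size_scale_leq _ _))// size_rotP.
- exact: Xlow.
by rewrite -scaleNr !N2Z !N2Xn sqrrN; ring.
Qed.

Lemma rot_N2_sub k l : (k <= l)%N -> N2 (rotP l - rotP k) = N2 (rotP l) - N2 (rotP k).
Proof.
move=> kl; apply/eqP; rewrite eq_sym subr_eq eq_sym addrC.
rewrite -(N2D (size_rotP k)) => [|i ik]; first by rewrite addrC subrK.
by rewrite coefB (rotP_coef kl ik) subrr.
Qed.

(** The numbers [N2 (rotP k)] are bounded, and [rot_N2_sub] makes the norm of a difference the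
    difference of the norms; so [k] is taken with [N2 (rotP k)] close to the supremum. *)
Lemma rot_tail (eps : R) : 0 < eps -> exists k, forall l, (k <= l)%N ->
  N2 (rotP l - rotP k) <= eps.
Proof.
move=> e0; pose E := [set N2 (rotP k) | k in [set: nat]].
have hE : has_sup E.
  split; first by exists (N2 (rotP 0)), 0%N.
  exists 2 => _ [k _ <-]; have := rot_N2 k; have := N2_ge0 (rotQ k); lra.
have [_ [k _ <-] hk] := sup_adherent e0 hE.
exists k => l kl; rewrite rot_N2_sub//.
have : N2 (rotP l) <= sup E by apply: ub_le_sup; [case: hE|exists l].
lra.
Qed.

Lemma rot_not_cauchy : ~ forall eps : R, 0 < eps ->
  exists K, forall k, (K <= k)%N -> `|(rotP k).[1] - (rotP K).[1]| <= eps.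
Proof.
apply: (@rotation_not_cauchy _ (fun k => (rotQ k).[1])) => [||k|k].
- by rewrite hornerC.
- by rewrite horner0.
- by rewrite rotPS hornerD hornerZ hornerM hornerXn expr1n mul1r.
- by rewrite rotQS hornerD hornerN hornerZ hornerM hornerXn expr1n mul1r.
Qed.

End Rotation.

(** * Polynomials of a contraction and their coordinatewise limit *)

Section PolynomialCalculus.
Variables (R : realType) (I : choiceType).
Local Notation C := R[i].
Local Notation H := (ell2 R I).
Local Notation B := (bop R I).
Implicit Types (S T : B) (f g y z : H) (P Q : {poly R}).

Lemma l2norm_sqr_le f (M : R) :
  (forall s : seq I, uniq s -> \sum_(i <- s) normc (f i) ^+ 2 <= M) ->
  l2norm f ^+ 2 <= M.
Proof. by move=> /l2_bound[]. Qed.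

Lemma l2norm_sqrD_le f g (M : R) :
  (forall s : seq I, uniq s ->
    \sum_(i <- s) (normc (f i) ^+ 2 + normc (g i) ^+ 2) <= M) ->
  l2norm f ^+ 2 + l2norm g ^+ 2 <= M.
Proof.
move=> h.
have sum_sub (F : I -> R) s s' : (forall i, 0 <= F i) -> uniq s -> {subset s <= s'} ->
    uniq s' -> \sum_(i <- s) F i <= \sum_(i <- s') F i.
  move=> F0 us ss' us'.
  rewrite [X in _ <= X](bigID (mem s)) /= -[X in X <= _]addr0 lerD ?sumr_ge0//.
  have sp : perm_eq s [seq i <- s' | mem s i].
    apply: uniq_perm => [//||i]; rewrite ?filter_uniq// mem_filter /=.
    by case: (boolP (i \in s)) => // /ss' ->.
  by rewrite -[X in _ <= X]big_filter (perm_big _ sp).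
rewrite addrC -lerBrDr; apply: l2norm_sqr_le => s us.
rewrite lerBrDr addrC -lerBrDr; apply: l2norm_sqr_le => s' us'.
rewrite lerBrDr; set t := undup (s ++ s').
have ut : uniq t by exact: undup_uniq.
apply: le_trans (h t ut); rewrite big_split lerD// sum_sub// => [i|i is'|i|i i_s].
- exact: sqr_ge0.
- by rewrite mem_undup mem_cat is' orbT.
- exact: sqr_ge0.
- by rewrite mem_undup mem_cat i_s.
Qed.

Lemma normc_sqr (z : C) : normc z ^+ 2 = complex.Re z ^+ 2 + complex.Im z ^+ 2.
Proof. by case: z => a b /=; rewrite sqr_sqrtr// addr_ge0 ?sqr_ge0. Qed.

Lemma rotation_norm (t : R) y z :
  l2norm (y + t%:C *: z) ^+ 2 + l2norm (z - t%:C *: y) ^+ 2 <=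
  (1 + t ^+ 2) * (l2norm y ^+ 2 + l2norm z ^+ 2).
Proof.
apply: l2norm_sqrD_le => s us.
rewrite (eq_bigr (fun i => (1 + t ^+ 2) * (normc (y i) ^+ 2 + normc (z i) ^+ 2))).
  rewrite -mulr_sumr big_split ler_wpM2l ?addr_ge0 ?sqr_ge0// lerD//.
    by rewrite sum_le_l2norm ?ell2P.
  by rewrite sum_le_l2norm ?ell2P.
move=> i _; rewrite !ell2_addE ell2_oppE !ell2_scaleE !normc_sqr.
by case: (y i) => a b; case: (z i) => c d /=; ring.
Qed.

Lemma disjoint_norm (y : nat -> H) (a : nat -> R) (K : R) n :
  (forall i j k, y j i != 0 -> y k i != 0 -> j = k) ->
  (forall j, l2norm (y j) ^+ 2 <= K) ->
  l2norm (\sum_(j < n) (a j)%:C *: y j) ^+ 2 <= (\sum_(j < n) a j ^+ 2) * K.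
Proof.
move=> dy yK; apply: l2norm_sqr_le => s us.
have pw i : normc ((\sum_(j < n) (a j)%:C *: y j) i) ^+ 2 <=
    \sum_(j < n) a j ^+ 2 * normc (y j i) ^+ 2.
  rewrite ell2_sumE; under eq_bigr do rewrite ell2_scaleE.
  have [[j yj]|ny] := pselect (exists j : 'I_n, y j i != 0).
    rewrite (bigD1 j)//= big1 ?addr0 => [|k kj]; last first.
      have [yk|] := eqVneq (y k i) 0; first by rewrite yk mulr0.
      by move=> /dy - /(_ _ yj) /val_inj kj'; rewrite kj' eqxx in kj.
    rewrite normcM normc_real exprMn real_normK ?num_real//.
    rewrite (bigD1 j)//= lerDl sumr_ge0// => k _.
    by rewrite mulr_ge0 ?sqr_ge0.
  rewrite big1 => [|j _]; first by rewrite normc0 expr0n sumr_ge0// => k _;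
    rewrite mulr_ge0 ?sqr_ge0.
  have [yk|yk] := eqVneq (y j i) 0; first by rewrite yk mulr0.
  by case: ny; exists j.
apply: (le_trans (ler_sum _ (fun i _ => pw i))); rewrite exchange_big mulr_suml /=.
apply: ler_sum => j _; rewrite -mulr_sumr ler_wpM2l ?sqr_ge0//.
exact: le_trans (sum_le_l2norm (ell2P _) us) (yK j).
Qed.

Variable W : B.

Definition ev P : B := \sum_(i < size P) (P`_i)%:C *: W ^+ i.

Lemma ev_widen P n : (size P <= n)%N -> ev P = \sum_(i < n) (P`_i)%:C *: W ^+ i.
Proof.
move=> Pn; rewrite /ev (big_ord_widen n (fun i => (P`_i)%:C *: W ^+ i) Pn) big_mkcond.
by apply: eq_bigr => i _; case: ltnP => // /(nth_default 0) ->; rewrite scale0r.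
Qed.

Lemma evD P Q : ev (P + Q) = ev P + ev Q.
Proof.
pose n := maxn (size P) (size Q).
rewrite !(@ev_widen _ n) ?leq_maxl ?leq_maxr ?size_polyD// -big_split.
by apply: eq_bigr => i _; rewrite coefD rmorphD scalerDl.
Qed.

Lemma evZ a P : ev (a *: P) = a%:C *: ev P.
Proof.
rewrite (@ev_widen _ (size P)) ?size_scale_leq// /ev scaler_sumr.
by apply: eq_bigr => i _; rewrite coefZ rmorphM scalerA.
Qed.

Lemma evB P Q : ev (P - Q) = ev P - ev Q.
Proof. by rewrite -scaleN1r evD evZ rmorphN1 scaleN1r. Qed.

Lemma evXn m P : ev ('X^m * P) = W ^+ m * ev P.
Proof.
rewrite (@ev_widen _ (m + size P)); last first.
  by rewrite (leq_trans (size_polyMleq _ _))// size_polyXn.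
rewrite big_split_ord /= big1 ?add0r => [|i _]; last first.
  by rewrite coefXnM /= ltn_ord scale0r.
rewrite mulr_sumr; apply: eq_bigr => i _.
by rewrite coefXnM ltnNge leq_addr /= addKn bop_scalerAr exprD.
Qed.

Lemma ev1 : ev 1 = 1.
Proof. by rewrite /ev size_poly1 big_ord1 coef1 scale1r expr0. Qed.

Lemma ev0 : ev 0 = 0. Proof. by rewrite /ev size_poly0 big_ord0. Qed.

Hypothesis W_contraction : opnorm W <= 1.

Lemma contraction_exp n f : l2norm ((W ^+ n) f) <= l2norm f.
Proof.
elim: n => [|n IH] //; rewrite exprS bopM (le_trans (le_opnorm _ _))//.
by rewrite (le_trans (ler_piMl (l2norm_ge0 _) W_contraction)).
Qed.

(** A rotation step applied to the vectors [P_k(W) f] and [Q_k(W) f] multiplies the sum of their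
    squared norms by at most [1 + tau k ^+ 2], because [W] is a contraction. This gives a bound
    uniform in [k]. *)
Lemma rot_bound k f :
  l2norm (ev (rotP R k) f) ^+ 2 + l2norm (ev (rotQ R k) f) ^+ 2 <= 2 * l2norm f ^+ 2.
Proof.
have := @rotation_growth R (fun k =>
  l2norm (ev (rotP R k) f) ^+ 2 + l2norm (ev (rotQ R k) f) ^+ 2) _ _ k.
rewrite [rotP R 0]/(1%R) [rotQ R 0]/(0%R) ev1 ev0 l2norm_0 expr0n addr0; apply;
  last exact: sqr_ge0.
move=> j; rewrite rotPS rotQS evD evB !evZ evXn.
apply: (le_trans (rotation_norm (tau R j) (ev (rotP R j) f) _)).
rewrite ler_wpM2l ?addr_ge0 ?sqr_ge0// lerD2l.
by rewrite lerXn2r ?nnegrE ?l2norm_ge0// contraction_exp.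
Qed.

Variable level : I -> nat.
Hypothesis W_level : forall n f i, (level i < n)%N -> (W ^+ n) f i = 0.

Lemma rot_stable k l f i : (level i < rotm R k)%N -> (k <= l)%N ->
  ev (rotP R l) f i = ev (rotP R k) f i.
Proof.
move=> ik; elim: l => [|l IH]; first by rewrite leqn0 => /eqP ->.
rewrite leq_eqVlt => /predU1P[->//|]; rewrite ltnS => kl.
rewrite rotPS evD evZ evXn bop_addE ell2_addE IH// bop_scaleE ell2_scaleE bopM.
by rewrite W_level ?mulr0 ?addr0// (leq_trans ik)// rotm_mono.
Qed.

(** The limit is taken coordinate by coordinate, each coordinate being eventually constant. Finitely
    many coordinates are read off from a single [P_k], so [rot_bound] makes the limit a bounded
    operator. *)
Lemma rot_limit : exists T : B, forall k f i, (level i < rotm R k)%N ->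
  T f i = ev (rotP R k) f i.
Proof.
pose t f i : C^o := ev (rotP R (level i)) f i.
have tE k f i : (level i < rotm R k)%N -> t f i = ev (rotP R k) f i.
  move=> ik; rewrite /t -(@rot_stable (level i) (maxn k (level i)))//; last 2 first.
  - exact: le_rotm.
  - exact: leq_maxr.
  by rewrite (@rot_stable k)// leq_maxl.
have t_bound f (s : seq I) : uniq s ->
    \sum_(i <- s) normc (t f i) ^+ 2 <= 2 * l2norm f ^+ 2.
  move=> us; pose k := \max_(i <- s) level i.
  rewrite (eq_big_seq (fun i => normc (ev (rotP R k) f i) ^+ 2)) => [|i si].
    rewrite (le_trans (sum_le_l2norm (ell2P _) us))//.
    by rewrite (le_trans _ (rot_bound k f))// lerDl sqr_ge0.
  rewrite (@tE k)// (leq_ltn_trans _ (le_rotm R k))//.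
  by rewrite /k (big_rem i)//= leq_maxl.
have ts f : t f \in l2_summable by have [] := l2_bound (t_bound f).
pose T0 f : H := Ell2 (ts f).
have T0b : T0 \in @bounded_linear R I.
  apply/asboolP; split=> [a f g|].
    apply: ell2_ext => i; rewrite ell2_addE ell2_scaleE /= /t.
    by rewrite (bop_linear (ev _) a f g) ell2_addE ell2_scaleE.
  exists 2 => f; apply: l2norm_le => [|s us]; first by rewrite mulr_ge0 ?l2norm_ge0.
  rewrite (le_trans (t_bound f s us))// exprMn ler_wpM2r ?sqr_ge0//.
  by rewrite -subr_ge0; lra.
by exists (Bop T0b) => k f i ik; exact: tE.
Qed.

End PolynomialCalculus.
(** * Cross edges entering a strong component *)

Section CycleAtRange.
Variables (R : realType) (G : digraph).
Local Notation C := R[i].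
Local Notation H := (ell2 R (dpath G)).
Local Notation B := (bop R (dpath G)).
Local Notation A := (graph_algebra R G).
Implicit Types (v x y z : vert G) (f : edge G) (p q : seq (edge G)) (w u : dpath G).
Implicit Types (S T Z : B) (g : H) (P : {poly R}).

Variables (e : edge G) (c : seq (edge G)).
Hypotheses (ce : cross e) (cc : cycle_at (rng e) c).

Let vm : valid_path (rng e) (c ++ [:: e]).
Proof. by case: cc => _ vc sc; rewrite valid_cat vc sc /= eqxx. Qed.

Let sm : psrc (rng e) (c ++ [:: e]) = src e.
Proof. by rewrite psrc_cat. Qed.

Let sc0 : (0 < size c)%N.
Proof. by case: cc; rewrite lt0n size_eq0. Qed.

Let W : B := Ins R e c [::].
Local Notation Le := (Lop R (rng e) [:: e]).

Definition cyc n := flatten (nseq n c).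

Lemma size_cyc n : size (cyc n) = (n * size c)%N.
Proof. by rewrite /cyc size_flatten /shape map_nseq sumn_nseq mulnC. Qed.

Lemma cycD m n : cyc (m + n) = cyc m ++ cyc n.
Proof. by rewrite /cyc nseqD flatten_cat. Qed.

Lemma cyc1 : cyc 1 = c. Proof. exact: cats0. Qed.

Lemma cyc_valid n : valid_path (rng e) (cyc n) /\ psrc (rng e) (cyc n) = rng e.
Proof.
case: cc => _ vc sc; elim: n => [//|n [IH1 IH2]].
by rewrite -add1n cycD cyc1 valid_cat psrc_cat vc sc IH1 IH2.
Qed.

Lemma notin_cyc n : e \notin cyc n.
Proof.
elim: n => [//|n IH]; rewrite -add1n cycD cyc1 mem_cat negb_or IH andbT.
exact: cross_notin_cycle cc.
Qed.

Lemma cyc_inj : injective cyc.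
Proof.
move=> m n /(congr1 size); rewrite !size_cyc => /eqP.
by rewrite eqn_pmul2r// => /eqP.
Qed.

Lemma cyce_valid n : valid_path (rng e) (cyc n ++ [:: e]).
Proof. by have [vn sn] := cyc_valid n; rewrite valid_cat vn sn /= eqxx. Qed.

Lemma psrc_cyce n : psrc (rng e) (cyc n ++ [:: e]) = src e.
Proof. by rewrite psrc_cat. Qed.

Definition cpath n : dpath G := mkp (rng e) (cyc n ++ [:: e]).

Lemma cpathE n : val (cpath n) = (rng e, cyc n ++ [:: e]).
Proof. by rewrite mkpE// cyce_valid. Qed.

Lemma cyce_split m n p q : cyc m ++ e :: p = cyc n ++ e :: q -> m = n.
Proof. by move=> /(split_uniq (notin_cyc m) (notin_cyc n))[/cyc_inj]. Qed.

Lemma cpath_inj : injective cpath.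
Proof.
move=> m n /(congr1 val); rewrite !cpathE => -[].
exact: cyce_split.
Qed.

Lemma W_Lop v p : valid_path v p -> e \notin p -> Lop R v p * W = W * Lop R v p.
Proof.
elim: p v => [|f p IH] v /= => [_ _|/andP[/eqP <- vp]]; first exact: Ins_vert.
rewrite inE negb_or => /andP[/eqP ef ep].
have -> : Lop R (rng f) (f :: p) = Lop R (rng f) [:: f] * Lop R (src f) p.
  by rewrite (@LopM _ _ _ [:: f])//= eqxx.
by rewrite -mulrA IH// !mulrA Ins_edge// => fe; apply: ef.
Qed.

Lemma W_exp_Le n : W ^+ n * Le = Lop R (rng e) (cyc n ++ [:: e]).
Proof.
elim: n => [|n IH]; first by rewrite expr0 mul1r.
have [vn sn] := cyc_valid n.
have E : Lop R (rng e) (cyc n ++ [:: e]) = Lop R (rng e) (cyc n) * Le.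
  by rewrite -(LopM R [:: e] vn) sn.
rewrite exprS -mulrA IH E mulrA -W_Lop ?notin_cyc// -mulrA Ins_self//.
have := LopM R (c ++ [:: e]) vn; rewrite sn => ->.
by rewrite catA -[X in cyc n ++ X]cyc1 -cycD addn1.
Qed.

(** Each application of [W] inserts a copy of [c] in front of [e], so [level w] bounds the [n] for
    which the range of [W ^+ n] can reach [w]. *)
Definition level w : nat := (index e (val w).2 %/ size c)%N.

Lemma W_level n g w : (level w < n)%N -> (W ^+ n) g w = 0.
Proof.
elim: n w => [//|n IH] w lw; rewrite exprS bopM.
have [[u uw]|nu] := pselect (exists u, ins e c [::] u w); last first.
  by rewrite rel_op0// => u uw; apply: nu; exists u.
rewrite (rel_opE _ (pbij_ins c _ ce) uw) IH//.
have := dpath_valid u; case: uw => p [q [uE wE]];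
  rewrite uE => /(cross_notin ce)/andP[ep _].
move: lw; rewrite /level uE wE /= -!catA !index_cat (negPf ep) (negPf (cross_notin_cycle ce cc)).
by rewrite mem_seq1 /= eqxx !addn0 divnDr ?dvdnn// divnn sc0 addn1 ltnS.
Qed.

Lemma level_cpath n : level (cpath n) = n.
Proof. by rewrite /level cpathE /= index_cat (negPf (notin_cyc n)) /= eqxx addn0 size_cyc mulnK. Qed.

Lemma Lop_ev v p P : Lop R v p * W = W * Lop R v p -> Lop R v p * ev W P = ev W P * Lop R v p.
Proof.
move=> LW; rewrite /ev mulr_sumr mulr_suml; apply: eq_bigr => i _.
by rewrite bop_scalerAr bop_scalerAl (commrX _ LW).
Qed.

Lemma Le_ev P : Le * ev W P = (P`_0)%:C *: Le.
Proof.
rewrite (@ev_widen _ _ _ _ (size P).+1)// big_ord_recl mulrDr expr0 bop_scalerAr mulr1.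
rewrite mulr_sumr big1 ?addr0// => i _.
by rewrite bop_scalerAr exprS mulrA Ins_self0// mul0r scaler0.
Qed.

(** The vectors [W^n L_e g] live on paths beginning with [c^n e], hence on disjoint sets for
    different [n]. So after [Le] only the square sum of the coefficients of [P] counts. *)
Lemma ev_Le_norm P g : l2norm (ev W P (Le g)) ^+ 2 <= N2 P * l2norm g ^+ 2.
Proof.
rewrite /ev bop_sumE.
apply: (@disjoint_norm R (dpath G) (fun n => (W ^+ n) (Le g)) (fun n => P`_n)) => [w j k|j].
  have supp n : (W ^+ n) (Le g) w != 0 -> exists q, (val w).2 = cyc n ++ e :: q.
    rewrite -bopM W_exp_Le => h; apply: contrapT => nq; move/eqP: h; case.
    by rewrite rel_op0// => u [_ wE]; apply: nq; exists (val u).2; rewrite wE -catA.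
  by move=> /supp[q qE] /supp[q' q'E]; apply: (@cyce_split _ _ q q'); rewrite -qE -q'E.
rewrite lerXn2r ?nnegrE ?l2norm_ge0// -bopM W_exp_Le.
by rewrite (le_trans (le_opnorm _ _))// ler_piMl ?l2norm_ge0// Lop_norm.
Qed.

Section Limit.
Variable T : B.
Hypothesis TE : forall k g w, (level w < rotm R k)%N -> T g w = ev W (rotP R k) g w.

Lemma T_stable k g w : (level w <= k)%N -> T g w = ev W (rotP R k) g w.
Proof. by move=> wk; apply: TE; exact: leq_ltn_trans wk (le_rotm R k). Qed.

Lemma Lop_T v p : Lop R v p * W = W * Lop R v p -> Lop R v p * T = T * Lop R v p.
Proof.
move=> LW; apply: bop_ext => g; apply: ell2_ext => u; rewrite !bopM.
have E k : (level u <= k)%N -> T (Lop R v p g) u = Lop R v p (ev W (rotP R k) g) u.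
  move=> uk; rewrite (T_stable _ uk).
  by transitivity ((ev W (rotP R k) * Lop R v p) g u) => //; rewrite -Lop_ev.
have [[w wu]|nw] := pselect (exists w, pre v p w u); last first.
  by rewrite (E _ (leqnn _)) !rel_op0// => w wu; apply: nw; exists w.
rewrite (E (maxn (level w) (level u))) ?leq_maxr// !(rel_opE _ (pbij_pre v p) wu).
by apply: T_stable; exact: leq_maxl.
Qed.

Lemma Le_T : Le * T = Le.
Proof.
apply: bop_ext => g; apply: ell2_ext => u; rewrite bopM.
have [[w wu]|nw] := pselect (exists w, pre (rng e) [:: e] w u); last first.
  by rewrite !rel_op0// => w wu; apply: nw; exists w.
rewrite (rel_opE _ (pbij_pre _ _) wu) (T_stable _ (leqnn _)).
transitivity ((Le * ev W (rotP R (level w))) g u).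
  by rewrite bopM (rel_opE _ (pbij_pre _ _) wu).
by rewrite Le_ev rotP_coef0 scale1r.
Qed.

(** By [ev_Le_norm] and [rot_tail], the operators [P_k(W) L_e] converge to [T * Le] in norm; each is
    a combination of the path operators of [c^n e]. *)
Lemma T_Le : A (T * Le).
Proof.
apply: algebra_closed => eps e0.
have [k kE] := @rot_tail R (eps ^+ 2) ltac:(by rewrite exprn_gt0).
exists (ev W (rotP R k) * Le).
  rewrite /ev mulr_suml; apply: (sublin_sum (@algebra_sublin R G)) => i _ _.
  rewrite bop_scalerAl W_exp_Le; apply: (sublinZ _ (@algebra_sublin R G)).
  by apply: algebra_Lop; exact: cyce_valid.
apply: opnorm_le => [|g]; first exact: ltW.
apply: l2norm_le => [|s us]; first by rewrite mulr_ge0 ?l2norm_ge0// ltW.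
(* Large enough for [P_l(W)] to agree with [T] on all coordinates in [s]. *)
pose l := maxn k (\max_(w <- s) level w).
rewrite (eq_big_seq (fun w => normc (ev W (rotP R l - rotP R k) (Le g) w) ^+ 2)) => [|w ws].
  rewrite (le_trans (sum_le_l2norm (ell2P _) us))// (le_trans (ev_Le_norm _ _))//.
  by rewrite exprMn ler_wpM2r ?sqr_ge0// kE// leq_maxl.
congr (normc _ ^+ 2); rewrite evB !bop_addE !bop_oppE !ell2_addE !ell2_oppE !bopM.
by rewrite (@T_stable l)// leq_max /l (big_rem w)//= leq_maxl orbT.
Qed.

Lemma T_commutator f : A (Lop R (rng f) [:: f] * T - T * Lop R (rng f) [:: f]).
Proof.
have sA := @algebra_sublin R G.
have [->|/eqP fe] := eqVneq f e.
  by rewrite Le_T; apply: (sublinB sA); [apply: algebra_Lop; rewrite /= eqxx|exact: T_Le].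
by rewrite Lop_T ?subrr; [case: sA|exact: Ins_edge].
Qed.

(** If [S] is a power series in [W], this is the Fejer mean of order [N] of that series at 1. In
    general it is the quadratic form of [S] at the sum of the basis vectors of the first [N] paths
    [c^i e], divided by [N]. *)
Definition fejer S N : C :=
  (\sum_(i < N) \sum_(j < N) cf S (cpath i) (cpath j)) / N%:R.

Lemma fejer_linear (a : C) S S' N : fejer (a *: S + S') N = a * fejer S N + fejer S' N.
Proof.
rewrite /fejer mulrA -mulrDl; congr (_ / _); rewrite mulr_sumr -big_split.
by apply: eq_bigr => i _; rewrite mulr_sumr -big_split.
Qed.

Lemma fejer_le S N : normc (fejer S N) <= opnorm S.
Proof.
have [->|N0] := posnP N; first by rewrite /fejer invr0 mulr0 normc0 opnorm_ge0.
pose g : H := \sum_(i < N) (1 : R)%:C *: xi R (cpath i).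
have gN : l2norm g ^+ 2 <= N%:R.
  have := @disjoint_norm R (dpath G) (fun n => xi R (cpath n)) (fun=> 1) 1 N.
  rewrite mulr1 (eq_bigr (fun=> 1)) => [|i _]; last by rewrite expr1n.
  rewrite sumr_const card_ord; apply=> [w j k|j].
    rewrite /=; case: (w =P cpath j) => [->|_]; last by rewrite eqxx.
    by case: (cpath j =P cpath k) => [/cpath_inj//|_]; rewrite eqxx.
  by rewrite expr_le1 ?l2norm_ge0 ?l2norm_xi.
have -> : fejer S N = (\sum_(j < N) S g (cpath j)) / N%:R.
  rewrite /fejer exchange_big; congr (_ / _); apply: eq_bigr => j _.
  rewrite /g bop_sum ell2_sumE; apply: eq_bigr => i _.
  by rewrite scale1r.
have NC : normc (N%:R : C)^-1 = N%:R^-1.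
  by rewrite normcV -(rmorph_nat (real_complex R)) normc_real normr_nat.
rewrite normcM NC ler_pdivrMr ?ltr0n//.
apply: (le_trans (normc_sum _ _ _)).
have Sg : \sum_(j < N) normc (S g (cpath j)) ^+ 2 <= opnorm S ^+ 2 * N%:R.
  rewrite -(big_mkord xpredT (fun j => normc (S g (cpath j)) ^+ 2)).
  rewrite -(big_map cpath xpredT (fun w => normc (S g w) ^+ 2)).
  apply: (le_trans (sum_le_l2norm (ell2P _) _)).
    by rewrite map_inj_uniq ?iota_uniq//; exact: cpath_inj.
  apply: (@le_trans _ _ ((opnorm S * l2norm g) ^+ 2)).
    by rewrite lerXn2r ?nnegrE ?l2norm_ge0 ?mulr_ge0 ?opnorm_ge0 ?l2norm_ge0 ?le_opnorm.
  by rewrite exprMn ler_wpM2l ?sqr_ge0.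
have [S0|S0] := leP (opnorm S) 0.
  rewrite (opnorm_le0 S0) big1 => [|j _]; last by rewrite normc0.
  by rewrite opnorm0 mul0r.
(* Replaces Cauchy-Schwarz: summed over the [N] coordinates, both terms on the right contribute at
   most [N * opnorm S / 2]. *)
have amgm (a : R) : a <= a ^+ 2 / (2 * opnorm S) + opnorm S / 2.
  rewrite -subr_ge0 (_ : _ - _ = (a - opnorm S) ^+ 2 / (2 * opnorm S)).
    by rewrite divr_ge0 ?sqr_ge0 ?mulr_ge0 ?opnorm_ge0.
  by field; rewrite gt_eqF.
apply: (le_trans (ler_sum _ (fun j _ => amgm _))).
rewrite big_split /= -mulr_suml sumr_const card_ord -mulr_natr.
have := ler_wpM2r (x := (2 * opnorm S)^-1) _ Sg.
rewrite invr_ge0 mulr_ge0 ?opnorm_ge0// => /(_ isT).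
rewrite (_ : opnorm S ^+ 2 * N%:R / (2 * opnorm S) = opnorm S / 2 * N%:R); last first.
  by field; rewrite gt_eqF.
by lra.
Qed.

Definition fejer_cauchy S := forall eps : R, 0 < eps -> exists K, forall M N,
  (K <= M)%N -> (K <= N)%N -> normc (fejer S M - fejer S N) <= eps.

Lemma count_shift n M N :
  \sum_(i < M) ((n + i < N)%N : nat) = minn M (N - n) :> nat.
Proof.
elim: M => [|M IH]; first by rewrite big_ord0 min0n.
by rewrite big_ord_recr /= IH; case: ltnP; lia.
Qed.

Lemma sum_shift (n N : nat) :
  \sum_(i < N) \sum_(j < N) ((j == n + i :> nat)%N%:R : C) = (N - n)%:R.
Proof.
rewrite -[in RHS](minn_idPr (leq_subr n N)) -count_shift natr_sum.
apply: eq_bigr => i _; have [lt|ge] := ltnP (n + i) N.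
  rewrite (bigD1 (Ordinal lt))//= eqxx big1 ?addr0// => j.
  by rewrite -val_eqE /= => /negPf ->.
by rewrite big1// => j _; case: eqP => // jE; have := ltn_ord j; rewrite jE ltnNge ge.
Qed.

(** The path operator of [c^n] at [rng e] has mean [(N - n) / N], which tends to 1; all other path
    operators have mean 0. By [fejer_le] the property passes to norm limits. *)
Lemma algebra_fejer S : A S -> fejer_cauchy S.
Proof.
apply: (span_ind (P := [set S | fejer_cauchy S])).
- split=> [eps e0|a S1 S2 h1 h2 eps e0].
    exists 0%N => M N _ _; rewrite /fejer !big1 ?mul0r ?subrr ?normc0 ?ltW// => i _;
    by rewrite big1// => j _; rewrite cf0.
  have M0 : 0 < normc a + 1 by rewrite ltr_wpDl ?normc_ge0.
  have [K1 h1'] := h1 (eps / 2 / (normc a + 1)) ltac:(by rewrite !divr_gt0).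
  have [K2 h2'] := h2 (eps / 2) ltac:(by rewrite divr_gt0).
  exists (maxn K1 K2) => M N; rewrite !geq_max => /andP[KM1 KM2] /andP[KN1 KN2].
  rewrite !fejer_linear.
  rewrite (_ : _ - _ = a * (fejer S1 M - fejer S1 N) + (fejer S2 M - fejer S2 N));
    last by ring.
  rewrite (le_trans (le_normcD _ _))// normcM (splitr eps) lerD ?h2'//.
  rewrite (le_trans (ler_wpM2l (normc_ge0 _) (h1' M N KM1 KN1)))// mulrCA.
  rewrite ler_piMr ?divr_ge0 ?(ltW e0)//.
  by rewrite ler_pdivrMr// mul1r lerDl.
- move=> S1 h eps e0.
  have [S' h' SS'] := h (eps / 3) ltac:(by rewrite divr_gt0).
  have [K hK] := h' (eps / 3) ltac:(by rewrite divr_gt0).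
  exists K => M N KM KN.
  have fS L : fejer S1 L = fejer (S1 - S') L + fejer S' L.
    by rewrite -[X in X + _]mul1r -fejer_linear scale1r subrK.
  rewrite !fS (_ : _ - _ = fejer (S1 - S') M - fejer (S1 - S') N + (fejer S' M - fejer S' N)); last by ring.
  have h1 := le_trans (fejer_le (S1 - S') M) SS'.
  have h2 := le_trans (fejer_le (S1 - S') N) SS'.
  have h3 := hK M N KM KN.
  rewrite (le_trans (le_normcD _ _))//.
  have := le_normcD (fejer (S1 - S') M) (- fejer (S1 - S') N); rewrite normcN.
  by lra.
- move=> v p vp eps e0.
  have [[n [vE pE]]|nn] := pselect (exists n, v = rng e /\ p = cyc n); last first.
    exists 0%N => M N _ _.
    suff f0 L : fejer (Lop R v p) L = 0 by rewrite !f0 subrr normc0 ltW.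
    rewrite /fejer big1 ?mul0r// => i _; rewrite big1// => j _.
    rewrite cf_Lop asboolF// => -[_]; rewrite !cpathE => -[ve ij]; apply: nn.
    exists (j - i)%N; split=> //; apply: (@cat_injr _ _ _ (cyc i ++ [:: e])).
    rewrite -ij catA -cycD subnK// -(leq_pmul2r sc0) -!size_cyc.
    by have := congr1 size ij; rewrite !size_cat /=; lia.
  pose K := (n + Num.bound (2 * n%:R / eps)).+1.
  have fE N : (K <= N)%N -> normc (fejer (Lop R v p) N - 1) <= eps / 2.
    move=> KN; rewrite /fejer.
    have -> : \sum_(i < N) \sum_(j < N) cf (Lop R v p) (cpath i) (cpath j) = (N - n)%:R.
      rewrite -sum_shift; apply: eq_bigr => i _; apply: eq_bigr => j _.
      rewrite cf_Lop; congr (nat_of_bool _)%:R; rewrite vE pE.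
      apply/asboolP/eqP; rewrite /pre !cpathE /= (cyc_valid n).2.
        by move=> [_ []]; rewrite catA -cycD; exact: cyce_split.
      by move=> ->; rewrite catA -cycD.
    have N0 : (0 : R) < N%:R by rewrite ltr0n; exact: leq_trans KN.
    have -> : (N - n)%:R / N%:R - 1 = (- (n%:R / N%:R))%:C :> C.
      rewrite natrB; last by rewrite /K in KN; lia.
      rewrite mulrBl divff ?pnatr_eq0 -?lt0n ?(leq_trans _ KN)//.
      by rewrite addrAC subrr sub0r rmorphN rmorphM fmorphV !rmorph_nat.
    rewrite normc_real normrN ger0_norm ?divr_ge0//.
    rewrite ler_pdivrMr// mulrAC ler_pdivlMr// -ler_pdivrMl// mulrC [n%:R * 2]mulrC.
    have b0 : 0 <= 2 * n%:R / eps by rewrite divr_ge0 ?mulr_ge0 ?(ltW e0).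
    rewrite (le_trans (ltW (archi_boundP b0)))// ler_nat.
    by rewrite /K in KN; lia.
  exists K => M N KM KN.
  rewrite (_ : _ - _ = (fejer (Lop R v p) M - 1) - (fejer (Lop R v p) N - 1)); last by ring.
  by rewrite (le_trans (le_normcD _ _))// normcN (splitr eps) lerD// fE.
Qed.

(** On the paths involved [T] agrees with [P_k(W)], so coefficient [n] is weighted by [(N - n) / N]
    for [N = rotm R k]. The distance from [P_k(1)] is thus at most the first absolute moment over
    [N], controlled by [rotm_moment]. *)
Lemma fejer_T k : normc (fejer T (rotm R k) - (rotP R k).[1]%:C) <= k.+1%:R^-1.
Proof.
set N := rotm R k; set P := rotP R k.
have N0 : (0 < N)%N by exact: leq_ltn_trans (le_rotm R k).
have cfW n i j : cf (W ^+ n) (cpath i) (cpath j) = (j == n + i)%N%:R.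
  have -> : cf (W ^+ n) (cpath i) (cpath j) = cf 1 (cpath (n + i)) (cpath j).
    rewrite /cf; congr (ell2_fun _ _).
    suff -> : (W ^+ n) (xi R (cpath i)) = xi R (cpath (n + i)) by [].
    elim: n i => [//|n IH] i.
    rewrite exprSr bopM addSnnS -(IH i.+1); congr ((W ^+ n) _).
    apply: rel_op_xi; first exact: pbij_ins.
    exists (cyc i), [::]; rewrite !cpathE; split=> //.
    by rewrite -addn1 cycD cyc1 cats0 -catA.
  by rewrite /cf /=; congr (nat_of_bool _)%:R; apply/eqP/eqP => [/cpath_inj|->].
have -> : fejer T N = (\sum_(n < size P) P`_n * (N - n)%:R)%:C / N%:R.
  rewrite /fejer rmorph_sum; congr (_ / _).
  transitivity (\sum_(i < N) \sum_(j < N) \sum_(n < size P) (P`_n)%:C * ((j == n + i :> nat)%N%:R : C)).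
    apply: eq_bigr => i _; apply: eq_bigr => j _.
    rewrite /cf (@TE k) ?level_cpath// /ev bop_sumE ell2_sumE; apply: eq_bigr => n _.
    by rewrite -cfW.
  under eq_bigr do rewrite exchange_big; rewrite exchange_big; apply: eq_bigr => n _.
  by rewrite rmorphM rmorph_nat -sum_shift mulr_sumr; apply: eq_bigr => i _;
    rewrite mulr_sumr.
have NR : (0 : R) < N%:R by rewrite ltr0n.
have -> : (\sum_(n < size P) P`_n * (N - n)%:R)%:C / N%:R - P.[1]%:C =
    (- ((\sum_(n < size P) n%:R * P`_n) / N%:R))%:C :> C.
  rewrite -(rmorph_nat (real_complex R)) -fmorphV -rmorphM -rmorphB; congr (_%:C).
  apply: (mulIf (lt0r_neq0 NR)); rewrite mulrBl mulNr !mulfVK ?gt_eqF//.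
  rewrite horner_coef mulr_suml -sumrB -sumrN; apply: eq_bigr => n _.
  rewrite expr1n mulr1 natrB ?(leq_trans (ltnW (ltn_ord n)) (size_rotP R k))//.
  by ring.
rewrite normc_real normrN normrM normfV (ger0_norm (ltW NR)) ler_pdivrMr//.
rewrite ler_pdivlMl ?ltr0n//.
apply: le_trans (rotm_moment R k); rewrite ler_wpM2l// (le_trans (ler_norm_sum _ _ _))//.
by apply: ler_sum => n _; rewrite normrM normr_nat.
Qed.

End Limit.

Lemma inner_no_cycle_at_range : all_inner R G -> False.
Proof.
move=> inner.
have Wn : opnorm W <= 1 by exact: rel_op_norm.
have [T TE] := rot_limit Wn W_level.
have [||T' AT' Zc] := inner_correction (T := T) inner.
- exact: T_commutator.
- move=> v; rewrite Lop_T ?subrr; [by case: (@algebra_sublin R G)|by []|exact: Ins_vert].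
set Z := T - T' in Zc; pose zeta := cf Z (vtx (src e)) (vtx (src e)).
(* Since [Z] commutes with the path operator of [c^i e], it sends the basis vector of [c^i e] to a
   vector supported on paths beginning with [c^i e]. Hence the means of [T] and [T'] differ by the
   constant [zeta], but only those of [T'] are Cauchy. *)
have ZE i j : cf Z (cpath i) (cpath j) = (j == i)%:R * zeta.
  have := pre_vtx (cyce_valid i); rewrite psrc_cyce => pi.
  have [->|/eqP ij] := eqVneq j i.
    by rewrite mul1r; exact: (commutant_cf Zc (cyce_valid i) pi pi).
  rewrite mul0r; apply: (commutant_cf0 Zc (cyce_valid i) pi) => u [_].
  by rewrite cpathE -catA => -[/cyce_split].
have fZ N : (0 < N)%N -> fejer T N = zeta + fejer T' N.
  move=> N0; rewrite -[T](subrK T') -/Z -[Z]scale1r fejer_linear mul1r; congr (_ + _).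
  rewrite /fejer; apply: (@mulIf _ N%:R); first by rewrite pnatr_eq0 -lt0n.
  rewrite mulfVK ?pnatr_eq0 -?lt0n// (eq_bigr (fun=> zeta)) => [|i _].
    by rewrite sumr_const card_ord mulr_natr.
  rewrite (bigD1 i)//= big1 ?addr0 => [|j ji]; first by rewrite ZE eqxx mul1r.
  by rewrite ZE -val_eqE in ji *; rewrite (negPf ji) mul0r.
apply: (@rot_not_cauchy R) => eps e0.
have [K hK] := algebra_fejer AT' (eps := eps / 3) ltac:(by rewrite divr_gt0).
pose L := maxn K (Num.bound (3 / eps)).
have LE k : (L <= k)%N -> (K <= rotm R k)%N /\ k.+1%:R^-1 <= eps / 3.
  rewrite geq_max => /andP[Kk bk]; split.
    by rewrite (leq_trans Kk)// ltnW// le_rotm.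
  have b0 : 0 <= 3 / eps by rewrite divr_ge0 ?(ltW e0).
  rewrite -[eps / 3]invrK lef_pV2 ?posrE ?ltr0n ?invr_gt0 ?divr_gt0// invfM invrK mulrC.
  by rewrite (le_trans (ltW (archi_boundP b0)))// ler_nat ltnW.
exists L => k Lk; have [h1 h2] := LE k Lk; have [h3 h4] := LE L (leqnn _).
have := le_trans (fejer_T TE k) h2; have := le_trans (fejer_T TE L) h4.
have := hK _ _ h1 h3.
rewrite !fZ; [|exact: leq_ltn_trans (le_rotm R _)|exact: leq_ltn_trans (le_rotm R _)].
set a := fejer T' _; set b := fejer T' _; set x := (rotP R k).[1]; set y := (rotP R L).[1].
move=> n1 n2 n3; rewrite -normc_real.
have -> : (x - y)%:C = (a - b) - (zeta + a - x%:C) + (zeta + b - y%:C).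
  by rewrite rmorphB; ring.
have := le_normcD ((a - b) - (zeta + a - x%:C)) (zeta + b - y%:C).
have := le_normcD (a - b) (- (zeta + a - x%:C)); rewrite normcN.
by lra.
Qed.

End CycleAtRange.
(** * Construction of the fruit tree *)

Lemma set2_eq (T : Type) (a b c d : T) :
  [set a; b] = [set c; d] -> (a = c /\ b = d) \/ (a = d /\ b = c).
Proof.
move=> E.
have : [set c; d] a by rewrite -E; left.
have : [set c; d] b by rewrite -E; right.
have : [set a; b] c by rewrite E; left.
have : [set a; b] d by rewrite E; right.
by move=> /= [] ? [] ? [] ? [] ?; subst; by [left|right].
Qed.

Lemma rst_map (T U : Type) (r : relation T) (r' : relation U) (g : T -> U) :
  (forall x y, r x y -> clos_refl_sym_trans U r' (g x) (g y)) ->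
  forall x y, clos_refl_sym_trans T r x y -> clos_refl_sym_trans U r' (g x) (g y).
Proof.
move=> h x y; elim=> {x y} [x y /h//|x|x y _ IH|x y z _ IH1 _ IH2].
- exact: rst_refl.
- exact: rst_sym.
- exact: rst_trans IH1 IH2.
Qed.

Lemma rst_invariant (T : Type) (r : relation T) (P : T -> Prop) :
  (forall x y, r x y -> P x <-> P y) ->
  forall x y, clos_refl_sym_trans T r x y -> P x <-> P y.
Proof.
by move=> h x y; elim=> {x y} [x y /h//|x|x y _ IH|x y z _ IH1 _ IH2] //;
  [rewrite IH|rewrite IH1].
Qed.

Lemma inj_surj_can (T U : Type) (g : T -> U) : injective g ->
  (forall y, exists x, g x = y) -> exists f, cancel f g /\ cancel g f.
Proof.
move=> gi gs; exists (fun y => sval (cid (gs y))); split=> [y|x].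
  by case: (cid _).
by apply: gi; case: (cid _).
Qed.

Lemma polygon_not_bridge (Q : digraph) n (v : 'I_n -> vert Q) (e : 'I_n -> edge Q) :
  is_polygon v e ->
  exists a, clos_refl_sym_trans (vert Q) (uedge (fun f => f <> a)) (src a) (rng a).
Proof.
case: n v e => [|n] v e [//= _ vi ei ve].
have n0 : (0 < n.+1)%N by [].
have chain i (hi : (i < n.+1)%N) : clos_refl_sym_trans (vert Q)
    (uedge (fun f => f <> e ord_max)) (v (Ordinal n0)) (v (Ordinal hi)).
  elim: i hi => [|i IH] hi.
    by rewrite (_ : Ordinal hi = Ordinal n0); [exact: rst_refl|exact: val_inj].
  have hi' := ltnW hi; apply: (rst_trans _ _ _ _ _ (IH hi')).
  have ne : e (Ordinal hi') <> e ord_max.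
    by move=> /ei/(congr1 val)/= E; move: hi; rewrite E ltnn.
  have Si : ordS (Ordinal hi') = Ordinal hi by apply: val_inj; rewrite /= modn_small.
  have := ve (Ordinal hi'); rewrite Si => E; have [[r s]|[r s]] := set2_eq E.
    by apply/rst_sym/rst_step; exists (e (Ordinal hi')).
  by apply: rst_step; exists (e (Ordinal hi')).
exists (e ord_max).
have S0 : ordS (@ord_max n) = Ordinal n0 by apply: val_inj; rewrite /= modnn.
have mE : Ordinal (ltnSn n) = @ord_max n by exact: val_inj.
have := ve ord_max; rewrite S0 => E; have [[-> ->]|[-> ->]] := set2_eq E.
  by rewrite -mE; exact: chain.
by apply: rst_sym; rewrite -mE; exact: chain.
Qed.

Section BuildFruitTree.
Variable G : digraph.
Implicit Types (x y z b : vert G) (e f : edge G) (p q c d : seq (edge G)).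

Definition cyclic x := exists c, cycle_at x c.
Definition exit_at x := exists2 e, cross e & src e = x.
Definition same_scc x y := reach x y /\ reach y x.

Hypotheses (conn : connected_digraph G) (nsc : ~ strongly_connected G)
  (fin : finite_set [set: vert G])
  (bridge : forall e, cross e ->
    ~ clos_refl_sym_trans (vert G) (uedge (fun f => f <> e)) (src e) (rng e))
  (range_acyclic : forall e, cross e -> ~ cyclic (rng e))
  (cycles_commute : forall e c d, cross e -> cycle_at (src e) c ->
    cycle_at (src e) d -> c ++ d = d ++ c)
  (exit_unique : forall e f c, cross e -> cross f -> cycle_at (src e) c ->
    reach (src e) (src f) -> reach (src f) (src e) -> e = f).

Lemma scc_refl x : same_scc x x. Proof. by split; exact: reach_refl. Qed.

Lemma scc_sym x y : same_scc x y -> same_scc y x. Proof. by case. Qed.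

Lemma scc_trans x y z : same_scc x y -> same_scc y z -> same_scc x z.
Proof. by move=> [xy yx] [yz zy]; split; apply: (@reach_trans _ y). Qed.

Lemma not_cross f : ~ cross f -> same_scc (src f) (rng f).
Proof. by move=> /contrapT rf; split=> //; exact: reach_edge. Qed.

Lemma not_cross_cyclic f : ~ cross f -> cyclic (rng f).
Proof.
by move=> /contrapT[p vp sp]; exists (f :: p); split; rewrite //= ?eqxx.
Qed.

Lemma cyclic_scc x y : cyclic x -> same_scc x y -> cyclic y.
Proof.
move=> [c [c0 vc sc]] [[p vp sp] [q vq sq]]; exists (p ++ c ++ q); split.
- by rewrite -size_eq0 !size_cat !addn_eq0 (size_eq0 c) (negPf c0) andbF.
- by rewrite !valid_cat vp sp vc sc vq.
- by rewrite !psrc_cat sp sc.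
Qed.

Lemma cyclic_in x f : cyclic x -> rng f = x -> same_scc (src f) x.
Proof.
move=> cx fx; rewrite -fx; apply: not_cross => /range_acyclic; apply.
by rewrite fx.
Qed.

Lemma cross_exists : exists e, cross e.
Proof.
apply: contrapT => nc; apply: nsc => x y.
have all f : same_scc (src f) (rng f).
  by apply: not_cross => cf0; apply: nc; exists f.
have [[p vp sp] _] : same_scc x y.
  elim: (conn x y) => {x y} [x y [f [<- <-]]|x|x y _ /scc_sym|x y z _ h1 _ h2] //.
    exact: scc_refl.
  exact: scc_trans h1 h2.
by exists (mkp y p); rewrite /path_src /path_rng mkpE.
Qed.

(** No cross edge enters the component of [x]. If none left it either, connectedness would make it
    the whole graph, which would be strongly connected. *)
Lemma cyclic_exit x : cyclic x -> exists2 e, cross e & same_scc x (src e).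
Proof.
move=> cx; apply: contrapT => ne; apply: nsc => y z.
have inv f : same_scc x (src f) <-> same_scc x (rng f).
  have [cf|nc] := pselect (cross f); last first.
    by have h := not_cross nc; split=> h'; apply: scc_trans h' _ => //; exact: scc_sym.
  split=> h; first by case: ne; exists f.
  by case: (range_acyclic cf (cyclic_scc cx h)).
have all w : same_scc x w.
  have [|h _] := rst_invariant (P := same_scc x) _ (conn x w); last by apply: h;
    exact: scc_refl.
  by move=> u v [f [<- <-]].
have [[p vp sp] _] := scc_trans (scc_sym (all y)) (all z).
by exists (mkp z p); rewrite /path_src /path_rng mkpE.
Qed.

Lemma exit_scc_uniq x y : cyclic x -> exit_at x -> exit_at y -> same_scc x y -> x = y.
Proof.
move=> [c cc] [e ce ex] [f cf fy] [xy yx]; subst x y; congr src.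
exact: exit_unique cc xy yx.
Qed.

(** Both edges complete to cycles [q f p] and [q f' p'] at an exit of the component, with the same
    [q]. These commute, and comparing the letters after [q] gives the equality. *)
Lemma in_edge_uniq f f' : cyclic (rng f) -> rng f = rng f' -> f = f'.
Proof.
move=> cf ff'; have [e ce [[q vq sq] er]] := cyclic_exit cf.
have sf := cyclic_in cf erefl; have sf' := cyclic_in cf (esym ff').
have mk g : rng g = rng f -> same_scc (src g) (rng f) ->
    exists p, cycle_at (src e) (q ++ g :: p).
  move=> gf [_ rg]; have [p vp sp] := reach_trans er rg.
  exists p; split; first by case: (q).
    by rewrite valid_cat vq sq /= gf eqxx.
  by rewrite psrc_cat sq.
have [p cp] := mk f erefl sf; have [p' cp'] := mk f' (esym ff') sf'.
have := cycles_commute ce cp cp'; rewrite -!catA => /eqP.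
by rewrite eqseq_cat// eqxx => /andP[_ /eqP[]].
Qed.

Variable e0 : edge G.

Definition in_edge x : edge G :=
  if pselect (exists f, rng f = x) is left h then sval (cid h) else e0.
Definition back x := src (in_edge x).

Lemma in_edgeE f : cyclic (rng f) -> in_edge (rng f) = f.
Proof.
move=> cf; rewrite /in_edge; case: pselect => [h|]; last by case; exists f.
by case: (cid h) => f' /= f'E; apply/esym/in_edge_uniq.
Qed.

Lemma rng_in_edge x : cyclic x -> rng (in_edge x) = x.
Proof.
move=> [[|f c] [//= _ /andP[/eqP fx _] _]]; rewrite /in_edge.
by case: pselect => [h|[]]; [case: (cid h)|exists f].
Qed.

Lemma back_scc x : cyclic x -> same_scc x (back x).
Proof. by move=> cx; apply/scc_sym/cyclic_in => //; exact: rng_in_edge. Qed.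

Lemma iter_back_scc x n : cyclic x -> same_scc x (iter n back x).
Proof.
move=> cx; elim: n => [|n IH]; first exact: scc_refl.
by apply: (scc_trans IH); apply: back_scc; exact: cyclic_scc cx IH.
Qed.

Lemma iter_back_path x p : cyclic x -> valid_path x p -> psrc x p = iter (size p) back x.
Proof.
elim: p x => [//|f p IH] x cx /= /andP[/eqP fx vp].
have bx : back x = src f by rewrite /back -fx in_edgeE// fx.
rewrite -[LHS]/(psrc (src f) p) IH//; last first.
  by rewrite -bx; apply: (cyclic_scc cx); exact: back_scc.
by rewrite -bx -iterSr.
Qed.

(** One less than the number of vertices of the circle through a cyclic [x], so that [fruit_len] in
    [build] is a successor and [ord0] can serve as base. *)
Definition circle_len x : nat :=
  if pselect (exists n, iter n.+1 back x == x) is left h then ex_minn h else 0.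

Lemma circle_lenP x : cyclic x -> iter (circle_len x).+1 back x = x /\
  forall n, (0 < n <= circle_len x)%N -> iter n back x <> x.
Proof.
move=> cx; have [c [c0 vc sc]] := cx.
rewrite /circle_len; case: pselect => [h|[]]; last first.
  exists (size c).-1; rewrite prednK ?lt0n ?size_eq0//.
  by rewrite -iter_back_path// sc.
case: ex_minnP => m /eqP mx mmin; split=> // -[//|n] /= nm /eqP /mmin.
by rewrite leqNgt nm.
Qed.

Lemma iter_back_mod x n : cyclic x -> iter n back x = iter (n %% (circle_len x).+1) back x.
Proof.
move=> /circle_lenP[h _]; rewrite {1}(divn_eq n (circle_len x).+1) addnC iterD.
by congr (iter _ _ _); elim: (n %/ _)%N => [//|k IH]; rewrite mulSn iterD IH.
Qed.

Lemma iter_back_inj x i j : cyclic x -> (i <= circle_len x)%N -> (j <= circle_len x)%N ->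
  iter i back x = iter j back x -> i = j.
Proof.
move=> cx; have [hx hmin] := circle_lenP cx.
wlog ij : i j / (i <= j)%N => [hw|] hi hj E.
  by have [/hw|/ltnW/hw h] := leqP i j; [apply|apply/esym/h].
apply/eqP; rewrite eqn_leq ij /= leqNgt; apply/negP => lt.
have := congr1 (iter ((circle_len x).+1 - j) back) E.
rewrite -!iterD subnK ?(leqW hj)// hx => /(hmin _)[].
by rewrite -subn_gt0 in lt; lia.
Qed.

(** Of the component of a cyclic vertex only the exit survives in the stem, as the leaf to which the
    circle is glued. *)
Definition stem_vert := {x : vert G | `[< ~ cyclic x \/ exit_at x >]}.
Definition stem_edge := {e : edge G | `[< cross e >]}.

Lemma stem_src_subproof (a : stem_edge) : `[< ~ cyclic (src (val a)) \/ exit_at (src (val a)) >].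
Proof. by apply/asboolP; right; exists (val a) => //; exact/asboolP/(valP a). Qed.

Lemma stem_rng_subproof (a : stem_edge) : `[< ~ cyclic (rng (val a)) \/ exit_at (rng (val a)) >].
Proof. by apply/asboolP; left; apply: range_acyclic; exact/asboolP/(valP a). Qed.

Definition build_stem : digraph := @Digraph stem_vert stem_edge
  (fun a => exist _ (src (val a)) (stem_src_subproof a))
  (fun a => exist _ (rng (val a)) (stem_rng_subproof a)).

Definition build : fruit_data := @FruitData build_stem
  [set l : vert build_stem | cyclic (val l)]
  (fun l => (circle_len (val l)).+1) (fun=> ord0).

(** Edge [j] of [circle n] runs from [j + 1] to [j], so increasing the position means stepping
    backwards from the exit. *)
Definition fruit_vert (z : vert (fruits build)) : vert G :=
  iter (tagged z) back (val (val (tag z))).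

Definition unbuild_vert (u : vert (glued build)) : vert G :=
  match u with inl x => val x | inr y => fruit_vert (val y) end.

Definition unbuild_edge (a : edge (glued build)) : edge G :=
  match a with inl a => val a | inr b => in_edge (fruit_vert b) end.

Lemma tag_cyclic (z : vert (fruits build)) : cyclic (val (val (tag z))).
Proof. by case: z => -[l /= lF] i; move: lF; rewrite inE. Qed.

Lemma fruit_vert_scc (z : vert (fruits build)) :
  same_scc (val (val (tag z))) (fruit_vert z).
Proof. exact: iter_back_scc (tag_cyclic z). Qed.

Lemma fruit_vert_cyclic (z : vert (fruits build)) : cyclic (fruit_vert z).
Proof. exact: cyclic_scc (tag_cyclic z) (fruit_vert_scc z). Qed.

Lemma unbuild_glue (z : vert (fruits build)) : unbuild_vert (glue_fruit z) = fruit_vert z.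
Proof.
rewrite /glue_fruit; case: insubP => [y _ yz|/negbNE/eqP z0] /=; first by rewrite yz.
by rewrite /fruit_vert z0.
Qed.

Lemma stem_cyclic_exit (l : vert build_stem) : cyclic (val l) -> exit_at (val l).
Proof. by move=> cl; have /asboolP[] := valP l. Qed.

Lemma fruit_vert_inj : injective fruit_vert.
Proof.
move=> z z' E; have c := tag_cyclic z; have c' := tag_cyclic z'.
have := scc_trans (fruit_vert_scc z) (scc_sym _);
  rewrite E => /(_ _ (fruit_vert_scc z')) ll'.
have := exit_scc_uniq c (stem_cyclic_exit c) (stem_cyclic_exit c') ll'.
case: z z' E c c' {ll'} => [l i] [l' i'] /= E c c' /val_inj/val_inj ll'; subst l'.
congr existT; apply: val_inj.
by apply: (iter_back_inj c _ _ E); rewrite -ltnS; exact: ltn_ord.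
Qed.

Lemma fruit_vert_surj x : cyclic x -> exists z : vert (fruits build), fruit_vert z = x.
Proof.
move=> cx; have [e ce xe] := cyclic_exit cx.
have cs : cyclic (src e) by exact: cyclic_scc cx xe.
have [_ [p vp sp]] := xe.
have lP : `[< ~ cyclic (src e) \/ exit_at (src e) >] by apply/asboolP; right; exists e.
pose l : vert build_stem := exist _ (src e) lP.
have lF : l \in fruit_at build by rewrite inE.
have [q vq sq] := xe.1.
have im : (size q %% (circle_len (src e)).+1 < (circle_len (src e)).+1)%N by rewrite ltn_pmod.
exists (existT _ (exist _ l lF) (Ordinal im)); rewrite /fruit_vert /=.
by rewrite -iter_back_mod// -iter_back_path.
Qed.

Lemma unbuild_vert_inj : injective unbuild_vert.
Proof.
have stem_free (x : vert build_stem) (y : free_vert build) : val x <> fruit_vert (val y).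
  move=> xy; have cy := fruit_vert_cyclic (val y).
  have cx : cyclic (val x) by rewrite xy.
  have cl := tag_cyclic (val y).
  have lx : val (val (tag (val y))) = val x.
    apply: (exit_scc_uniq cl (stem_cyclic_exit cl) (stem_cyclic_exit cx)).
    by rewrite xy; exact: fruit_vert_scc.
  have := valP y; rewrite /= -val_eqE /=; apply/negP/negPn/eqP.
  apply: (iter_back_inj (j := 0) cl) => //; first by rewrite -ltnS; exact: ltn_ord.
  by rewrite -[LHS]/(fruit_vert (val y)) -xy lx.
move=> [x|y] [x'|y'] /=.
- by move=> /val_inj ->.
- by move=> /stem_free.
- by move=> /esym/stem_free.
- by move=> /fruit_vert_inj/val_inj ->.
Qed.

Lemma unbuild_vert_surj x : exists u, unbuild_vert u = x.
Proof.
have [/fruit_vert_surj[z <-]|nc] := pselect (cyclic x).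
  by exists (glue_fruit z); exact: unbuild_glue.
have xP : `[< ~ cyclic x \/ exit_at x >] by apply/asboolP; left.
by exists (inl (exist _ x xP : vert build_stem)).
Qed.

Lemma stem_edge_cross (a : edge build_stem) : cross (val a).
Proof. exact/asboolP/(valP a). Qed.

Lemma unbuild_edge_inj : injective unbuild_edge.
Proof.
have ne (a : edge build_stem) (b : edge (fruits build)) : val a <> in_edge (fruit_vert b).
  move=> E; have nr := range_acyclic (@stem_edge_cross a); apply: nr.
  by rewrite E rng_in_edge; exact: fruit_vert_cyclic.
move=> [a|b] [a'|b'] /=.
- by move=> /val_inj ->.
- by move=> /ne.
- by move=> /esym/ne.
- move=> /(congr1 rng); rewrite !rng_in_edge; try exact: fruit_vert_cyclic.
  by move=> /fruit_vert_inj ->.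
Qed.

Lemma unbuild_edge_surj f : exists a, unbuild_edge a = f.
Proof.
have [cf|nf] := pselect (cross f).
  have fP : `[< cross f >] by apply/asboolP.
  by exists (inl (exist _ f fP : edge build_stem)).
have [z zE] := fruit_vert_surj (not_cross_cyclic nf).
exists (inr z); rewrite /= zE in_edgeE//; exact: not_cross_cyclic.
Qed.

Lemma unbuild_rng (a : edge (glued build)) : unbuild_vert (rng a) = rng (unbuild_edge a).
Proof.
case: a => [a|b] //; rewrite -[LHS]/(unbuild_vert (glue_fruit (rng b))) unbuild_glue /=.
by rewrite rng_in_edge; [case: b|exact: fruit_vert_cyclic].
Qed.

Lemma unbuild_src (a : edge (glued build)) : unbuild_vert (src a) = src (unbuild_edge a).
Proof.
case: a => [a|b] //; rewrite -[LHS]/(unbuild_vert (glue_fruit (src b))) unbuild_glue /=.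
have := tag_cyclic b; case: b => l i cl; rewrite /fruit_vert /= -/(back _).
by rewrite -iterS [RHS]iter_back_mod.
Qed.

Lemma build_iso : digraph_iso G (glued build).
Proof.
have [fv [cv1 cv2]] := inj_surj_can unbuild_vert_inj unbuild_vert_surj.
have [fe [ce1 ce2]] := inj_surj_can unbuild_edge_inj unbuild_edge_surj.
exists fv, fe; split; [by exists unbuild_vert|by exists unbuild_edge|].
by move=> e; split; apply: unbuild_vert_inj; rewrite ?unbuild_src ?unbuild_rng ce1 cv1.
Qed.

(** The graph of the retraction of [G] onto its stem that collapses each circle to its exit; it
    turns walks in [G] into walks in the stem. *)
Definition stem_base x (X : vert build_stem) :=
  (val X = x /\ ~ cyclic x) \/ [/\ cyclic x, exit_at (val X) & same_scc x (val X)].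

Lemma stem_base_ex x : exists X, stem_base x X.
Proof.
have [cx|nc] := pselect (cyclic x).
  have [e ce xe] := cyclic_exit cx.
  have eP : `[< ~ cyclic (src e) \/ exit_at (src e) >] by apply/asboolP; right; exists e.
  by exists (exist _ (src e) eP); right; split=> //; exists e.
have xP : `[< ~ cyclic x \/ exit_at x >] by apply/asboolP; left.
by exists (exist _ x xP); left.
Qed.

Lemma stem_base_uniq x X Y : stem_base x X -> stem_base x Y -> X = Y.
Proof.
move=> [[Xx nx]|[cx eX sX]] [[Yx ny]|[cy eY sY]] //; apply: val_inj.
  by rewrite Xx Yx.
apply: exit_scc_uniq (cyclic_scc cx sX) eX eY _.
exact: scc_trans (scc_sym sX) sY.
Qed.

Definition to_stem x : vert build_stem := sval (cid (stem_base_ex x)).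

Lemma to_stemP x : stem_base x (to_stem x).
Proof. by rewrite /to_stem; case: (cid _). Qed.

Lemma to_stem_val (X : vert build_stem) : to_stem (val X) = X.
Proof.
apply: stem_base_uniq (to_stemP _) _.
have [cX|nc] := pselect (cyclic (val X)); last by left.
by right; split=> //; [exact: stem_cyclic_exit|exact: scc_refl].
Qed.

Lemma build_stem_connected : connected_digraph build_stem.
Proof.
move=> X Y; rewrite -(to_stem_val X) -(to_stem_val Y).
apply: (rst_map (g := to_stem) _ (conn (val X) (val Y))) => x y [f [<- <-]].
have [cf|nf] := pselect (cross f).
  have fP : `[< cross f >] by apply/asboolP.
  pose a : edge build_stem := exist _ f fP.
  rewrite -[src f]/(val (src a)) -[rng f]/(val (rng a)) !to_stem_val.
  by apply: rst_step; exists a.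
rewrite (_ : to_stem (src f) = to_stem (rng f)); first exact: rst_refl.
have cr := not_cross_cyclic nf; have sr := not_cross nf.
apply: stem_base_uniq (to_stemP _) _; right.
have [[_]//|[_ eX sX]] := to_stemP (rng f).
split=> //; [exact: cyclic_scc cr (scc_sym sr)|exact: scc_trans sr sX].
Qed.

Lemma build_fruit_tree : fruit_tree_without_in_fruit G.
Proof.
have [e ce] := cross_exists.
have eP : `[< cross e >] by apply/asboolP.
pose a : edge build_stem := exist _ e eP.
have iso := build_iso; exists build; split=> //; last first.
  move=> [l [cl [b [bl _]]]]; have nr := range_acyclic (@stem_edge_cross b); apply: nr.
  by have := congr1 val bl => /= ->.
split; last first.
  have [fv [fe [[gv c1 c2] _ _]]] := iso.
  suff -> : [set: vert (glued build)] = fv @` [set: vert G] by exact: finite_image.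
  by apply/seteqP; split=> // u _; exists (gv u).
split.
- split; first exact: build_stem_connected.
    exists (src a), (rng a) => /(congr1 val)/= sr; apply: ce; rewrite sr.
    exact: reach_refl.
  (* A polygon in the stem contains an edge that is not a bridge there, hence not a bridge in [G]
     either. *)
  move=> [n [v [ed /polygon_not_bridge[b hb]]]].
  apply: (bridge (@stem_edge_cross b)).
  apply: (rst_map (g := val) _ hb) => x y [c [cb <- <-]].
  by apply: rst_step; exists (val c); split=> // /val_inj.
- move=> l cl; have [f cf fl] := stem_cyclic_exit cl.
  have fP : `[< cross f >] by apply/asboolP.
  exists (exist _ f fP : edge build_stem); split; first by left; exact: val_inj.
  move=> b [/(congr1 val)/= bl|/(congr1 val)/= bl]; apply: val_inj => /=; last first.
    by case: (range_acyclic (@stem_edge_cross b)); rewrite bl.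
  have [c cc] : cyclic (src f) by rewrite fl.
  apply: exit_unique cc _ _ => //; [exact: stem_edge_cross| |]; rewrite fl bl;
    exact: reach_refl.
- move=> E; have : [set: vert build_stem] (rng a) by [].
  by rewrite -E /= => /(range_acyclic ce).
Qed.

End BuildFruitTree.

Lemma fruit_tree_of_inner (R : realType) (G : digraph) :
  connected_digraph G -> ~ strongly_connected G -> all_inner R G ->
  fruit_tree_without_in_fruit G.
Proof.
move=> conn nsc inner.
have acyc (e : edge G) : cross e -> ~ cyclic (rng e).
  by move=> ce [c cc]; exact: (inner_no_cycle_at_range ce cc inner).
have [e0 _] := cross_exists conn nsc.
apply: (build_fruit_tree conn nsc _ _ acyc _ _ e0).
- exact: (inner_finite_vert inner conn).
- by move=> e ce; exact: (inner_bridge inner ce).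
- by move=> e c d ce; exact: (inner_cycles_commute inner ce).
- by move=> e f c ce cf; exact: (inner_exit_unique inner ce cf).
Qed.
(** * Derivations on fruit trees *)

(* [K] is the set of vertices on the circles; for such a vertex [x], [bs x] is
   the vertex at which its circle is glued to the stem, and [rho x] is the
   length of the path from [x] to [bs x] along the circle. *)
Record fruit_structure (G : digraph) (K : vert G -> Prop) (rho : vert G -> nat)
    (bs : vert G -> vert G) : Prop := FruitStructure {
  fs_fin : finite_set [set: vert G];
  fs_in_uniq : forall e f, K (rng e) -> rng e = rng f -> e = f;
  fs_in : forall e, K (rng e) -> K (src e);
  fs_bridge : forall e, ~ K (rng e) ->
    ~ clos_refl_sym_trans (vert G) (uedge (fun f => f <> e)) (src e) (rng e);
  fs_out_uniq : forall e f, K (src e) -> src e = src f ->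
    (K (rng e) <-> K (rng f)) -> e = f;
  fs_exit : forall e, K (src e) -> ~ K (rng e) -> rho (src e) = 0%N;
  fs_rho : forall e, K (rng e) -> bs (src e) = bs (rng e) /\
    (rho (src e) = (rho (rng e)).+1 \/ rho (src e) = 0%N);
  fs_base : forall x, K x -> rho x = 0%N -> bs x = x;
  fs_down : forall x, K x -> (0 < rho x)%N ->
    exists f, [/\ src f = x, K (rng f) & rho x = (rho (rng f)).+1] }.

Section LinearClosed.
Variables (R : realType) (I : choiceType).
Local Notation B := (bop R I).

Lemma lim_closed_lin (F : B -> B) (M : R) : (forall S T, F (S - T) = F S - F T) ->
  (forall S, opnorm (F S) <= M * opnorm S) -> lim_closed [set S | F S = 0].
Proof.
move=> FB FM T h; apply: opnorm_le0; apply/ler_addgt0Pr => e e0; rewrite add0r.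
have M0 : 0 < `|M| + 1 by rewrite ltr_wpDl.
have [S /= S0 TS] := h (e / (`|M| + 1)) (divr_gt0 e0 M0).
rewrite -[F T]subr0 -S0 -FB (le_trans (FM _))//.
rewrite (le_trans (ler_wpM2r (opnorm_ge0 _) (ler_norm _)))//.
rewrite (le_trans (ler_wpM2l (normr_ge0 _) TS))// mulrA ler_pdivrMr// mulrC.
by rewrite ler_wpM2l ?(ltW e0)// lerDl.
Qed.

End LinearClosed.

(** * Reducing derivations to zero by inner ones *)

Section Elimination.
Variables (R : realType) (G : digraph).
Local Notation C := R[i].
Local Notation B := (bop R (dpath G)).
Local Notation A := (graph_algebra R G).
Local Notation P := (fun v => Lop R v [::]).
Local Notation L := (fun e => Lop R (rng e) [:: e]).
Implicit Types (v x y z : vert G) (e f : edge G) (p q c : seq (edge G)).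
Implicit Types (S T X : B) (d : B -> B).

Let sA : sublin A := @algebra_sublin R G.

Lemma algebra_P v : A (P v). Proof. exact: algebra_Lop. Qed.
Lemma algebra_L e : A (L e). Proof. by apply: algebra_Lop; rewrite /= eqxx. Qed.
Hint Resolve algebra_P algebra_L : core.

Lemma PL e : P (rng e) * L e = L e.
Proof. exact: (@LopM R G (rng e) [::] [:: e]). Qed.

Lemma LP e : L e * P (src e) = L e.
Proof. by rewrite (@LopM R G (rng e) [:: e] [::])//= eqxx. Qed.

Lemma PP x : P x * P x = P x. Proof. exact: (@LopM R G x [::] [::]). Qed.
Lemma PP0 x y : x <> y -> P x * P y = 0.
Proof. by move=> xy; apply: LopM0 => /esym. Qed.

Definition good_der d := is_derivation A d /\ bounded_on A d.
Definition der_shift d T := fun S => d S - (S * T - T * S).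

Lemma der0 d : is_derivation A d -> d 0 = 0.
Proof.
case=> _ dL _; have A0 : A 0 by case: sA.
have := dL 1 0 0 A0 A0; rewrite !scale1r addr0 => /eqP.
by rewrite -subr_eq0 opprD addrA subrr sub0r oppr_eq0 => /eqP.
Qed.

Lemma derB d S T : is_derivation A d -> A S -> A T -> d (S - T) = d S - d T.
Proof.
case=> _ dL _ AS AT; rewrite addrC -scaleN1r dL// scaleN1r addrC//.
Qed.

Lemma good_shift d T : A T -> good_der d -> good_der (der_shift d T).
Proof.
move=> AT [[dA dL dM] [M dB]]; split; first split=> [S AS|a S S' AS AS'|S S' AS AS'].
- by apply: (sublinB sA); [exact: dA|apply: (sublinB sA); exact: algebraM].
- rewrite /der_shift dL// mulrDl mulrDr bop_scalerAl bop_scalerAr.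
  rewrite (_ : a *: (S * T) + S' * T - _ = a *: (S * T - T * S) + (S' * T - T * S')).
    by rewrite [X in _ = X + _]scalerBr opprD addrACA.
  by rewrite scalerBr opprD addrACA.
- rewrite /der_shift dM// mulrBl mulrBr mulrBl mulrBr !mulrA.
  rewrite addrACA -opprD; congr (_ + - _).
  by rewrite [RHS]addrC addrA subrK.
exists (M + opnorm T + opnorm T) => S AS.
have h1 := dB S AS; have h2 := opnormM S T; have h3 := opnormM T S.
have h4 := opnormD_le (d S) (- (S * T - T * S)).
have h5 := opnormD_le (S * T) (- (T * S)).
by rewrite /der_shift; rewrite !opnormN in h4 h5; lra.
Qed.

Lemma inner_shift d T : A T -> is_inner A (der_shift d T) -> is_inner A d.
Proof.
move=> AT [T' AT' h]; exists (T' + T); first exact: (sublinD sA).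
move=> S AS; rewrite -[d S](subrK (S * T - T * S)) -[X in X + _]/(der_shift d T S) h//.
by rewrite mulrDl mulrDr opprD addrACA.
Qed.

Definition kills_vert d := forall v, d (P v) = 0.

Lemma der_corner d S x y : is_derivation A d -> kills_vert d -> A S ->
  P x * S * P y = S -> d S = P x * d S * P y.
Proof.
move=> [_ _ dM] kv AS E.
by rewrite -{1}E !dM ?kv ?mul0r ?mulr0 ?add0r ?addr0//; exact: algebraM.
Qed.

Lemma der_path d v p : is_derivation A d -> kills_vert d -> valid_path v p ->
  (forall f, f \in p -> d (L f) = 0) -> d (Lop R v p) = 0.
Proof.
move=> dd kv; have [_ _ dM] := dd; elim: p v => [v _ _|f p IH v /= /andP[/eqP <- vp] kp].
  exact: kv.
have -> : Lop R (rng f) (f :: p) = L f * Lop R (src f) p.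
  by rewrite (@LopM _ _ _ [:: f])//= eqxx.
rewrite dM// ?kp ?mem_head// ?mul0r ?add0r ?IH ?mulr0// => [g gp|].
  by rewrite kp// inE gp orbT.
exact: algebra_Lop.
Qed.

Lemma der_zero d : good_der d -> kills_vert d -> (forall e, d (L e) = 0) -> is_inner A d.
Proof.
move=> [dd [M dB]] kv ke; exists 0; first by case: sA.
move=> S AS; rewrite mulr0 mul0r subrr; have [dA dL dM] := dd.
suff [] : (A `&` [set S | d S = 0]) S by [].
apply: (generator_ind _ _ _ _ _ AS) => [||S1 S2 [A1 d1] [A2 d2]|e|v].
- split=> [|a S1 S2 [A1 d1] [A2 d2]]; first by split; [case: sA|exact: der0].
  by split; [exact: sA.2|rewrite /= dL// d1 d2 scaler0 addr0].
- move=> T h; have AT : A T by apply: algebra_closed => e /h[S' [AS' _] TS']; exists S'.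
  split=> //; apply: opnorm_le0; apply/ler_addgt0Pr => e e0; rewrite add0r.
  have M0 : 0 < `|M| + 1 by rewrite ltr_wpDl.
  have [S' [AS' d0] TS'] := h (e / (`|M| + 1)) (divr_gt0 e0 M0).
  rewrite -[d T]subr0 -d0 -derB// (le_trans (dB _ _))//; first exact: (sublinB sA).
  rewrite (le_trans (ler_wpM2r (opnorm_ge0 _) (ler_norm _)))//.
  rewrite (le_trans (ler_wpM2l (normr_ge0 _) TS'))// mulrA ler_pdivrMr// mulrC.
  by rewrite ler_wpM2l ?(ltW e0)// lerDl.
- by split; [exact: algebraM|rewrite /= dM// d1 d2 mulr0 mul0r addr0].
- by rewrite L_edgeE; split; [exact: algebra_L|exact: ke].
- by rewrite L_vertE; split; [exact: algebra_P|exact: kv].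
Qed.

(** With finitely many vertices the projections [P x] sum to 1, and the operator [- sum d(P x) P x]
    implements [d] on all of them. *)
Lemma der_kill_vert d : finite_set [set: vert G] -> good_der d ->
  exists2 T, A T & kills_vert (der_shift d T).
Proof.
move=> /finite_seqP[s0 s0E] [dd _]; have [dA dL dM] := dd.
pose s := undup s0.
have us : uniq s by exact: undup_uniq.
have sT v : v \in s.
  by rewrite mem_undup; have : [set: vert G] v by []; rewrite s0E.
have sum1 : \sum_(v <- s) P v = 1.
  apply: bop_ext => g; apply: ell2_ext => w; rewrite bop_sumE ell2_sumE.
  have ww : pre (val w).1 [::] w w by split=> //; exact: surjective_pairing.
  rewrite (bigD1_seq (val w).1)// (rel_opE _ (pbij_pre _ _) ww) big1 => [|v /eqP vw];
    first exact: addr0.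
  by rewrite rel_op0// => u [_ wE]; apply: vw; rewrite wE.
(* Obtained by differentiating [P y * P x = 0], as [self0] is by differentiating
   [P y * P y = P y]. *)
have cross0 x y : x <> y -> P y * d (P x) * P x = - (d (P y) * P x).
  move=> xy; have := dM (P y) (P x) (algebra_P y) (algebra_P x).
  rewrite PP0; last by move=> /esym.
  move=> /esym/eqP; rewrite der0// addrC addr_eq0 => /eqP E.
  by rewrite E mulNr -mulrA PP.
have self0 y : P y * d (P y) * P y = 0.
  have := dM (P y) (P y) (algebra_P y) (algebra_P y); rewrite PP => E.
  have := congr1 (fun S => P y * S * P y) E.
  rewrite mulrDr mulrDl !mulrA PP -!mulrA PP !mulrA => /eqP.
  by rewrite -subr_eq0 opprD addrA subrr sub0r oppr_eq0 => /eqP.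
exists (- \sum_(x <- s) d (P x) * P x).
  apply: (sublinN sA); apply: (sublin_sum sA) => x _ _.
  by apply: algebraM => //; exact: dA.
move=> y; rewrite /der_shift mulrN mulNr opprK mulr_sumr mulr_suml.
have -> : \sum_(x <- s) P y * (d (P x) * P x) = - (d (P y) * (1 - P y)).
  rewrite (bigD1_seq y)//= mulrA self0 add0r -sum1 (bigD1_seq y (sT y) us) /= addrAC subrr add0r.
  rewrite mulr_sumr -sumrN; apply: eq_bigr => x /eqP xy.
  by rewrite mulrA cross0.
rewrite (bigD1_seq y)//= big1 ?addr0 => [|x /eqP xy]; last first.
  by rewrite -mulrA PP0 ?mulr0.
by rewrite -mulrA PP opprK mulrBr mulr1 subrK subrr.
Qed.

Lemma corner_ind (F : B -> B) (M : R) x y S : (forall S T, F (S - T) = F S - F T) ->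
  (forall a S, F (a *: S) = a *: F S) ->
  (forall S, opnorm (F S) <= M * opnorm S) ->
  (forall p, valid_path x p -> psrc x p = y -> F (Lop R x p) = 0) ->
  A S -> F (P x * S * P y) = 0.
Proof.
move=> FB FZ FM Fp AS.
have F0 : F 0 = 0 by have := FB 0 0; rewrite !subrr.
have FD S1 S2 : F (S1 + S2) = F S1 + F S2.
  by rewrite -{1}[S2]opprK FB -[- S2]sub0r FB F0 sub0r opprK.
apply: (span_ind (P := [set S | F (P x * S * P y) = 0])) AS => [||v p vp].
- split=> [|a S1 S2 /= h1 h2] /=; first by rewrite mulr0 mul0r.
  by rewrite mulrDr mulrDl FD bop_scalerAr bop_scalerAl FZ h1 h2 scaler0 addr0.
- apply: (@lim_closed_lin _ _ (fun S => F (P x * S * P y)) `|M|) => [S1 S2|S1].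
    by rewrite mulrBr mulrBl FB.
  rewrite (le_trans (FM _))// (le_trans (ler_wpM2r (opnorm_ge0 _) (ler_norm _)))//.
  rewrite ler_wpM2l// (le_trans (opnormM _ _))//.
  rewrite (le_trans (ler_piMr (opnorm_ge0 _) (Lop_norm _ _ _)))//.
  rewrite (le_trans (opnormM _ _))//.
  exact: (ler_piMl (opnorm_ge0 _) (Lop_norm _ _ _)).
- rewrite /=; have [xv|/eqP xv] := eqVneq x v; last first.
    by rewrite (@LopM0 _ _ x [::] v p) ?mul0r// => /esym.
  subst v; rewrite (@LopM _ _ x [::] p)//.
  have [py|/eqP py] := eqVneq (psrc x p) y; last by rewrite LopM0// => /esym.
  by have := LopM R [::] vp; rewrite py => ->; rewrite cats0 Fp.
Qed.

(** Paths are written from their range, so every path from [src e] to [rng e] traverses [e] last: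
    the corner of [A] between these vertices consists of left multiples of [L e]. *)
Definition gate e := src e <> rng e /\
  forall p, valid_path (rng e) p -> psrc (rng e) p = src e -> exists q, p = e :: q.

(** Take for [X] the adjoint of [L e] times [d (L e)]. It lies in [A] because every path operator in
    the corner of [d (L e)] begins with [e], which the adjoint strips. *)
Lemma gate_factor d e : good_der d -> kills_vert d -> gate e ->
  exists X, [/\ A X, P (src e) * X * P (src e) = X & L e * X = d (L e)].
Proof.
move=> [dd _] kv [_ ge]; have [dA dL dM] := dd.
have dE : d (L e) = P (rng e) * d (L e) * P (src e).
  by apply: der_corner => //; rewrite PL LP.
have Ae := dA _ (algebra_L e).
have ve : valid_path (rng e) [:: e] by rewrite /= eqxx.
have adj q : valid_path (src e) q -> Ladj R (rng e) [:: e] * Lop R (rng e) (e :: q) = Lop R (src e) q.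
  move=> vq; have -> : Lop R (rng e) (e :: q) = L e * Lop R (src e) q by rewrite (@LopM _ _ _ [:: e]).
  by rewrite mulrA Ladj_Lop// (@LopM _ _ _ [::]).
exists (Ladj R (rng e) [:: e] * d (L e)); split.
- rewrite dE;
    apply: (span_ind (P := [set S | A (Ladj R (rng e) [:: e] * (P (rng e) * S * P (src e)))])) Ae.
  + split=> [|a S1 S2 /= h1 h2]; first by rewrite /= mulr0 mul0r mulr0; case: sA.
    by rewrite mulrDr mulrDl mulrDr bop_scalerAr bop_scalerAl bop_scalerAr; exact: sA.2.
  + have h1 := lim_closed_mulr (T := P (src e)) (lim_closed_mull (T := Ladj R (rng e) [:: e]) (@algebra_closed R G)).
    exact: (lim_closed_mull (T := P (rng e)) h1).
  + move=> v p vp /=; have [xv|/eqP xv] := eqVneq (rng e) v; last first.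
      by rewrite (@LopM0 _ _ _ [::] v p) ?mul0r ?mulr0; [case: sA|move=> /esym].
    subst v; rewrite (@LopM _ _ _ [::] p)//.
    have [py|/eqP py] := eqVneq (psrc (rng e) p) (src e); last first.
      by rewrite LopM0 ?mulr0; [case: sA|move=> /esym].
    rewrite -[X in Lop R X [::]]py LopM// cats0; have [q pq] := ge p vp py; subst p.
    by move: vp => /= /andP[_ vq]; rewrite adj//; exact: algebra_Lop.
- have PsA : P (src e) * Ladj R (rng e) [:: e] = Ladj R (rng e) [:: e].
    rewrite (rel_opM R (pbij_pre _ _) (pbij_pre_adj _ _)); apply: eq_rel_op => w u;
      split=> [[w' [rw wE] [rw' uE]]|[ru wE]].
      by have -> : u = w' by apply: dpath_eq; rewrite uE.
    by exists u => //; split=> //; rewrite [LHS]surjective_pairing ru.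
  by rewrite mulrA PsA dE -!mulrA PP.
- rewrite dE mulrA; apply/eqP; rewrite -subr_eq0; apply/eqP.
  apply: (@corner_ind (fun S => L e * Ladj R (rng e) [:: e] * S - S) 2 _ _ _ _ _ _ _ Ae).
  + by move=> S T; rewrite mulrBr !opprD !opprK addrACA.
  + by move=> a S; rewrite bop_scalerAr scalerBr.
  + move=> S; rewrite (le_trans (opnormD_le _ _))// opnormN mulrDl mul1r lerD2r.
    rewrite (le_trans (opnormM _ _))// ler_piMl ?opnorm_ge0//.
    rewrite (le_trans (opnormM _ _))// mulr_ile1 ?opnorm_ge0//; exact: rel_op_norm.
  + move=> p vp py; have [q pq] := ge p vp py; subst p.
    have vq : valid_path (src e) q by move: vp => /= /andP[].
    by rewrite -mulrA adj// (@LopM _ _ _ [:: e])// subrr.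
Qed.

(** As [X] lives in the corner at [src e], its commutators affect only edges incident to [src e];
    since [src e] and [rng e] differ, that with [L e] is [L e * X]. *)
Lemma gate_shift d e : good_der d -> kills_vert d -> gate e ->
  exists X, [/\ A X, kills_vert (der_shift d X), der_shift d X (L e) = 0 &
    forall f, ~ incident f (src e) -> der_shift d X (L f) = d (L f)].
Proof.
move=> gd kv ge; have [X [AX XE eX]] := gate_factor gd kv ge.
have PX y : y <> src e -> P y * X = 0.
  by move=> ye; rewrite -XE !mulrA PP0// !mul0r.
have XP y : y <> src e -> X * P y = 0.
  by move=> ye; rewrite -XE -!mulrA PP0 ?mulr0// => /esym.
have Xl : P (src e) * X = X by rewrite -XE !mulrA PP.
have Xr : X * P (src e) = X by rewrite -XE -!mulrA PP.
exists X; split=> //.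
- move=> y; rewrite /der_shift kv sub0r; have [->|/eqP ye] := eqVneq y (src e).
    by rewrite Xl Xr subrr oppr0.
  by rewrite PX// XP// subrr oppr0.
- rewrite /der_shift eX -(PL e) (mulrA X) XP; last by case: ge => + _ => h /esym.
  by rewrite mul0r subr0 subrr.
- move=> f nf; rewrite /der_shift -(PL f) (mulrA X) XP ?mul0r; last by move=> h;
    apply: nf; right.
  by rewrite PL -(LP f) -mulrA PX ?mulr0 ?subr0// => h; apply: nf; left.
Qed.

(** The edges of [es] are treated in order of increasing [phi]. Treating [e] disturbs only edges at
    [src e], and by hypothesis none of those already killed is among them. [Kd] collects the killed
    edges during the induction. *)
Lemma eliminate (es : seq (edge G)) (phi : edge G -> nat) (Kd : edge G -> Prop) d :
  good_der d -> kills_vert d -> (forall f, Kd f -> d (L f) = 0) ->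
  uniq es -> sorted (fun e f => phi e <= phi f)%N es ->
  (forall e, e \in es -> gate e) ->
  (forall e f, e \in es -> Kd f -> ~ incident f (src e)) ->
  (forall e f, e \in es -> f \in es -> f <> e -> (phi f <= phi e)%N -> ~ incident f (src e)) ->
  (forall d', good_der d' -> kills_vert d' -> (forall f, Kd f -> d' (L f) = 0) ->
    (forall f, f \in es -> d' (L f) = 0) -> is_inner A d') ->
  is_inner A d.
Proof.
move=> + + + + + + + + H; move: H; elim: es Kd d => [|e es IH] Kd d H gd kv kd.
  by move=> *; apply: H.
move=> /= /andP[ees ues] srt ges kdes eses.
have [X [AX kvX eX fX]] := gate_shift gd kv (ges e (mem_head _ _)).
apply: (inner_shift AX); apply: (IH (fun f => Kd f \/ f = e)) => //.
- move=> d' gd' kv' kd' kes'; apply: H => // [f /(or_introl)/kd'//|f].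
  by rewrite inE => /predU1P[->|/kes'//]; apply: kd'; right.
- exact: good_shift.
- move=> f [kf|->//]; rewrite fX ?kd//.
  by apply: kdes; rewrite ?mem_head.
- exact: path_sorted srt.
- by move=> f fes; apply: ges; rewrite inE fes orbT.
- move=> f g fes [kg|->]; first by apply: kdes; rewrite ?inE ?fes ?orbT.
  apply: eses; rewrite ?mem_head ?inE ?fes ?orbT//.
    by move=> ef; rewrite ef fes in ees.
  have /allP := order_path_min (fun (x y z : edge G) => @leq_trans (phi x) (phi y) (phi z)) srt.
  exact.
- by move=> f g fes gs; apply: eses; rewrite inE ?fes ?gs orbT.
Qed.

Lemma cycle_der_zero d v c : good_der d -> kills_vert d -> valid_path v c ->
  psrc v c = v ->
  (forall q, valid_path v q -> psrc v q = v -> c ++ q = q ++ c) -> d (Lop R v c) = 0.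
Proof.
move=> [dd [M dB]] kv vc sc comm; have [dA dL dM] := dd.
set Lc := Lop R v c; set Y := d Lc.
have AL : A Lc by exact: algebra_Lop.
have PLc : P v * Lc = Lc by rewrite /Lc (@LopM _ _ v [::]).
have LcP : Lc * P v = Lc by rewrite /Lc -{2}sc LopM// cats0.
have YE : Y = P v * Y * P v by apply: der_corner; rewrite ?PLc.
have AY : A Y by exact: dA.
have cY : Lc * Y = Y * Lc.
  apply/eqP; rewrite -subr_eq0 YE; apply/eqP.
  apply: (@corner_ind (fun S => Lc * S - S * Lc) 2 _ _ _ _ _ _ _ AY).
  - by move=> S T; rewrite mulrBr mulrBl !opprD !opprK addrACA.
  - by move=> a S; rewrite bop_scalerAr bop_scalerAl scalerBr.
  - move=> S; rewrite (le_trans (opnormD_le _ _))// opnormN mulrDl mul1r lerD//.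
      by rewrite (le_trans (opnormM _ _))// ler_piMl ?opnorm_ge0// Lop_norm.
    by rewrite (le_trans (opnormM _ _))// ler_piMr ?opnorm_ge0// Lop_norm.
  - move=> q vq sq; rewrite /Lc.
    have := LopM R q vc; rewrite sc => ->; have := LopM R c vq; rewrite sq => ->.
    by rewrite comm// subrr.
have Lk k : A (Lc ^+ k.+1) /\ d (Lc ^+ k.+1) = Lc ^+ k * Y *+ k.+1.
  elim: k => [|k [IH1 IH2]]; first by rewrite expr1 expr0 mul1r mulr1n.
  rewrite exprS; split; first exact: algebraM.
  rewrite dM// IH2 -/Y mulrnAr mulrA -exprS [RHS]mulrS; congr (_ + _).
  by rewrite (commrX k.+1 (esym cY : GRing.comm Y Lc)).
(* Multiplication by [Lc] cannot decrease the norm here, because the contraction [Ladj] undoes it on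
   operators with range in the space of [P v]. *)
have Ladjk k : opnorm Y <= opnorm (Lc ^+ k * Y).
  elim: k => [|k IH]; first by rewrite expr0 mul1r.
  have PYk : P v * (Lc ^+ k * Y) = Lc ^+ k * Y.
    case: (k) => [|j]; first by rewrite expr0 mul1r YE !mulrA PP.
    by rewrite exprS !mulrA PLc.
  have -> : opnorm (Lc ^+ k.+1 * Y) = opnorm (Lc * (Lc ^+ k * Y)) by rewrite exprS mulrA.
  apply: (le_trans IH); rewrite -{1}PYk -{1}sc -(Ladj_Lop R vc) -mulrA.
  by rewrite (le_trans (opnormM _ _))// ler_piMl ?opnorm_ge0// Ladj_norm.
have Lkn k : opnorm (Lc ^+ k.+1) <= 1.
  elim: k => [|k IH]; first by rewrite expr1 Lop_norm.
  by rewrite exprS (le_trans (opnormM _ _))// mulr_ile1 ?opnorm_ge0// Lop_norm.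
apply: opnorm_le0; rewrite leNgt; apply/negP => Y0.
(* Chosen so that [k.+1 * opnorm Y] exceeds [|M|], whereas [d (Lc ^+ k.+1)] has norm at most
   [|M|]. *)
pose k := Num.bound (`|M| / opnorm Y).
have [Ak dk] := Lk k; have := dB _ Ak; rewrite dk -scaler_nat opnormZ.
rewrite -(rmorph_nat (real_complex R)) normc_real normr_nat => h.
have h1 : k.+1%:R * opnorm Y <= `|M|.
  rewrite (le_trans (ler_wpM2l _ (Ladjk k)))// (le_trans h)//.
  rewrite (le_trans (ler_wpM2r (opnorm_ge0 _) (ler_norm _)))//.
  by rewrite ler_piMr.
move: h1; rewrite -ler_pdivlMr// leNgt => /negP; apply.
rewrite (lt_trans (archi_boundP _))// ?divr_ge0 ?opnorm_ge0// ltr_nat ltnSn//.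
Qed.

End Elimination.

(** * Innerness from the combinatorial structure *)

Section InnerOfStructure.
Variables (R : realType) (G : digraph).
Local Notation B := (bop R (dpath G)).
Local Notation A := (graph_algebra R G).
Local Notation P := (fun v => Lop R v [::]).
Local Notation L := (fun e => Lop R (rng e) [:: e]).
Implicit Types (v x y z : vert G) (e f : edge G) (p q c : seq (edge G)).
Implicit Types (S T X : B) (d : B -> B).
Variables (K : vert G -> Prop) (rho : vert G -> nat) (bs : vert G -> vert G).
Hypothesis fs : fruit_structure K rho bs.

Lemma path_avoiding e v p : e \notin p -> valid_path v p ->
  clos_refl_sym_trans (vert G) (uedge (fun f => f <> e)) (psrc v p) v.
Proof.
elim: p v => [|f p IH] v /=; first by move=> *; exact: rst_refl.
rewrite inE negb_or => /andP[/eqP ef ep] /andP[/eqP <- vp].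
apply: rst_trans (IH _ ep vp) _; apply: rst_step.
by exists f; split=> // fe; apply: ef.
Qed.

(** A shortest path from [rng e] back to [src e] would avoid [e], contradicting that [e] is a
    bridge. *)
Lemma structure_cross e : ~ K (rng e) -> cross e.
Proof.
move=> nK [p]; have [n] := ubnP (size p); elim: n p => [//|n IH] p pn vp sp.
have [ep|ep] := boolP (e \in p); last first.
  by apply: (fs_bridge fs nK); rewrite -sp; apply: rst_sym; exact: path_avoiding ep vp.
case/path.splitPr: ep pn vp sp => p1 p2; rewrite size_cat valid_cat psrc_cat /=.
by move=> pn /and3P[_ _ vp2] sp2; apply: (IH p2) => //; lia.
Qed.

Lemma structure_acyclic x c : ~ K x -> ~ cycle_at x c.
Proof.
move=> nK cc; have [c0 vc sc] := cc; case: c c0 vc sc cc => // f c _ /andP[/eqP fx _] _ cc.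
have cf : cross f by apply: structure_cross; rewrite fx.
by have := cross_notin_cycle cf cc; rewrite mem_head.
Qed.

(** A path from [src e] to [rng e] must use the bridge [e], and whatever follows [e] would be a
    cycle at [rng e], which is off the circles. *)
Lemma exit_gate e : ~ K (rng e) -> gate e.
Proof.
move=> nK; have nb := fs_bridge fs nK; split=> [sr|p vp sp].
  by apply: nb; rewrite sr; exact: rst_refl.
have [ep|ep] := boolP (e \in p); last by case: nb; rewrite -sp; exact: path_avoiding ep vp.
case/path.splitPr: ep vp sp => p1 p2;
  rewrite valid_cat psrc_cat => /= /and3P[v1 /eqP e1 _] _.
case: p1 v1 e1 => [|f p1] v1 e1; first by exists p2.
by case: (@structure_acyclic (rng e) (f :: p1) nK).
Qed.

Lemma circle_gate e : K (rng e) -> (0 < rho (src e))%N -> gate e.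
Proof.
move=> Ke re; have ne : src e <> rng e.
  by have [_ [h|h]] := fs_rho fs Ke => E; rewrite E in h re; lia.
split=> // -[|f p] /= vp sp; first by case: ne.
case/andP: vp => /eqP fe _; exists p; congr cons.
by apply/esym/(fs_in_uniq fs Ke).
Qed.

Lemma ends_uniq e f : rng e = rng f -> src e = src f -> e = f.
Proof.
move=> er es; have [Ke|nK] := pselect (K (rng e)); first exact: (fs_in_uniq fs Ke).
apply: contrapT => ef; apply: (fs_bridge fs nK); apply: rst_step.
by exists f; split=> // fe; apply: ef.
Qed.

Lemma finite_edges : exists Es : seq (edge G), uniq Es /\ forall e, e \in Es.
Proof.
have /finite_seqP[s sE] := fs_fin fs.
have sT v : v \in s by have : [set: vert G] v by []; rewrite sE.
pose pick (xy : vert G * vert G) : option (edge G) :=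
  if pselect (exists e, rng e = xy.1 /\ src e = xy.2) is left h then Some (sval (cid h))
  else None.
exists (undup (pmap pick [seq (x, y) | x <- s, y <- s])); split; first exact: undup_uniq.
move=> e; rewrite mem_undup mem_pmap; apply/mapP; exists (rng e, src e).
  by apply/allpairsP; exists (rng e, src e).
rewrite /pick; case: pselect => [h|]; last by case; exists e.
by case: (cid h) => f /= [fr fs']; congr Some; apply: ends_uniq.
Qed.

(** By [exit_gate] a path from [src e] to [rng e] is [e q] with [q] closed at [src e], and [src e]
    lies on no cycle. So the corner containing [d (L e)] is spanned by [L e]. *)
Lemma scalar_value d e : good_der d -> kills_vert d -> ~ K (rng e) -> ~ K (src e) ->
  exists a : R[i], d (L e) = a *: L e.
Proof.
move=> [dd _] kv nr ns; have [dA _ _] := dd.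
have ve : valid_path (rng e) [:: e] by rewrite /= eqxx.
have dE : d (L e) = P (rng e) * d (L e) * P (src e).
  by apply: der_corner => //; rewrite ?PL ?LP//; exact: algebra_L.
exists (cf (d (L e)) (vtx (src e)) (epath e)); rewrite {1}dE.
pose F S := S - cf S (vtx (src e)) (epath e) *: L e.
have dP : cf (d (L e)) (vtx (src e)) (epath e) =
    cf (P (rng e) * d (L e) * P (src e)) (vtx (src e)) (epath e) by rewrite -dE.
apply/eqP; rewrite dP -subr_eq0; apply/eqP.
have Ae : A (d (L e)) by apply: dA; exact: algebra_L.
apply: (@corner_ind R G F 2 (rng e) (src e) _ _ _ _ _ Ae) => [S T|a S|S|p vp sp].
- by rewrite /F cfD cfN scalerBl !opprD !opprK addrACA.
- by rewrite /F cfZ scalerBr scalerA.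
- rewrite /F (le_trans (opnormD_le _ _))// opnormN opnormZ mulrDl mul1r lerD2l.
  apply: (le_trans (ler_wpM2l (normc_ge0 _) (Lop_norm R _ _))); rewrite mulr1.
  exact: cf_le.
- have [_ ge] := exit_gate nr; have [q pq] := ge p vp sp; subst p.
  case: q vp sp => [|g q] vp sp; last first.
    case: (@structure_acyclic (src e) (g :: q) ns); split=> //.
    by move: vp => /= /andP[].
  rewrite /F cf_Lop asboolT ?scale1r ?subrr//.
  exact: (pre_vtx ve).
Qed.

Lemma scalar_shift d e : good_der d -> kills_vert d -> ~ K (rng e) -> ~ K (src e) ->
  exists T, [/\ A T, kills_vert (der_shift d T), der_shift d T (L e) = 0 &
    forall f, f <> e -> der_shift d T (L f) = d (L f)].
Proof.
move=> gd kv nr ns; have [a ae] := scalar_value gd kv nr ns.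
have /finite_seqP[s0 sE] := fs_fin fs; pose s := undup s0.
have us : uniq s by exact: undup_uniq.
have sT v : v \in s by rewrite mem_undup; have : [set: vert G] v by []; rewrite sE.
(* The side of the bridge [e] containing [src e]. The projection [T] onto paths with range there
   commutes with all other [L f], and its commutator with [L e] is [L e]. *)
pose h x := `[< clos_refl_sym_trans (vert G) (uedge (fun f => f <> e)) (src e) x >].
pose T := \sum_(x <- s | h x) P x.
have AT : A T.
  by apply: (sublin_sum (@algebra_sublin R G)) => x _ _; exact: algebra_P.
have TL S y : S * P y = S -> S * T = if h y then S else 0.
  move=> SE; rewrite /T mulr_sumr big_mkcond (bigD1_seq y)//= SE.
  rewrite big1 ?addr0// => x /eqP xy; case: ifP => // _.
  by rewrite -SE -mulrA PP0 ?mulr0// => /esym.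
have TR S y : P y * S = S -> T * S = if h y then S else 0.
  move=> SE; rewrite /T mulr_suml big_mkcond (bigD1_seq y)//= SE.
  rewrite big1 ?addr0// => x /eqP xy; case: ifP => // _.
  by rewrite -SE mulrA PP0 ?mul0r.
have hr : h (rng e) = false by apply: asboolF; exact: (fs_bridge fs nr).
have hs : h (src e) by apply/asboolP; exact: rst_refl.
exists (a *: T); split.
- exact: (sublinZ _ (@algebra_sublin R G)).
- move=> y; rewrite /der_shift kv bop_scalerAr bop_scalerAl -scalerBr.
  by rewrite (TL _ y) ?(TR _ y) ?PP// subrr scaler0 subr0.
- rewrite /der_shift ae bop_scalerAr bop_scalerAl -scalerBr.
  by rewrite (TL _ (src e)) ?LP// (TR _ (rng e)) ?PL// hs hr subr0 subrr.
- move=> f fe; rewrite /der_shift bop_scalerAr bop_scalerAl -scalerBr.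
  rewrite (TL _ (src f)) ?LP// (TR _ (rng f)) ?PL//.
  have -> : h (src f) = h (rng f).
    apply/asboolP/asboolP => hx; apply: rst_trans hx _; last apply: rst_sym;
    by apply: rst_step; exists f.
  by rewrite subrr scaler0 subr0.
Qed.

Lemma eliminate_scalar (es : seq (edge G)) :
  (forall e, e \in es -> ~ K (rng e) /\ ~ K (src e)) ->
  (forall d, good_der d -> kills_vert d -> (forall f, f \in es -> d (L f) = 0) ->
    is_inner A d) ->
  forall d, good_der d -> kills_vert d -> is_inner A d.
Proof.
elim: es => [|e es IH] nK H; first by move=> d gd kv; apply: H.
apply: IH => [f fes|d gd kv kes]; first by apply: nK; rewrite inE fes orbT.
have [nr ns] := nK e (mem_head _ _).
have [T [AT kvT eT fT]] := scalar_shift gd kv nr ns.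
apply: (inner_shift AT); apply: H => //; first exact: good_shift.
move=> f; rewrite inE => /predU1P[->//|fes].
by have [->//|/eqP fe] := eqVneq f e; rewrite fT// kes.
Qed.

Lemma circle_path x : K x -> exists p, [/\ valid_path (bs x) p, psrc (bs x) p = x &
  forall f, f \in p -> K (rng f) /\ (0 < rho (src f))%N].
Proof.
have [n] := ubnP (rho x); elim: n x => // n IH x xn Kx.
have [r0|r0] := posnP (rho x); first by exists [::]; rewrite (fs_base fs).
have [f [fx Kf rf]] := fs_down fs Kx r0.
have [|p [vp sp pK]] := IH _ _ Kf; first by rewrite rf in xn; lia.
have [bf _] := fs_rho fs Kf; rewrite fx in bf; exists (p ++ [:: f]); split.
- by rewrite bf valid_cat vp sp /= eqxx.
- by rewrite psrc_cat bf sp.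
- move=> g; rewrite mem_cat => /orP[/pK//|]; rewrite inE => /eqP ->.
  by rewrite fx.
Qed.

Lemma circle_det v p q : K v -> valid_path v p -> valid_path v q -> size p = size q -> p = q.
Proof.
elim: p q v => [|f p IH] [|g q] v //= Kv /andP[/eqP fv vp] /andP[/eqP gv vq] [pq].
have Kf : K (rng f) by rewrite fv.
have fg : f = g by apply: (fs_in_uniq fs Kf); rewrite fv gv.
by subst g; congr cons; apply: (IH q (src f)) => //; exact: (fs_in fs Kf).
Qed.

(** The circle is [c = p e] with [d] zero on all edges of [p], so [d (L_c) = L_p d (L_e)]. This is 0
    by [cycle_der_zero], and [L_p] can be stripped off. *)
Lemma closing_edge d e : good_der d -> kills_vert d -> K (rng e) -> rho (src e) = 0%N ->
  (forall f, K (rng f) -> (0 < rho (src f))%N -> d (L f) = 0) -> d (L e) = 0.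
Proof.
move=> gd kv Ke r0 kc; have [dd _] := gd; have [dA dL dM] := dd.
have Ks := fs_in fs Ke.
have bv : bs (rng e) = src e by have [<- _] := fs_rho fs Ke; exact: (fs_base fs).
have [p [vp sp pK]] := circle_path Ke; rewrite bv in vp sp.
have vc : valid_path (src e) (p ++ [:: e]) by rewrite valid_cat vp sp /= eqxx.
have sc : psrc (src e) (p ++ [:: e]) = src e by rewrite psrc_cat.
have := cycle_der_zero gd kv vc sc.
have -> : Lop R (src e) (p ++ [:: e]) = Lop R (src e) p * L e.
  by have := LopM R [:: e] vp; rewrite sp.
rewrite dM; [|exact: algebra_Lop|exact: algebra_L].
rewrite (der_path dd kv vp) => [|f /pK[Kf rf]]; last exact: kc.
rewrite mul0r add0r => -/(_ _)/(congr1 (fun S => Ladj R (src e) p * S)).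
have dE : d (L e) = P (rng e) * d (L e) * P (src e).
  by apply: der_corner => //; rewrite ?PL ?LP//; exact: algebra_L.
rewrite mulr0 mulrA Ladj_Lop// sp {1}dE !mulrA PP -dE; apply.
move=> q vq sq; apply: (circle_det Ks); rewrite ?size_cat 1?addnC//.
- by rewrite valid_cat vc sc.
- by rewrite valid_cat vq sq.
Qed.

Lemma inner_of_structure : all_inner R G.
Proof.
move=> d0 dd0 bd0; have gd0 : good_der d0 by [].
have [T AT kv] := der_kill_vert (fs_fin fs) gd0.
apply: (inner_shift AT); have gd := good_shift AT gd0.
move: (der_shift d0 T) gd kv => {T AT gd0 bd0 dd0 d0} d gd kv.
have [Es [uE EsT]] := finite_edges.
pose scalar e := `[< ~ K (rng e) /\ ~ K (src e) >].
apply: (@eliminate_scalar [seq e <- Es | scalar e]) gd kv => [e|{}d gd kv ks].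
  by rewrite mem_filter => /andP[/asboolP].
have {}ks f : ~ K (rng f) /\ ~ K (src f) -> d (L f) = 0.
  by move=> fK; apply: ks; rewrite mem_filter EsT andbT; apply/asboolP.
(* The exits, and all circle edges but the closing ones, whose source is the base. *)
pose target e := (~ K (rng e) /\ K (src e)) \/ (K (rng e) /\ (0 < rho (src e))%N).
(* Exits come first, then each circle is worked through away from its base: the target edge ending
   at [src e] has a source with [rho] larger by one. *)
pose phi e := if `[< K (rng e) >] then rho (src e) else 0%N.
pose leT e f := (phi e <= phi f)%N.
pose es := sort leT [seq e <- Es | `[< target e >]].
have esE e : e \in es -> target e.
  by rewrite mem_sort mem_filter => /andP[/asboolP].
have tK e : target e -> K (src e) by case=> -[// Ke _]; exact: (fs_in fs Ke).
apply: (@eliminate R G es phi (fun f => ~ K (rng f) /\ ~ K (src f)) d) => //.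
- by rewrite sort_uniq filter_uniq.
- by apply: sort_sorted => e f; exact: leq_total.
- by move=> e /esE[[nr _]|[Kr r0]]; [exact: exit_gate|exact: circle_gate].
- by move=> e f /esE/tK Ks [nr ns] [E|E]; rewrite E in nr ns.
- move=> e f /esE te /esE tf fe; have Ke := tK e te; have Kf := tK f tf.
  rewrite /phi; case: te => [[nre _]|[Kre re]]; case: tf => [[nrf _]|[Krf rf]].
  + move=> _ [E|E]; last by rewrite E in nrf.
    by apply: fe; apply: (fs_out_uniq fs Kf E).
  + by rewrite asboolT// asboolF// => h; lia.
  + move=> _ [E|E]; last by rewrite E in nrf.
    by have := fs_exit fs Kf nrf; rewrite E; lia.
  + rewrite !asboolT// => h [E|E]; first by apply: fe; apply: (fs_out_uniq fs Kf E).
    have [_ [h'|h']] := fs_rho fs Krf; last by rewrite h' in rf.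
    by rewrite E in h'; lia.
move=> d' gd' kv' ks' kt'.
have kt f : target f -> d' (L f) = 0.
  by move=> tf; apply: kt'; rewrite mem_sort mem_filter EsT andbT; apply/asboolP.
apply: der_zero => // e.
have [Kr|nr] := pselect (K (rng e)); last first.
  have [Ks|ns] := pselect (K (src e)); last exact: ks'.
  by apply: kt; left.
have [r0|r0] := posnP (rho (src e)); last by apply: kt; right.
by apply: (closing_edge gd' kv' Kr r0) => f Kf rf; apply: kt; right.
Qed.

End InnerOfStructure.

(** * From fruit trees to the combinatorial structure *)

Lemma bridge_of_no_polygon (Q : digraph) :
  ~ (exists n (v : 'I_n -> vert Q) (e : 'I_n -> edge Q), is_polygon v e) ->
  forall a : edge Q,
    ~ clos_refl_sym_trans (vert Q) (uedge (fun f => f <> a)) (src a) (rng a).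
Proof.
move=> npol a conn; apply: npol.
pose r x y := `[< uedge (fun f => f <> a) x y \/ uedge (fun f => f <> a) y x >].
have [p] : exists2 p, path r (src a) p & last (src a) p = rng a.
  have := clos_rst_rst1n _ _ _ _ conn.
  elim=> [x|x y z xy _ [p yp pz]]; first by exists [::].
  by exists (y :: p) => //=; rewrite yp andbT; apply/asboolP.
(* A walk without repeated vertices, closed up by [a], is a polygon. If [a] is a loop, the walk is
   empty and the polygon has length 1. *)
case/shortenP => {}p rp up _ lp.
pose v (i : 'I_(size p).+1) := nth (src a) (src a :: p) i.
have v_inj : injective v.
  move=> i j /eqP; rewrite nth_uniq//= ?ltnS -?ltnS ?ltn_ord//.
  by move=> /eqP/val_inj.
have vS (i : 'I_(size p).+1) : (i < size p)%N -> v (ordS i) = nth (src a) p i.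
  by move=> ip; rewrite /v /= modn_small.
have eP (i : 'I_(size p).+1) : exists f : edge Q,
    [set rng f; src f] = [set v i; v (ordS i)] /\ (f = a <-> i = size p :> nat).
  have [ip|pi] := ltnP i (size p); last first.
    have ip : i = size p :> nat by apply/eqP; rewrite eqn_leq pi -ltnS ltn_ord.
    exists a; split=> //; rewrite /v /= ip modnn /= -lp.
    by rewrite (last_nth (src a)) setUC.
  have /asboolP[|] := pathP (src a) rp i ip; rewrite -vS// => -[f [fa sf rf]].
    by exists f; rewrite sf rf setUC; split=> //; split=> // h; rewrite h ltnn in ip.
  by exists f; rewrite sf rf; split=> //; split=> // h; rewrite h ltnn in ip.
pose e i := sval (cid (eP i)).
have eE i : [set rng (e i); src (e i)] = [set v i;
  v (ordS i)] /\ (e i = a <-> i = size p :> nat).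
  by rewrite /e; case: (cid _).
exists (size p).+1, v, e; split=> // [i j ij|i]; last by have [] := eE i.
have [Ei ei] := eE i; have [Ej ej] := eE j.
have [ip|ip] := eqVneq (i : nat) (size p).
  by apply: ord_inj; rewrite ip; apply/esym/ej; rewrite -ij; apply/ei.
have jp : j != size p :> nat by apply: contra_neq ip => /ej; rewrite -ij => /ei.
have ltp (k : 'I_(size p).+1) : k != size p :> nat -> (k < size p)%N.
  by move=> kp; rewrite ltn_neqAle kp -ltnS ltn_ord.
move: Ei; rewrite ij Ej => E; have [[/v_inj//]|[E1 E2]] := set2_eq E.
(* Off the closing edge there is no wrap-around, so swapped endpoints would mean both [i = j + 1]
   and [j = i + 1]. *)
move: E1 E2 => /v_inj/(congr1 val) /= + /v_inj/(congr1 val) /=.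
by have := ltp i ip; have := ltp j jp => h1 h2; rewrite !modn_small//; lia.
Qed.

Lemma shift_modn0 n b i : (b < n)%N -> (i < n)%N -> ((i + (n - b)) %% n)%N = 0%N -> i = b.
Proof.
move=> bn in_ /eqP; rewrite -/(dvdn _ _) => /dvdnP[k kE].
have k2 : (k < 2)%N by rewrite -(@ltn_pmul2r n) ?(leq_ltn_trans _ bn)// -kE; lia.
by case: k k2 kE => [|[|]] // _; lia.
Qed.

Section StructureOfFruitTree.
Variable D : fruit_data.
Local Notation H := (glued D).
Hypotheses (tree : is_fruit_tree D) (no_in : ~ exists l, is_in_fruit (l : vert (stem D))).

Let stem_bridge := bridge_of_no_polygon
  (let: And3 _ _ h := (let: And3 h _ _ := tree.1 in h) in h).

Definition on_circle (u : vert H) : Prop :=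
  match u with inl l => fruit_at D l | inr _ => True end.

(** The position renumbered so that the base has position 0; adding [n - base] stands for
    subtracting the base modulo [n]. *)
Definition circle_pos (z : vert (fruits D)) : nat :=
  let n := fruit_len D (val (tag z)) in
  ((tagged z + (n - fruit_base D (val (tag z)))) %% n)%N.

Definition circle_rank (u : vert H) : nat :=
  match u with inl _ => 0 | inr y => circle_pos (val y) end.

Definition circle_stem (u : vert H) : vert (stem D) :=
  match u with inl l => l | inr y => val (tag (val y)) end.

Definition circle_base (u : vert H) : vert H := inl (circle_stem u).

Lemma circle_pos0 (z : vert (fruits D)) :
  circle_pos z = 0%N <-> tagged z == fruit_base D (val (tag z)).
Proof.
case: z => l i; rewrite /circle_pos /=; set n := fruit_len D (val l).
set b := fruit_base D (val l); have bn : (b < n)%N by exact: ltn_ord.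
have in_ : (i < n)%N by exact: ltn_ord.
split=> [/eqP|/eqP ->]; last by rewrite subnKC ?modnn// ltnW.
rewrite -val_eqE /= => /eqP/(shift_modn0 bn in_)/eqP; exact.
Qed.

Lemma on_circle_glue z : on_circle (glue_fruit z).
Proof.
rewrite /glue_fruit; case: insubP => //= _.
by have := valP (tag z); rewrite inE.
Qed.

Lemma circle_rank_glue z : circle_rank (glue_fruit z) = circle_pos z.
Proof.
rewrite /glue_fruit; case: insubP => [y _ <-//|/negbNE /= h].
by apply/esym/circle_pos0.
Qed.

Lemma circle_stem_glue z : circle_stem (glue_fruit z) = val (tag z).
Proof. by rewrite /glue_fruit; case: insubP => [y _ <-|]. Qed.

Lemma glue_inj : injective (@glue_fruit D).
Proof.
move=> z z' E; have := congr1 circle_stem E; rewrite !circle_stem_glue => /val_inj ll'.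
move: E; rewrite /glue_fruit.
case: insubP => [y _ yz|/negbNE/eqP nz]; case: insubP => [y' _ yz'|/negbNE/eqP nz'] //.
  by move=> [yy']; rewrite -yz yy' yz'.
move=> _; case: z z' ll' nz nz' => l i [l' i'] /= ll'; subst l' => -> ->.
by [].
Qed.

Lemma stem_not_in (a : edge (stem D)) : ~ fruit_at D (rng a).
Proof.
move=> ra; apply: no_in; exists (rng a); split=> //; exists a; split=> // sr.
by apply: (@stem_bridge a); rewrite sr; exact: rst_refl.
Qed.

Lemma src_glue (b : edge (fruits D)) : @src H (inr b) = glue_fruit (src b).
Proof. by []. Qed.

Lemma rng_glue (b : edge (fruits D)) : @rng H (inr b) = glue_fruit (rng b).
Proof. by []. Qed.

Lemma circle_pos_step (b : edge (fruits D)) :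
  circle_pos (src b) = (circle_pos (rng b)).+1 \/ circle_pos (src b) = 0%N.
Proof.
case: b => l i; rewrite /circle_pos /=; set n := fruit_len D (val l).
set k := (n - _)%N; have n0 : (0 < n)%N by exact: leq_ltn_trans (ltn_ord i).
have -> : ((i.+1 %% n + k) %% n = ((i + k) %% n).+1 %% n)%N.
  by rewrite modnDml -addn1 addnAC -[in RHS]addn1 modnDml addn1.
have : ((i + k) %% n < n)%N by rewrite ltn_mod.
rewrite leq_eqVlt => /predU1P[->|lt]; first by right; rewrite modnn.
by left; rewrite modn_small.
Qed.

Lemma glued_structure : fruit_structure on_circle circle_rank circle_base.
Proof.
have [[[stem_conn _ _] leaf _] fin] := tree.
split=> //.
- move=> [a|b] [a'|b']; rewrite ?rng_glue.
  + by move=> /stem_not_in.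
  + by move=> /stem_not_in.
  + by move=> /[swap] -> /stem_not_in.
  + move=> _ /glue_inj; case: b b' => l i [l' i'] /= E.
    by congr inr.
- by move=> [a /stem_not_in//|b _]; rewrite src_glue; exact: on_circle_glue.
- move=> [a _|b]; last by rewrite rng_glue => /(_ (on_circle_glue _)).
  (* Collapsing every circle to its base turns a walk avoiding [a] in the glued graph into one in
     the stem. *)
  move=> h; apply: (@stem_bridge a);
    apply: (rst_map (g := circle_stem) _ h) => x y [[c|c] [ca <- <-]].
    by apply: rst_step; exists c; split=> // E; apply: ca; rewrite E.
  by rewrite src_glue rng_glue !circle_stem_glue; exact: rst_refl.
- move=> [a|b] [a'|b'].
  + move=> /leaf[c [_ cu]] [E] _; congr inl; rewrite -(cu a); last by left.
    by apply: cu; left.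
  + move=> _ _ [_]; rewrite rng_glue => /(_ (on_circle_glue _)) /stem_not_in //.
  + move=> _ _ []; rewrite rng_glue => /(_ (on_circle_glue _)) /stem_not_in //.
  + move=> _; rewrite !src_glue => /glue_inj E _; congr inr.
    case: b b' E => l i [l' i'] /= E.
    have ll' : l = l' := congr1 (@tag _ _) E; subst l'.
    by move/eqP: E; rewrite eq_Tagged /= => /eqP/ordS_inj ->.
- by move=> [a //|b] _; rewrite rng_glue => /(_ (on_circle_glue _)).
- move=> [a /stem_not_in//|b _];
    rewrite /circle_base src_glue rng_glue !circle_stem_glue !circle_rank_glue.
  by split; [|exact: circle_pos_step].
- move=> [l //|y] _ /= /circle_pos0; have := valP y; rewrite /= => /negPf -> //.
- move=> [l //|y] _ yr; have y0 : (0 < circle_pos (val y))%N by exact: yr.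
  case E : (val y) => [l i].
  pose b : edge (fruits D) := existT _ l (ord_pred i).
  have sb : src b = val y by rewrite E /src /= ord_predK.
  exists (inr b); rewrite src_glue rng_glue sb; split.
  + by rewrite /glue_fruit valK.
  + exact: on_circle_glue.
  + rewrite circle_rank_glue -[circle_rank _]/(circle_pos (val y)) -sb;
      have [->//|h] := circle_pos_step b.
    by rewrite -sb h in y0.
Qed.

End StructureOfFruitTree.

Lemma structure_iso (G H : digraph) (K : vert H -> Prop) rho bs :
  fruit_structure K rho bs -> digraph_iso G H ->
  exists (K' : vert G -> Prop) rho' bs', fruit_structure K' rho' bs'.
Proof.
move=> fs [fv [fe [bv be sr]]]; have [gv c1 c2] := bv.
have vi := bij_inj bv; have ei := bij_inj be.
have sE e : fv (src e) = src (fe e) by have [] := sr e.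
have rE e : fv (rng e) = rng (fe e) by have [] := sr e.
exists (K \o fv), (rho \o fv), (gv \o bs \o fv); split=> /=.
- suff -> : [set: vert G] = gv @` [set: vert H] by apply: finite_image; exact: (fs_fin fs).
  by apply/seteqP; split=> // x _; exists (fv x).
- by move=> e f; rewrite rE => Ke /(congr1 fv); rewrite !rE => /(fs_in_uniq fs Ke)/ei.
- by move=> e; rewrite rE sE; exact: (fs_in fs).
- move=> e; rewrite rE => Ke h; apply: (fs_bridge fs Ke); rewrite -sE -rE.
  apply: (rst_map (g := fv) _ h) => x y [f [fe' <- <-]]; apply: rst_step.
  by exists (fe f); split=> // /ei.
- move=> e f; rewrite !sE !rE => Ks /(congr1 fv); rewrite !sE => E KK.
  by apply/ei/(fs_out_uniq fs).
- by move=> e; rewrite sE rE; exact: (fs_exit fs).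
- by move=> e; rewrite rE sE => /(fs_rho fs)[-> h].
- by move=> x Kx /(fs_base fs Kx) ->.
- move=> x Kx /(fs_down fs Kx)[f [fx Kf rf]]; have [ge _ c4] := be.
  exists (ge f); rewrite rE c4; split=> //.
  by apply: vi; rewrite sE c4.
Qed.

Lemma inner_of_fruit_tree (R : realType) (G : digraph) :
  fruit_tree_without_in_fruit G -> all_inner R G.
Proof.
move=> [D [tree iso no_in]].
have [K [rho [bs fs]]] := structure_iso (glued_structure tree no_in) iso.
exact: inner_of_structure fs.
Qed.
Theorem corollary6p15 (R : realType) (G : digraph) :
  connected_digraph G -> ~ strongly_connected G ->
  ((forall d : bop R (dpath G) -> bop R (dpath G),
      is_derivation (graph_algebra R G) d ->
      bounded_on (graph_algebra R G) d ->
      is_inner (graph_algebra R G) d)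
   <-> fruit_tree_without_in_fruit G).
Proof.
move=> conn nsc; split; first exact: fruit_tree_of_inner.
exact: inner_of_fruit_tree.
Qed.
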